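(* Assume the following. (A1) $\det(e^{-\tau A}-I)\ne 0$. (A2) $L\ge 0$, $M\ge 1$, $\omega>0$ are constants such that $\|g'(\xi)\|\le L$ for all $\xi\in D$ and $\|e^{tA}\|\le Me^{\omega|t|}$ for all $t\in[-\tau,\tau]$. (A5) $\displaystyle S=\frac{\sqrt n\,MLR_\tau\,(e^{(\|A\|+L+\omega)\tau}-1)}{\|A\|+L+\omega}<1$. (A6) $g\in C^2(D;\mathbb R^n)$ and there is a constant $\bar H\ge 0$ such that for every $k=1,\dots,n$ and every $\xi\in D$ the Hessian matrix $\left(\frac{\partial^2 g_k(\xi)}{\partial\xi_i\partial\xi_j}\right)_{i,j=1}^n$ of the component $g_k$ has norm at most $\bar H$. Let $x^{(0)}\in X_D$, $u\in L^\infty([0,\tau];\mathbb R^n)$, and $r>0$ be such that $\overline{B_r(x^{(0)})}\subset X_D$, and assume that $$0<h:=\rho_0(x^{(0)},u)\,\rho_1^2\,\rho_2\le\frac12,\qquad r_0:=\frac{1-\sqrt{1-2h}}{h}\,\rho_0(x^{(0)},u)\,\rho_1\le r .$$ Then there exists an $x^*\in\overline{B_{r_0}(x^{(0)})}$ such that $P(x^* )=0$, and both the modified Newton scheme $$x^{(k+1)}=x^{(k)}-[P'(x^{(0)})]^{-1}P(x^{(k)}),\quad k=0,1,\dots,$$ and the classical Newton scheme $$\tilde x^{(k+1)}=\tilde x^{(k)}-[P'(\tilde x^{(k)})]^{-1}P(\tilde x^{(k)}),\quad \tilde x^{(0)}=x^{(0)},\quad k=0,1,\dots,$$ converge to $x^*$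 in $X$ as $k\to+\infty$. With $\eta=\rho_0(x^{(0)},u)\rho_1$, the convergence rates are estimated, for $k=0,1,\dots$, by $$\|\tilde x^{(k)}-x^*\|\le 2^{1-k}(2h)^{2^k-1}\eta,\qquad \|x^{(k)}-x^*\|\le\frac{\eta}{h}\left(1-\sqrt{1-2h}\right)^{k+1}.$$ Moreover, if $h<\frac12$, then the zero $x^*$ of $P$ is unique in $B_r(x^{(0)})\cap B_{r_1}(x^{(0)})$, where $r_1=\frac{1+\sqrt{1-2h}}{h}\eta$; and if $h=\frac12$, then $x^*$ is unique in $\overline{B_{r_0}(x^{(0)})}$.
   Context: Let $\tau>0$, $D\subset\mathbb R^n$ a domain (open connected set) containing the origin, $A$ a constant real $n\times n$ matrix, $g=(g_1,\dots,g_n)^\top\in C^1(D;\mathbb R^n)$ with Jacobian matrix $g'(\xi)$, and $u\in L^\infty([0,\tau];\mathbb R^n)$. $\|\cdot\|$ on $\mathbb R^n$ is the Euclidean norm, on matrices the induced 2-norm; $I$ is the identity matrix. $X=C([0,\tau];\mathbb R^n)$ has the norm $\|x\|=\sup_{t\in[0,\tau]}\|x(t)\|$, and $X_D=C([0,\tau];D)$. $B_r(x)$ denotes the open ball in $X$ of radius $r$ centered at $x$, and $\overline{B_r(x)}$ its closure. $\|u\|_{L^\infty[0,\tau]}$ is the essential supremum of $\|u(t)\|$. Under $\det(e^{-\tau A}-I)\neq 0$, the operator $P:X_D\to X$ is $P(x)=\mathcal F(x)-x$, where $$\mathcal F(x)(t)=e^{tA}c(x)+\int_0^t e^{(t-s)A}[g(x(s))+u(s)]\,ds,$$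 $$c(x)=(e^{-\tau A}-I)^{-1}\int_0^\tau e^{-sA}[g(x(s))+u(s)]\,ds .$$ (Zeros of $P$ are the Carathéodory solutions of $\dot x=Ax+g(x)+u(t)$ on $[0,\tau]$ with $x(0)=x(\tau)$.) $P'(x)$ denotes the Fréchet derivative of $P$ at $x$. Constants: $R_\tau=\|(e^{-\tau A}-I)^{-1}\|$, $\phi_L(t)=\sqrt n\,e^{(\|A\|+L)t}$, $$\rho_0(x,u)=\|x\|+\frac{M(e^{\omega\tau}-1)(1+MR_\tau e^{\omega\tau})}{\omega}\left(\|u\|_{L^\infty[0,\tau]}+\sup_{t\in[0,\tau]}\|g(x(t))\|\right),$$ $$\rho_1=1+\frac{LMR_\tau(e^{\omega\tau}-1)\phi_L(\tau)}{(1-S)\omega}+\frac{L\phi_L(\tau)(\phi_L(\tau)-\sqrt n)}{\|A\|+L}\left(1+\frac{LMR_\tau(e^{\omega\tau}-1)\phi_L(\tau)}{(1-S)\omega}\right),$$ $$\rho_2=\frac{\sqrt n\,\bar H M(e^{\omega\tau}-1)(1+MR_\tau e^{\omega\tau})}{\omega}.$$ *)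

(* Defs.v *)
From HB Require Import structures.
From mathcomp Require Import all_boot all_order all_algebra.
From mathcomp Require Import all_classical all_reals all_analysis.
From mathcomp Require Import ring.

Set Implicit Arguments.
Unset Strict Implicit.
Unset Printing Implicit Defensive.
Import Order.TTheory GRing.Theory Num.Theory.
Import numFieldNormedType.Exports.

Local Open Scope classical_set_scope.
Local Open Scope ring_scope.

(* The library norm `|v| on matrices is the max norm; norm2 is the Euclidean  *)
(* norm and opnorm2 the operator norm it induces on square matrices.          *)
Definition norm2 (R : realType) (n : nat) (v : 'cV[R]_n) : R :=
  Num.sqrt (\sum_(i < n) v i 0 ^+ 2).

Definition opnorm2 (R : realType) (n : nat) (A : 'M[R]_n) : R :=
  sup [set norm2 (A *m v) | v in [set v : 'cV[R]_n | norm2 v <= 1]].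

Definition expmx (R : realType) (n : nat) (A : 'M[R]_n) : 'M[R]_n :=
  limn (series (fun k => (k`!%:R)^-1 *: A ^+ k)).

Section norm2_theory.
Variables (R : realType) (n : nat).
Implicit Types v w : 'cV[R]_n.

Lemma sumsq_ge0 v : 0 <= \sum_(i < n) v i 0 ^+ 2.
Proof. by apply: sumr_ge0 => i _; exact: sqr_ge0. Qed.

Lemma norm2_ge0 v : 0 <= norm2 v.
Proof. exact: sqrtr_ge0. Qed.

Lemma norm20 : norm2 (0 : 'cV[R]_n) = 0.
Proof. by rewrite /norm2 big1 ?sqrtr0// => i _; rewrite mxE expr0n. Qed.

Lemma norm2_eq0 v : norm2 v = 0 -> v = 0.
Proof.
move=> /eqP; rewrite sqrtr_eq0 => v0.
have {}v0 : \sum_(i < n) v i 0 ^+ 2 == 0 by rewrite eq_le v0 sumsq_ge0.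
move: v0; rewrite psumr_eq0; last by move=> i _; exact: sqr_ge0.
move=> /allP v0; apply/colP => i; rewrite mxE; apply/eqP.
by have := v0 i (mem_index_enum _); rewrite sqrf_eq0.
Qed.

Lemma norm2Z (l : R) v : norm2 (l *: v) = `|l| * norm2 v.
Proof.
rewrite /norm2 -sqrtr_sqr -sqrtrM ?sqr_ge0// mulr_sumr.
by congr (Num.sqrt _); apply: eq_bigr => i _; rewrite mxE exprMn.
Qed.

Lemma cauchy_schwarz (a b : 'I_n -> R) :
  (\sum_i a i * b i) ^+ 2 <= (\sum_i a i ^+ 2) * (\sum_i b i ^+ 2).
Proof.
suff : 0 <= ((\sum_i a i ^+ 2) * (\sum_i b i ^+ 2)
             - (\sum_i a i * b i) ^+ 2) *+ 2.
  by rewrite pmulrn_lge0// subr_ge0.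
have E1 : (\sum_i a i ^+ 2) * (\sum_i b i ^+ 2)
    = \sum_i \sum_j a i ^+ 2 * b j ^+ 2.
  by rewrite mulr_suml; apply: eq_bigr => i _; rewrite mulr_sumr.
have E2 : (\sum_i a i ^+ 2) * (\sum_i b i ^+ 2)
    = \sum_i \sum_j a j ^+ 2 * b i ^+ 2 by rewrite E1 exchange_big.
have E3 : (\sum_i a i * b i) ^+ 2 = \sum_i \sum_j (a i * b i) * (a j * b j).
  by rewrite expr2 mulr_suml; apply: eq_bigr => i _; rewrite mulr_sumr.
rewrite mulrnBl mulr2n {1}E1 E2 E3 -mulr_natl -big_split/=.
rewrite mulr_sumr -sumrB; apply: sumr_ge0 => i _.
rewrite -big_split/= mulr_sumr -sumrB; apply: sumr_ge0 => j _.
have -> : a i ^+ 2 * b j ^+ 2 + a j ^+ 2 * b i ^+ 2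
    - 2%:R * (a i * b i * (a j * b j)) = (a i * b j - a j * b i) ^+ 2 by ring.
exact: sqr_ge0.
Qed.

Lemma norm2D v w : norm2 (v + w) <= norm2 v + norm2 w.
Proof.
rewrite -(@ler_pXn2r _ 2)// ?nnegrE ?addr_ge0 ?norm2_ge0//.
rewrite sqrrD !sqr_sqrtr ?sumsq_ge0// -sqrtrM ?sumsq_ge0//.
have -> : \sum_i (v + w) i 0 ^+ 2 = \sum_i v i 0 ^+ 2
    + (\sum_i v i 0 * w i 0) *+ 2 + \sum_i w i 0 ^+ 2.
  by rewrite -sumrMnl -!big_split/=; apply: eq_bigr => i _; rewrite mxE sqrrD.
rewrite lerD2r lerD2l lerMn2r/= (le_trans (ler_norm _))//.
by rewrite -sqrtr_sqr ler_sqrt ?mulr_ge0 ?sumsq_ge0//; exact: cauchy_schwarz.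
Qed.

Lemma norm2_le_mxnorm v : norm2 v <= n%:R * `|v|.
Proof.
have h i : `|v i 0| <= `|v|.
  by rewrite [leRHS]/Num.norm/= mx_normrE; exact: (le_bigmax _ _ (i, 0)).
have nv : 0 <= n%:R * `|v| by rewrite mulr_ge0.
rewrite -(@ler_pXn2r _ 2)// ?nnegrE ?norm2_ge0// sqr_sqrtr ?sumsq_ge0//.
apply: (@le_trans _ _ (\sum_(i < n) `|v| ^+ 2)).
  apply: ler_sum => i _; rewrite -real_normK ?num_real//.
  by rewrite ler_pXn2r// nnegrE.
rewrite sumr_const card_ord exprMn -[leLHS]mulr_natl; apply: ler_wpM2r.
  exact: sqr_ge0.
by rewrite -natrX ler_nat; case: (n) => // m; rewrite -[leqLHS]expn1 leq_pexp2l.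
Qed.

End norm2_theory.

(* CX tau n is C([0,tau]; R^n): a continuous function on [0,tau] is           *)
(* represented by its extension by 0 to R, so that equality in CX tau n is    *)
(* equality on [0,tau].                                                       *)
Definition contI (R : realType) (tau : R) (n : nat) :
    {pred (R -> 'cV[R]_n)} :=
  [pred f : R -> 'cV[R]_n |
    `[< {within `[0, tau], continuous f} /\
        forall t : R, ~ `[0, tau]%classic t -> f t = 0 >] ].

Arguments contI {R} tau n.

Section contI_closed.
Variables (R : realType) (tau : R) (n : nat).

Lemma contI_submod_closed : submod_closed (contI tau n).
Proof.
split.
  apply/asboolP; split; last by [].
  by move=> t; exact: cvg_cst.
move=> l f g /asboolP[fc f0] /asboolP[gc g0]; apply/asboolP; split.
  by move=> t; apply: cvgD; [apply: cvgZr; exact: fc|exact: gc].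
by move=> t ht; rewrite !fctE f0// g0// scaler0 addr0.
Qed.

HB.instance Definition _ := GRing.isSubmodClosed.Build R (R -> 'cV[R]_n)
  (contI tau n) contI_submod_closed.

End contI_closed.

Record CX (R : realType) (tau : R) (n : nat) := MkX {
  Xfun :> R -> 'cV[R]_n ; _ : Xfun \in contI tau n }.

HB.instance Definition _ (R : realType) (tau : R) (n : nat) :=
  [isSub for @Xfun R tau n].
HB.instance Definition _ (R : realType) (tau : R) (n : nat) :=
  [Choice of CX tau n by <:].
HB.instance Definition _ (R : realType) (tau : R) (n : nat) :=
  [SubChoice_isSubLmodule of CX tau n by <:].

(* The supremum of the empty set (case tau < 0) is 0. *)
Definition Xnorm (R : realType) (tau : R) (n : nat) (x : CX tau n) : R :=
  sup [set norm2 (x t) | t in `[0, tau]].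

Section Xnorm_theory.
Variables (R : realType) (tau : R) (n : nat).
Implicit Types x y : CX tau n.

Lemma X_cont x : {within `[0, tau], continuous x}.
Proof. by case: x => f /= /asboolP[]. Qed.

Lemma X_out x t : ~ `[0, tau]%classic t -> x t = 0.
Proof. by case: x => f /= /asboolP[_]; apply. Qed.

Lemma Xfun_inj x y : (forall t, `[0, tau]%classic t -> x t = y t) -> x = y.
Proof.
move=> xy; apply: val_inj; apply/funext => t /=.
by have [/xy//|ht] := pselect (`[0, tau]%classic t); rewrite !X_out.
Qed.

Lemma XaddE x y t : (x + y) t = x t + y t. Proof. by []. Qed.
Lemma XscaleE (l : R) x t : (l *: x) t = l *: x t. Proof. by []. Qed.
Lemma XzeroE t : (0 : CX tau n) t = 0. Proof. by []. Qed.

Lemma Xnorm_bounded x : has_ubound [set norm2 (x t) | t in `[0, tau]].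
Proof.
have : compact (x @` `[0, tau]).
  by apply: continuous_compact; [exact: X_cont|exact: segment_compact].
move=> /compact_bounded[m [_ hm]].
exists (n%:R * (m + 1)) => _ [t ht <-].
rewrite (le_trans (norm2_le_mxnorm _))// ler_wpM2l//.
by apply: (hm (m + 1)); [rewrite ltrDl|exists t].
Qed.

Lemma norm2_le_Xnorm x t : norm2 (x t) <= Xnorm x.
Proof.
have [ht|ht] := pselect (`[0, tau]%classic t).
  by apply: ub_le_sup; [exact: Xnorm_bounded|exists t].
rewrite X_out// norm20 /Xnorm.
have [->|/set0P[_ [s hs _]]] := eqVneq [set norm2 (x t0) | t0 in `[0, tau]] set0.
  by rewrite sup0.
apply: (le_trans (norm2_ge0 (x s))).
by apply: ub_le_sup; [exact: Xnorm_bounded|exists s].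
Qed.

Lemma Xnorm_ge0 x : 0 <= Xnorm x.
Proof. exact: le_trans (norm2_ge0 (x 0)) (norm2_le_Xnorm x 0). Qed.

Lemma Xnorm_le x (m : R) : 0 <= m ->
  (forall t, `[0, tau]%classic t -> norm2 (x t) <= m) -> Xnorm x <= m.
Proof.
move=> m0 xm; rewrite /Xnorm.
have [->|/set0P ne] := eqVneq [set norm2 (x t0) | t0 in `[0, tau]] set0.
  by rewrite sup0.
by apply: ge_sup => // _ [t ht <-]; exact: xm.
Qed.

Lemma XnormD x y : Xnorm (x + y) <= Xnorm x + Xnorm y.
Proof.
apply: Xnorm_le; first by rewrite addr_ge0 ?Xnorm_ge0.
move=> t ht; rewrite XaddE (le_trans (norm2D _ _))//.
by rewrite lerD// norm2_le_Xnorm.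
Qed.

Lemma XnormZ (l : R) x : Xnorm (l *: x) = `|l| * Xnorm x.
Proof.
have le a y : Xnorm (a *: y) <= `|a| * Xnorm y.
  apply: Xnorm_le; first by rewrite mulr_ge0 ?Xnorm_ge0.
  by move=> t ht; rewrite XscaleE norm2Z ler_wpM2l ?norm2_le_Xnorm.
apply/eqP; rewrite eq_le le/=.
have [->|l0] := eqVneq l 0; first by rewrite normr0 mul0r Xnorm_ge0.
rewrite -{1}[x](scalerK l0) mulrC -ler_pdivlMr ?normr_gt0//.
by rewrite mulrC -normfV; exact: le.
Qed.

Lemma Xnorm0_eq0 x : Xnorm x = 0 -> x = 0.
Proof.
move=> x0; apply: Xfun_inj => t ht; apply: norm2_eq0; apply/eqP.
by rewrite eq_le norm2_ge0 andbT -x0 norm2_le_Xnorm.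
Qed.

End Xnorm_theory.

HB.instance Definition _ (R : realType) (tau : R) (n : nat) :=
  Lmodule_isNormed.Build R (CX tau n)
    (@XnormD R tau n) (@XnormZ R tau n) (@Xnorm0_eq0 R tau n).

Definition X_in (R : realType) (tau : R) (n : nat) (D : set 'cV[R]_n) :
    set (CX tau n) :=
  [set x | forall t, `[0, tau]%classic t -> D (x t)].

Definition partial (R : realType) (n : nat) (j : 'I_n) (f : 'cV[R]_n -> R) :
    'cV[R]_n -> R :=
  fun xi => 'D_(delta_mx j 0) f xi.

(* f is of class C^k on D, which is meant to be open. *)
Fixpoint Ck (R : realType) (n : nat) (D : set 'cV[R]_n) (k : nat)
    (f : 'cV[R]_n -> R) : Prop :=
  match k with
  | 0 => forall xi, D xi -> {for xi, continuous f}
  | k'.+1 => (forall xi, D xi -> {for xi, continuous f}) /\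
      forall j : 'I_n,
        (forall xi, D xi -> derivable f xi (delta_mx j 0)) /\
        Ck D k' (partial j f)
  end.

Definition coordf (R : realType) (n : nat) (g : 'cV[R]_n -> 'cV[R]_n)
    (k : 'I_n) : 'cV[R]_n -> R :=
  fun xi => g xi k 0.

Definition Ckv (R : realType) (n : nat) (D : set 'cV[R]_n) (k : nat)
    (g : 'cV[R]_n -> 'cV[R]_n) : Prop :=
  forall i : 'I_n, Ck D k (coordf g i).

(* The library's jacobian acts on row vectors: it is the transpose of this. *)
Definition jacobian_mx (R : realType) (n : nat) (g : 'cV[R]_n -> 'cV[R]_n)
    (xi : 'cV[R]_n) : 'M[R]_n :=
  \matrix_(i < n, j < n) partial j (coordf g i) xi.

Definition hessian_mx (R : realType) (n : nat) (f : 'cV[R]_n -> R)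
    (xi : 'cV[R]_n) : 'M[R]_n :=
  \matrix_(i < n, j < n) partial i (partial j f) xi.

Definition Linfty_norm (R : realType) (tau : R) (n : nat)
    (u : R -> 'cV[R]_n) : \bar R :=
  Lnorm (mrestr (@lebesgue_measure R) (measurable_itv `[0, tau])) +oo%E
    (fun t => (norm2 (u t))%:E).

(* A class in L^oo([0,tau]; R^n) is given by a Borel representative u. *)
Definition Linfty (R : realType) (tau : R) (n : nat) (u : R -> 'cV[R]_n) :
    Prop :=
  (forall i : 'I_n, measurable_fun `[0, tau] (fun t => u t i 0)) /\
  (Linfty_norm tau u < +oo)%E.

Definition intv (R : realType) (n : nat) (a b : R) (f : R -> 'cV[R]_n) :
    'cV[R]_n :=
  \col_(i < n) \int[lebesgue_measure]_(s in `[a, b]) (f s i 0).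

Section operator.
Variables (R : realType) (tau : R) (n : nat).
Variables (A : 'M[R]_n) (g : 'cV[R]_n -> 'cV[R]_n) (u : R -> 'cV[R]_n).

Definition cvec (x : R -> 'cV[R]_n) : 'cV[R]_n :=
  invmx (expmx (- tau *: A) - 1%:M) *m
  intv 0 tau (fun s => expmx (- s *: A) *m (g (x s) + u s)).

Definition calF (x : R -> 'cV[R]_n) (t : R) : 'cV[R]_n :=
  expmx (t *: A) *m cvec x +
  intv 0 t (fun s => expmx ((t - s) *: A) *m (g (x s) + u s)).

(* FX x has the values calF x t for t in [0,tau]: calF x is continuous on     *)
(* [0,tau] for every x with values in D, so the default value 0 of insubd can *)
(* occur only for x not in X_in D, where g need not be continuous.            *)
Definition FX (x : CX tau n) : CX tau n :=
  insubd (0 : CX tau n) (patch (fun=> 0) `[0, tau] (calF x)).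

Definition Pop (x : CX tau n) : CX tau n := FX x - x.

Lemma PopE (x : CX tau n) : {within `[0, tau], continuous (calF x)} ->
  forall t, `[0, tau]%classic t -> Pop x t = calF x t - x t.
Proof.
move=> h t ht.
have xB (y z : CX tau n) : (y - z) t = y t - z t by [].
have hF : patch (fun=> 0) `[0, tau] (calF x) \in contI tau n.
  apply/asboolP; split.
    apply: (subspace_eq_continuous _ h) => s hs.
    by rewrite /= /from_subspace/= patchT.
  by move=> s hs; rewrite /patch memNset.
have vE : val (FX x) = patch (fun=> 0) `[0, tau] (calF x).
  by rewrite /FX insubdK.
rewrite /Pop (xB (FX x) x); congr (_ - _).
by rewrite -[LHS]/(val (FX x) t) vE /patch mem_set.
Qed.

End operator.

Section newton.
Variables (R : realType) (V : normedModType R).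

(* The set-theoretic inverse of T, meaningful when T is bijective. *)
Definition inv_op (T : V -> V) : V -> V := 'pinv_(fun=> 0) [set: V] T.

Definition invertible_op (T : V -> V) : Prop :=
  bijective T /\ continuous (inv_op T).

Definition modified_newton (Q : V -> V) (x0 : V) (k : nat) : V :=
  iter k (fun x => x - inv_op ('d Q x0) (Q x)) x0.

Definition newton (Q : V -> V) (x0 : V) (k : nat) : V :=
  iter k (fun x => x - inv_op ('d Q x) (Q x)) x0.

End newton.

Section constants.
Variables (R : realType) (tau : R) (n : nat).
Variables (A : 'M[R]_n) (g : 'cV[R]_n -> 'cV[R]_n).
Variables (L M omega Hbar : R).

Definition Rtau : R := opnorm2 (invmx (expmx (- tau *: A) - 1%:M)).

Definition phi (t : R) : R := Num.sqrt n%:R * expR ((opnorm2 A + L) * t).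

Definition Sconst : R :=
  Num.sqrt n%:R * M * L * Rtau * (expR ((opnorm2 A + L + omega) * tau) - 1) /
  (opnorm2 A + L + omega).

Definition rho0 (x : CX tau n) (u : R -> 'cV[R]_n) : R :=
  `|x| +
  M * (expR (omega * tau) - 1) * (1 + M * Rtau * expR (omega * tau)) / omega *
  (fine (Linfty_norm tau u) + sup [set norm2 (g (x t)) | t in `[0, tau]]).

Definition rho1 : R :=
  1
  + L * M * Rtau * (expR (omega * tau) - 1) * phi tau / ((1 - Sconst) * omega)
  + L * phi tau * (phi tau - Num.sqrt n%:R) / (opnorm2 A + L) *
    (1 + L * M * Rtau * (expR (omega * tau) - 1) * phi tau /
         ((1 - Sconst) * omega)).

Definition rho2 : R :=
  Num.sqrt n%:R * Hbar * M * (expR (omega * tau) - 1) *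
  (1 + M * Rtau * expR (omega * tau)) / omega.

End constants.

(* Main.v *)
From HB Require Import structures.
Require Import Defs.
From mathcomp Require Import all_boot all_order all_algebra.
From mathcomp Require Import all_classical all_reals all_analysis.
From mathcomp Require Import ring lra.

(** The theorem is Kantorovich's convergence theorem for Newton's method, applied
    to [P x = F x - x] on the Banach space [C([0, tau]; R^n)]. That theorem needs
    three numbers: a bound of the residual at the starting point, a bound of the
    inverse of the derivative there, and a Lipschitz constant of the derivative.
    They are [rho0], [rho1] and [rho2].

    The abstract part. Newton's method for [Q] is compared with Newton's method
    for the quadratic polynomial [c/2 t^2 - t + e], with [c] the product of the bound
    of the inverse and the Lipschitz constant, and [e] a bound of the first step;
    the hypothesis [c e <= 1/2] says that it has real roots. At each iterate the
    Neumann series ([bijective_perturbation]) and the Taylor estimate give new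
    constants, for which the ball certain to contain a zero is nested in the
    previous one ([newton_stateS], [kroot_step]); the product [c e] decays
    quadratically ([newton_states]), which gives the rate. The modified scheme is
    treated in the opposite direction: given a zero [y] in the closed ball, its
    iterates are shown to converge to [y] with a rate given by the scalar iterates
    ([modified_newton_rate]). Applied to the limit of Newton's method this is the
    convergence of the modified scheme, and applied to any other zero it is
    uniqueness.

    The operator. [F x] is [Kop (g \o x + u)], where the linear operator [Kop] sends
    a forcing term [f] to the [tau]-periodic solution of [y' = A y + f]. So [P x - P y]
    and the derivative [v |-> Kop (g' (x) v) - v] are controlled by pointwise bounds
    of [g] and by the norm [kappa] of [Kop] on bounded functions ([norm2_Kop_le]):
    the residual bound is immediate, and the Lipschitz bound and the Taylor estimate
    for [P] ([Pop_C11]) follow from those for [g], obtained coordinate by coordinate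
    from the Hessians, hence the factor [sqrt n] in [rho2]. Since [u] is only
    essentially bounded it is first replaced by a representative bounded everywhere.

    The inverse of the derivative. The equation [v = Kop (g' v) - w] is solved by
    iteration. A plain contraction argument fails, because [g'] is not small. But
    [v |-> Kop (g' v)] is dominated by a positive integral operator, for which
    [e^((a + L) t)], with [a] the norm of [A], is a strict supersolution exactly because
    [S < 1] ([norm2_Kop_weighted]): in the sup norm with this weight the iteration is a
    contraction. A second supersolution, now of the inhomogeneous problem, bounds
    all the iterates ([norm2_Kop_supersolution]); its maximum is at most [rho1]
    ([rho1_majorant]). *)

Set Implicit Arguments.
Unset Strict Implicit.
Unset Printing Implicit Defensive.
Import Order.TTheory GRing.Theory Num.Theory.
Import numFieldNormedType.Exports measurable_realfun.

Local Open Scope classical_set_scope.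
Local Open Scope ring_scope.

(** * Fixed points by iteration *)

Section Sequences.
Variables (R : realType) (V : completeNormedModType R).
Implicit Types (x : V ^nat) (a b : V).

Lemma geometric_steps_cvg x (C q : R) : 0 <= q -> q < 1 ->
  (forall k, `|x k.+1 - x k| <= C * q ^+ k) -> cvgn x.
Proof.
move=> q0 q1 hx.
have C0 : 0 <= C by have := hx 0%N; rewrite expr0 mulr1; exact: le_trans.
have ct : cvgn (series (telescope x)).
  apply: normed_cvg; apply: (@series_le_cvg _ _ (geometric C q)) => //.
  - by move=> n; exact: normr_ge0.
  - by move=> n; rewrite /geometric mulr_ge0// exprn_ge0.
  - by apply: is_cvg_geometric_series; rewrite ger0_norm.
have -> : x = (fun n => x 0%N + series (telescope x) n).
  by apply/funext => n; exact: eq_sum_telescope.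
by apply: is_cvgD => //; exact: is_cvg_cst.
Qed.

Lemma norm_cvg_le x a b (C : R) :
  x @ \oo --> a -> (forall k, `|x k - b| <= C) -> `|a - b| <= C.
Proof.
move=> xa hx.
have h : (fun k => `|x k - b|) @ \oo --> `|a - b|.
  by apply: cvg_norm; apply: cvgB => //; exact: cvg_cst.
by rewrite -(cvg_lim _ h)//; apply: limr_le; [exact: cvgP h|exact: nearW].
Qed.

Lemma squeeze_norm_cvg x a (e : R ^nat) :
  (forall k, `|x k - a| <= e k) -> e @ \oo --> 0 -> x @ \oo --> a.
Proof.
move=> hx he; apply/cvgrPdist_le => d d0.
near=> k.
rewrite distrC (le_trans (hx k))// (le_trans (ler_norm _))//.
by near: k; exact: cvgr0_norm_le.
Unshelve. all: by end_near. Qed.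

(** The factor [C] lets [Phi] be a contraction for an equivalent norm only, such
    as a weighted sup norm; the distances between consecutive iterates are still
    dominated by a geometric sequence. *)
Lemma iterates_cvg_fixpoint (Phi : V -> V) (C q : R) : 0 <= q -> q < 1 ->
  (forall k a b, `|iter k Phi a - iter k Phi b| <= C * q ^+ k * `|a - b|) ->
  forall a0, exists2 a, Phi a = a & (iter k Phi a0 @[k --> \oo] --> a).
Proof.
move=> q0 q1 hP a0.
have cx : cvgn (fun k => iter k Phi a0).
  apply: (@geometric_steps_cvg _ (C * `|Phi a0 - a0|) q) => // k.
  by rewrite mulrAC [iter k.+1 _ _]iterSr; exact: hP.
exists (limn (fun k => iter k Phi a0)) => //.
set a := limn _.
have hS : (fun k => iter k.+1 Phi a0) @ \oo --> a.
  by move: cx; rewrite -(cvg_shiftS (fun k => iter k Phi a0)).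
have hP' : (fun k => iter k.+1 Phi a0) @ \oo --> Phi a.
  apply: (@squeeze_norm_cvg _ _ (fun k => `|C * q| * `|iter k Phi a0 - a|)).
    move=> k; apply: (le_trans (hP 1%N _ _)); rewrite expr1.
    by apply: ler_wpM2r => //; exact: ler_norm.
  rewrite -[0](mulr0 `|C * q|); apply: cvgMl_tmp.
  by apply/norm_cvg0P; rewrite -(subrr a); apply: cvgB => //; exact: cvg_cst.
exact: (cvg_unique _ hP' hS).
Qed.

Lemma fixpoint_unique (Phi : V -> V) (C q : R) : 0 <= q -> q < 1 ->
  (forall k a b, `|iter k Phi a - iter k Phi b| <= C * q ^+ k * `|a - b|) ->
  forall a b, Phi a = a -> Phi b = b -> a = b.
Proof.
move=> q0 q1 hP a b ha hb.
have it k c : Phi c = c -> iter k Phi c = c by move=> hc; elim: k => // k /= ->.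
have h : (fun=> a) @ \oo --> b.
  apply: (@squeeze_norm_cvg _ _ (geometric (C * `|a - b|) q)).
    by move=> k; have := hP k a b; rewrite !it// mulrAC.
  by apply: cvg_geometric; rewrite ger0_norm.
have ca : (fun=> a) @ \oo --> a by exact: cvg_cst.
exact: cvg_unique ca h.
Qed.

End Sequences.

(** * Inverses and derivatives of operators *)

Section BoundedBelow.
Variables (R : realType) (V : normedModType R).

Lemma inv_opK (T : V -> V) : bijective T -> cancel (inv_op T) T.
Proof.
by move=> [S SK TK] w; apply: pinvK; rewrite inE; exists (S w).
Qed.

Lemma inv_op_continuous (T : {linear V -> V}) (b : R) : bijective T ->
  (forall v, `|v| <= b * `|T v|) -> invertible_op T.
Proof.
move=> bT hT; split => // w; apply/cvgrPdist_le => e e0.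
have b0 : 0 < `|b| + 1 by rewrite ltr_wpDl.
near=> z.
rewrite (le_trans (hT _))// linearB !inv_opK//.
apply: (@le_trans _ _ ((`|b| + 1) * `|w - z|)).
  by rewrite ler_wpM2r// (le_trans (ler_norm _))// lerDl.
rewrite mulrC -ler_pdivlMr//; near: z.
apply: cvgr_dist_le; first exact: cvg_id.
by rewrite divr_gt0.
Unshelve. all: by end_near. Qed.

(** ['d Q x] is the result of a choice among the linear maps that approximate [Q]
    to first order; this is how an explicit candidate [T] is recognized as the
    chosen one. *)
Lemma diff_of_quadratic (W : normedModType R) (Q : V -> W) (T : {linear V -> W})
    (x : V) (B C d : R) :
  (forall v, `|T v| <= B * `|v|) -> 0 < d ->
  (forall v, `|v| <= d -> `|Q (x + v) - Q x - T v| <= C * `|v| ^+ 2) ->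
  differentiable Q x /\ 'd Q x = T :> (V -> W).
Proof.
move=> hB d0 hC.
have cT : continuous T.
  apply/linear_bounded_continuous; exists `|B|; split; first by rewrite num_real.
  move=> M hM; near=> v; apply: (le_trans (hB v)).
  apply: (@le_trans _ _ (`|B| * 1)); last by rewrite mulr1 ltW.
  apply: (@le_trans _ _ (`|B| * `|v|)); first by rewrite ler_wpM2r// ler_norm.
  rewrite ler_wpM2l//; near: v.
have hQ : Q \o shift x = cst (Q x) + T +o_ 0 id.
  apply/eqaddoP => e e0; near=> v.
  rewrite !fctE /cst /= opprD addrA [v + x]addrC.
  have hv : `|v| <= d.
    by near: v; apply: cvgr0_norm_le => //; exact: cvg_id.
  apply: (le_trans (hC v hv)); rewrite expr2 mulrA ler_wpM2r//.
  have C1 : 0 < `|C| + 1 by rewrite ltr_wpDl.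
  apply: (@le_trans _ _ ((`|C| + 1) * `|v|)).
    by rewrite ler_wpM2r// (le_trans (ler_norm _))// lerDl.
  rewrite mulrC -ler_pdivlMr//; near: v.
  by apply: cvgr0_norm_le; [exact: cvg_id|rewrite divr_gt0].
have dQ := diff_unique cT hQ.
split; last exact: dQ.
by apply/diff_locallyP; split; rewrite dQ.
Unshelve. all: by end_near. Qed.

End BoundedBelow.

Lemma inj_surj_bijective (T U : Type) (f : T -> U) :
  injective f -> (forall w, exists v, f v = w) -> bijective f.
Proof.
move=> fi fs; have [g gK] := choice fs.
by exists g => // v; apply: fi; rewrite gK.
Qed.

(** The Neumann series as a fixed-point problem: [B' v = w] says that [v] is
    fixed by the contraction [v |-> B^-1 (w + B v - B' v)]. *)
Lemma bijective_perturbation (R : realType) (V : completeNormedModType R)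
    (B B' : {linear V -> V}) (b d : R) :
  bijective B -> (forall v, `|v| <= b * `|B v|) ->
  0 <= b -> 0 <= d -> b * d < 1 -> (forall v, `|B' v - B v| <= d * `|v|) ->
  bijective B' /\ (forall v, `|v| <= b / (1 - b * d) * `|B' v|).
Proof.
move=> bB hB b0 d0 bd1 hB'.
have hb v : `|v| <= b / (1 - b * d) * `|B' v|.
  rewrite mulrAC ler_pdivlMr ?subr_gt0//.
  have h1 := hB v.
  have h2 : `|B v| <= `|B' v| + d * `|v|.
    have -> : B v = B' v - (B' v - B v) by rewrite opprB addrC subrK.
    by rewrite (le_trans (ler_normB _ _))// lerD2l.
  have h3 : b * `|B v| <= b * (`|B' v| + d * `|v|) by rewrite ler_wpM2l.
  have h4 := le_trans h1 h3.
  by rewrite mulrBr mulr1 mulrCA lerBlDr -mulrDr [`|v| * d]mulrC.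
split => //; apply: inj_surj_bijective => [x y xy|w].
  apply/eqP; rewrite -subr_eq0 -normr_le0 (le_trans (hb _))//.
  by rewrite linearB/= xy subrr normr0 mulr0.
pose Phi v := inv_op B (w + (B v - B' v)).
have hPhi v1 v2 : `|Phi v1 - Phi v2| <= b * d * `|v1 - v2|.
  rewrite -mulrA (le_trans (hB _))// ler_wpM2l// /Phi linearB !inv_opK//.
  suff -> : w + (B v1 - B' v1) - (w + (B v2 - B' v2)) =
    B (v1 - v2) - B' (v1 - v2) by rewrite distrC.
  rewrite !linearB/= opprD addrACA subrr add0r.
  by rewrite !opprB [B' v2 - B v2]addrC addrACA opprK.
have hit k v1 v2 : `|iter k Phi v1 - iter k Phi v2| <= 1 * (b * d) ^+ k * `|v1 - v2|.
  rewrite mul1r; elim: k => [|k IH]; first by rewrite expr0 mul1r.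
  rewrite !iterS (le_trans (hPhi _ _))// exprS -[X in _ <= X]mulrA ler_wpM2l//.
  by rewrite mulr_ge0.
have [v hv _] := iterates_cvg_fixpoint (mulr_ge0 b0 d0) bd1 hit 0.
exists v; have : B (Phi v) = B v by rewrite hv.
rewrite /Phi inv_opK// addrCA => /eqP.
by rewrite -subr_eq0 addrAC subrr add0r subr_eq0 => /eqP.
Qed.

(** * The scalar majorant of Newton's method *)

(** The smaller root of the scalar majorant [c/2 t^2 - t + e]. *)
Definition kroot (R : realType) (c e : R) : R :=
  (1 - Num.sqrt (1 - 2 * (c * e))) / c.

Lemma sqrt_disc (R : realType) (c e : R) : 0 < c -> 0 < e -> c * e <= 1 / 2 ->
  exists s, [/\ s = Num.sqrt (1 - 2 * (c * e)), s ^+ 2 = 1 - 2 * (c * e),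
                0 <= s & s < 1].
Proof.
move=> c0 e0 ce; exists (Num.sqrt (1 - 2 * (c * e))).
have h2 : Num.sqrt (1 - 2 * (c * e)) ^+ 2 = 1 - 2 * (c * e).
  by rewrite sqr_sqrtr//; lra.
split=> //.
rewrite ltNge; apply/negP => h; have := exprn_ege1 2 h; rewrite h2.
have := mulr_gt0 c0 e0; lra.
Qed.

Lemma mul_kroot (R : realType) (c e : R) : 0 < c ->
  c * kroot c e = 1 - Num.sqrt (1 - 2 * (c * e)).
Proof. by move=> c0; rewrite /kroot mulrC divfK// gt_eqF. Qed.

Lemma kroot_gt0 (R : realType) (c e : R) : 0 < c -> 0 < e -> c * e <= 1 / 2 ->
  0 < kroot c e.
Proof.
move=> c0 e0 ce; have [s [hs _ _ s1]] := sqrt_disc c0 e0 ce.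
by rewrite /kroot -hs divr_gt0// subr_gt0.
Qed.

Lemma kroot_le (R : realType) (c e : R) : 0 < c -> 0 < e -> c * e <= 1 / 2 ->
  kroot c e <= 2 * e.
Proof.
move=> c0 e0 ce; have [s [hs s2 s0 s1]] := sqrt_disc c0 e0 ce.
rewrite -(ler_pM2l c0) mul_kroot// -hs mulrCA.
have : s ^+ 2 <= s by rewrite expr2 ler_piMl// ltW// s1.
by rewrite s2; lra.
Qed.

Lemma krootE (R : realType) (c e : R) : 0 < c -> 0 < e -> c * e <= 1 / 2 ->
  kroot c e = e + c / 2 * kroot c e ^+ 2.
Proof.
move=> c0 e0 ce; have [s [hs s2 s0 s1]] := sqrt_disc c0 e0 ce.
have cn : c != 0 by rewrite gt_eqF.
apply: (mulfI cn).
have -> : c * (e + c / 2 * kroot c e ^+ 2) = c * e + (c * kroot c e) ^+ 2 / 2.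
  by field.
rewrite mul_kroot// -hs -sqrrN opprB sqrrB1 s2; lra.
Qed.

(** One Newton step on the majorant changes its coefficients as below and moves
    the origin to [e]; hence the ball in which the limit is known to lie is
    contained in the previous one. *)
Lemma kroot_step (R : realType) (c e : R) : 0 < c -> 0 < e -> c * e <= 1 / 2 ->
  kroot (c / (1 - c * e)) (c * e ^+ 2 / (2 * (1 - c * e))) = kroot c e - e.
Proof.
move=> c0 e0 ce; have [s [hs s2 s0 s1]] := sqrt_disc c0 e0 ce.
have d0 : 0 < 1 - c * e by lra.
have dn : 1 - c * e != 0 by rewrite gt_eqF.
have cn : c != 0 by rewrite gt_eqF.
have hs' : Num.sqrt (1 - 2 * (c / (1 - c * e) * (c * e ^+ 2 / (2 * (1 - c * e)))))
    = s / (1 - c * e).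
  have -> : 1 - 2 * (c / (1 - c * e) * (c * e ^+ 2 / (2 * (1 - c * e)))) =
      (s / (1 - c * e)) ^+ 2.
    by rewrite exprMn s2; field.
  by rewrite sqrtr_sqr ger0_norm// divr_ge0// ltW.
by rewrite /kroot hs' -hs; field; rewrite cn dn.
Qed.

Lemma kantorovich_step_h (R : realType) (c e : R) :
  0 < c -> 0 < e -> c * e <= 1 / 2 ->
  c / (1 - c * e) * (c * e ^+ 2 / (2 * (1 - c * e))) <= 2 * (c * e) ^+ 2.
Proof.
move=> c0 e0 ce.
have d0 : 0 < 1 - c * e by lra.
have dn : 1 - c * e != 0 by rewrite gt_eqF.
have -> : c / (1 - c * e) * (c * e ^+ 2 / (2 * (1 - c * e))) =
  (c * e) ^+ 2 / (2 * (1 - c * e) ^+ 2) by field.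
rewrite ler_pdivrMr; last by rewrite mulr_gt0// exprn_gt0.
have h1 : (1 / 2) ^+ 2 <= (1 - c * e) ^+ 2 by rewrite ler_sqr ?nnegrE//; lra.
rewrite mulrAC -[leLHS]mul1r ler_wpM2r ?sqr_ge0//; lra.
Qed.

Lemma kantorovich_step_e (R : realType) (c e : R) :
  0 < c -> 0 < e -> c * e <= 1 / 2 ->
  c * e ^+ 2 / (2 * (1 - c * e)) <= c * e * e.
Proof.
move=> c0 e0 ce; rewrite ler_pdivrMr; last by lra.
rewrite expr2 mulrA -[leLHS]mulr1 ler_wpM2l ?mulr_ge0 ?(ltW c0) ?(ltW e0)//; lra.
Qed.

(** * The Newton-Kantorovich theorem *)

(** The Taylor estimate is what integrating the Lipschitz bound of the derivative
    along the segment from [y] to [x] gives. It is required up to the sphere,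
    where the limit of the iterates may lie, while derivatives are only taken
    inside. *)
Record C11_on_ball (R : realType) (V : normedModType R) (Q : V -> V) (x0 : V)
    (r K : R) : Prop := C11OnBall {
  C11_diff : forall x, `|x - x0| < r -> differentiable Q x;
  C11_lip : forall x y v, `|x - x0| < r -> `|y - x0| < r ->
    `|'d Q x v - 'd Q y v| <= K * `|x - y| * `|v|;
  C11_taylor : forall x y z, `|x - x0| <= r -> `|y - x0| <= r -> `|z - x0| < r ->
    `|Q x - Q y - 'd Q z (x - y)| <= K / 2 * (`|x - z| + `|y - z|) * `|x - y| }.

(** The induction hypothesis of Kantorovich at one iterate [x]: [b] bounds the
    inverse of the derivative and [e] the length of the next step. The ball of
    radius [kroot (b * K) e] around [x] is where the limit will be found, and
    [ns_ball] keeps it inside the domain. *)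
Record newton_state (R : realType) (V : normedModType R) (Q : V -> V) (x0 : V)
    (r K : R) (x : V) (b e : R) : Prop := NewtonState {
  ns_ball : `|x - x0| + kroot (b * K) e <= r;
  ns_bij : bijective ('d Q x);
  ns_bound : forall v, `|v| <= b * `|'d Q x v|;
  ns_b : 0 < b;
  ns_e : 0 < e;
  ns_h : b * K * e <= 1 / 2;
  ns_res : b * `|Q x| <= e }.

Section NewtonKantorovich.
Variables (R : realType) (V : completeNormedModType R).
Implicit Types (Q : V -> V) (x : V) (r K b e : R).

Let N Q x := x - inv_op ('d Q x) (Q x).

Lemma newton_state_lt Q x0 r K x b e : 0 < K ->
  newton_state Q x0 r K x b e -> `|x - x0| < r.
Proof.
move=> K0 [hb _ _ b0 e0 h _]; apply: (lt_le_trans _ hb).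
by rewrite ltrDl kroot_gt0// mulr_gt0.
Qed.

Lemma newton_state_dist Q x0 r K x b e :
  newton_state Q x0 r K x b e -> `|N Q x - x| <= e.
Proof.
move=> [_ bij hb _ _ _ res]; apply: le_trans res.
by rewrite /N addrAC subrr add0r normrN (le_trans (hb _))// inv_opK.
Qed.

Lemma newton_state_residual Q x0 r K x b e : 0 < K -> C11_on_ball Q x0 r K ->
  newton_state Q x0 r K x b e -> `|Q (N Q x)| <= K / 2 * e ^+ 2.
Proof.
move=> K0 [dQ lQ tQ] st; have he := newton_state_dist st.
have xr := newton_state_lt K0 st.
case: st => [hb bij _ b0 e0 hh _].
have hN : 'd Q x (N Q x - x) = - Q x.
  by rewrite /N addrAC subrr add0r linearN inv_opK.
have NR : `|N Q x - x0| <= r.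
  rewrite -[N Q x - x0](subrKA x) (le_trans (ler_normD _ _))//.
  rewrite addrC (le_trans _ hb)// lerD2l (le_trans he)//.
  have bK := mulr_gt0 b0 K0.
  rewrite krootE// lerDl mulr_ge0 ?sqr_ge0// divr_ge0//; exact: ltW.
have := tQ _ _ _ NR (ltW xr) xr; rewrite hN opprK subrK subrr normr0 addr0.
move=> /le_trans; apply; rewrite -mulrA ler_wpM2l ?divr_ge0 ?(ltW K0)// -expr2.
by rewrite ler_pXn2r ?nnegrE ?(ltW e0)//.
Qed.

(** The Neumann series controls the inverse of the derivative at the next
    iterate, the Taylor estimate the residual there, and [kroot_step] says that
    the new ball is nested in the old one. *)
Lemma newton_stateS Q x0 r K x b e : 0 < K -> C11_on_ball Q x0 r K ->
  newton_state Q x0 r K x b e ->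
  newton_state Q x0 r K (N Q x) (b / (1 - b * K * e))
    (b * K * e ^+ 2 / (2 * (1 - b * K * e))).
Proof.
move=> K0 hQ st.
have he := newton_state_dist st.
have hres := newton_state_residual K0 hQ st.
have xr := newton_state_lt K0 st.
case: st hQ => [hb bij bnd b0 e0 hh _] [dQ lQ tQ].
have bK := mulr_gt0 b0 K0.
have d0 : 0 < 1 - b * K * e by lra.
have hstep := kroot_step bK e0 hh.
have hball : `|N Q x - x0| + kroot (b / (1 - b * K * e) * K)
    (b * K * e ^+ 2 / (2 * (1 - b * K * e))) <= r.
  rewrite mulrAC hstep -[N Q x - x0](subrKA x).
  have := ler_normD (N Q x - x) (x - x0).
  by move: hb he; lra.
have e'0 : 0 < b * K * e ^+ 2 / (2 * (1 - b * K * e)).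
  by rewrite divr_gt0 ?mulr_gt0// ?exprn_gt0.
have h' : b / (1 - b * K * e) * K * (b * K * e ^+ 2 / (2 * (1 - b * K * e))) <= 1 / 2.
  rewrite [b / _ * K]mulrAC (le_trans (kantorovich_step_h bK e0 hh))//.
  have p0 := mulr_gt0 bK e0; nra.
have Nr : `|N Q x - x0| < r.
  apply: (lt_le_trans _ hball); rewrite ltrDl kroot_gt0//.
  by rewrite mulr_gt0// divr_gt0.
have hpert v : `|'d Q (N Q x) v - 'd Q x v| <= K * e * `|v|.
  rewrite (le_trans (lQ _ _ _ Nr xr))// ler_wpM2r// ler_wpM2l// ltW//.
have bd1 : b * (K * e) < 1 by rewrite mulrA; lra.
have [bij' bnd'] := bijective_perturbation bij bnd (ltW b0)
  (ltW (mulr_gt0 K0 e0)) bd1 hpert.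
split => //; rewrite ?divr_gt0//; first by move=> v; have := bnd' v; rewrite mulrA.
apply: (le_trans (ler_wpM2l (ltW (divr_gt0 b0 d0)) hres)).
by rewrite le_eqVlt; apply/orP; left; apply/eqP; field; rewrite gt_eqF.
Qed.

Lemma newton_iterates_close Q x0 r K j x b e : 0 < K -> C11_on_ball Q x0 r K ->
  newton_state Q x0 r K x b e -> `|iter j (N Q) x - x| <= kroot (b * K) e.
Proof.
move=> K0 hQ; elim: j x b e => [|j IH] x b e st.
  by case: st => *; rewrite subrr normr0 ltW// kroot_gt0// mulr_gt0.
have := IH _ _ _ (newton_stateS K0 hQ st); have := newton_state_dist st.
case: st => [_ _ _ b0 e0 hh _].
rewrite mulrAC kroot_step ?mulr_gt0// iterSr => h1 h2.
rewrite -[_ - x](subrKA (N Q x)) (le_trans (ler_normD _ _))//.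
by move: h1 h2; lra.
Qed.

(** With [h_k = b_k K e_k], one step gives [h_(k+1) <= 2 h_k^2] and
    [e_(k+1) <= h_k e_k]: this is the quadratic decay. *)
Lemma newton_states Q x0 r K b e k : 0 < K -> C11_on_ball Q x0 r K ->
  newton_state Q x0 r K x0 b e ->
  exists bk ek, [/\ newton_state Q x0 r K (newton Q x0 k) bk ek,
    bk * K * ek <= (2 * (b * K * e)) ^+ (2 ^ k) / 2 &
    ek <= (2^-1) ^+ k * (2 * (b * K * e)) ^+ (2 ^ k - 1) * e].
Proof.
move=> K0 hQ st; elim: k => [|k [bk [ek [stk hk ekle]]]].
  exists b, e; split => //; last by rewrite !expr0 !mul1r.
  by rewrite expn0 expr1; lra.
exists (bk / (1 - bk * K * ek)), (bk * K * ek ^+ 2 / (2 * (1 - bk * K * ek))).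
have stk' := newton_stateS K0 hQ stk.
case: stk => [_ _ _ bk0 ek0 hh _].
case: st => [_ _ _ b0 e0 _ _].
have bK := mulr_gt0 bk0 K0.
have h0 := mulr_gt0 (mulr_gt0 b0 K0) e0.
have hk0 := mulr_gt0 bK ek0.
split; first exact: stk'.
  rewrite [bk / _ * K]mulrAC (le_trans (kantorovich_step_h bK ek0 hh))//.
  set H := 2 * _ in hk *.
  rewrite expnSr exprM.
  have : (bk * K * ek) ^+ 2 <= (H ^+ (2 ^ k) / 2) ^+ 2.
    by rewrite ler_pXn2r// nnegrE ?ltW// divr_gt0// exprn_gt0// mulr_gt0.
  by rewrite exprMn; lra.
apply: (le_trans (kantorovich_step_e bK ek0 hh)).
set H := 2 * _ in hk ekle *.
have H0 : 0 < H by rewrite mulr_gt0.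
have := ler_pM (ltW hk0) (ltW ek0) hk ekle.
move=> /le_trans; apply; rewrite le_eqVlt; apply/orP; left; apply/eqP.
have -> : (2 ^ k.+1 - 1 = 2 ^ k + (2 ^ k - 1))%N.
  by rewrite expnS mul2n -addnn addnBA// expn_gt0.
by rewrite exprD exprS; field.
Qed.

End NewtonKantorovich.

Section NewtonKantorovichTheorem.
Variables (R : realType) (V : completeNormedModType R).
Implicit Types (Q : V -> V) (x y : V) (r K b e : R).

Lemma C11_continuous Q x0 r K (x_ : V ^nat) x : 0 < r -> 0 < K ->
  C11_on_ball Q x0 r K -> (forall k, `|x_ k - x0| <= r) -> `|x - x0| <= r ->
  x_ @ \oo --> x -> (fun k => Q (x_ k)) @ \oo --> Q x.
Proof.
move=> r0 K0 [dQ _ tQ] xr yr cx.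
have x0r : `|x0 - x0| < r by rewrite subrr normr0.
have cd : continuous ('d Q x0) by apply: diff_continuous; exact: dQ.
have c0 : (fun k => x_ k - x) @ \oo --> (0 : V).
  by rewrite -(subrr x); apply: cvgB => //; exact: cvg_cst.
apply: (@squeeze_norm_cvg _ _ _ _
    (fun k => K * r * `|x_ k - x| + `|'d Q x0 (x_ k - x)|)).
  move=> k; rewrite -[Q (x_ k) - _](subrK ('d Q x0 (x_ k - x))).
  rewrite (le_trans (ler_normD _ _))// lerD2r (le_trans (tQ _ _ _ (xr k) yr x0r))//.
  rewrite ler_wpM2r// mulrAC -mulrA ler_wpM2l ?(ltW K0)//.
  by have := xr k; move: yr; lra.
rewrite -[0]addr0; apply: cvgD; last first.
  apply/norm_cvg0P; rewrite -(linear0 ('d Q x0)).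
  by apply: continuous_cvg => //; exact: cd.
by rewrite -(mulr0 (K * r)); apply: cvgMl_tmp; apply/norm_cvg0P.
Qed.

(** By [newton_states] the steps are at most [e / 2^k], so the iterates converge;
    applying [newton_iterates_close] from the [k]-th iterate on bounds the distance
    to the limit by [kroot <= 2 e_k]. *)
Theorem newton_kantorovich Q x0 r K b e : 0 < K -> C11_on_ball Q x0 r K ->
  newton_state Q x0 r K x0 b e ->
  exists xs, [/\ `|xs - x0| <= kroot (b * K) e, Q xs = 0,
    newton Q x0 @ \oo --> xs &
    forall k, `|newton Q x0 k - xs| <=
      2 * ((2^-1) ^+ k * (2 * (b * K * e)) ^+ (2 ^ k - 1) * e)].
Proof.
move=> K0 hQ st; have hs k := newton_states k K0 hQ st.
have h01 : 0 <= 2 * (b * K * e) <= 1.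
  by case: st => [_ _ _ b0 e0 hh _]; have := mulr_gt0 (mulr_gt0 b0 K0) e0; lra.
have e0 : 0 < e by case: st.
have hstep k : `|newton Q x0 k.+1 - newton Q x0 k| <= e * 2^-1 ^+ k.
  have [bk [ek [stk _ hek]]] := hs k.
  rewrite (le_trans (newton_state_dist stk))// (le_trans hek)//.
  rewrite mulrC ler_wpM2l ?(ltW e0)// ler_piMr ?exprn_ge0//.
  by move/andP: h01 => [? ?]; exact: exprn_ile1.
have c : cvgn (newton Q x0).
  by apply: (geometric_steps_cvg _ _ hstep); lra.
pose xs := limn (newton Q x0).
have cxs : newton Q x0 @ \oo --> xs by [].
have hclose k : exists2 ek, `|xs - newton Q x0 k| <= 2 * ek &
    ek <= 2^-1 ^+ k * (2 * (b * K * e)) ^+ (2 ^ k - 1) * e.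
  have [bk [ek [stk _ hek]]] := hs k.
  exists ek => //; apply: (@le_trans _ _ (kroot (bk * K) ek)); last first.
    by case: stk => [_ _ _ bk0 ek0 hh _]; rewrite kroot_le// mulr_gt0.
  apply: (@norm_cvg_le _ _ (fun j => newton Q x0 (j + k)%N)).
    by rewrite cvg_shiftn.
  move=> j; have := newton_iterates_close j K0 hQ stk.
  by rewrite /newton -iterD.
have hx0 : `|xs - x0| <= kroot (b * K) e.
  by apply: (norm_cvg_le cxs) => k; exact: (newton_iterates_close k K0 hQ st).
have rho_r : kroot (b * K) e <= r.
  by case: st => [+ _ _ _ _ _ _]; rewrite subrr normr0 add0r.
have r0 : 0 < r.
  by apply: lt_le_trans rho_r; case: st => *; rewrite kroot_gt0// mulr_gt0.
exists xs; split => //; last first.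
  move=> k; have [ek h1 h2] := hclose k.
  by rewrite distrC (le_trans h1)// ler_wpM2l.
have cQ : (fun k => Q (newton Q x0 k)) @ \oo --> Q xs.
  apply: (C11_continuous r0 K0 hQ) => //; last exact: le_trans rho_r.
  move=> k; rewrite (le_trans _ rho_r)//.
  exact: (newton_iterates_close k K0 hQ st).
suff cQ0 : (fun k => Q (newton Q x0 k)) @ \oo --> 0 by exact: cvg_unique cQ cQ0.
rewrite -cvg_shiftS.
apply: (@squeeze_norm_cvg _ _ _ _ (geometric (K / 2 * e ^+ 2) (2^-1))); last first.
  by apply: cvg_geometric; rewrite ger0_norm; lra.
move=> k; rewrite subr0 /= /geometric.
have [bk [ek [stk _ hek]]] := hs k.
rewrite (le_trans (newton_state_residual K0 hQ stk))// -[X in _ <= X]mulrA.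
rewrite ler_wpM2l ?divr_ge0 ?(ltW K0)//.
have ek0 : 0 < ek by case: stk.
have hek' : ek <= 2^-1 ^+ k * e.
  rewrite (le_trans hek)// ler_wpM2r ?(ltW e0)// ler_piMr ?exprn_ge0//.
  by move/andP: h01 => [? ?]; exact: exprn_ile1.
have q1 : (2^-1 : R) ^+ k <= 1 by rewrite exprn_ile1//; lra.
apply: (@le_trans _ _ (ek * e)).
  rewrite expr2 ler_wpM2l ?(ltW ek0)// (le_trans hek')// ler_piMl ?(ltW e0)//.
have -> : e ^+ 2 * 2^-1 ^+ k = 2^-1 ^+ k * e * e by rewrite expr2; ring.
by rewrite ler_wpM2r ?(ltW e0).
Qed.


(** The modified Newton iterates, started at 0, for the scalar polynomial
    [c/2 t^2 - t + e], whose derivative at 0 is -1. *)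
Definition majorant c e (k : nat) : R := iter k (fun t => e + c / 2 * t ^+ 2) 0.

Lemma majorant_bounds c e k : 0 < c -> 0 < e -> c * e <= 1 / 2 ->
  0 <= majorant c e k <= kroot c e.
Proof.
move=> c0 e0 ce; elim: k => [|k /andP[h1 h2]].
  by rewrite lexx ltW// kroot_gt0.
rewrite /majorant iterS -/(majorant c e k) addr_ge0 ?(ltW e0) ?mulr_ge0 ?sqr_ge0 ?(ltW c0)//=.
rewrite [leRHS]krootE// lerD2l ler_wpM2l ?divr_ge0 ?(ltW c0)//.
by rewrite ler_pXn2r// nnegrE ltW// kroot_gt0.
Qed.

Lemma majorantS c e k : 0 < c -> 0 < e -> c * e <= 1 / 2 ->
  kroot c e - majorant c e k.+1 =
  c / 2 * (majorant c e k + kroot c e) * (kroot c e - majorant c e k).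
Proof.
move=> c0 e0 ce; rewrite {1}krootE// /majorant iterS -/(majorant c e k).
by field.
Qed.

Lemma majorant_geometric c e k : 0 < c -> 0 < e -> c * e <= 1 / 2 ->
  kroot c e - majorant c e k <= kroot c e * (c * kroot c e) ^+ k.
Proof.
move=> c0 e0 ce; elim: k => [|k IH]; first by rewrite subr0 expr0 mulr1.
have /andP[h1 h2] := majorant_bounds k c0 e0 ce.
have r0 := kroot_gt0 c0 e0 ce.
rewrite majorantS// exprS mulrCA; apply: ler_pM => //.
- by rewrite !mulr_ge0 ?addr_ge0 ?(ltW c0) ?(ltW r0).
- by rewrite subr_ge0.
- by rewrite -mulrA ler_wpM2l ?(ltW c0)//; lra.
Qed.

(** The factor [c * kroot c e] is 1 when [c * e = 1/2]; the sublinear rate below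
    still gives convergence. *)
Lemma majorant_harmonic c e k : 0 < c -> 0 < e -> c * e <= 1 / 2 ->
  kroot c e - majorant c e k <= 2 / c * harmonic k.
Proof.
move=> c0 e0 ce.
suff h : c / 2 * (kroot c e - majorant c e k) <= k.+2%:R^-1.
  have -> : kroot c e - majorant c e k =
      2 / c * (c / 2 * (kroot c e - majorant c e k)) by field; rewrite gt_eqF.
  rewrite ler_wpM2l ?divr_ge0 ?(ltW c0)// (le_trans h)//.
  by rewrite lef_pV2 ?posrE ?ltr0n// ler_nat.
(* The error multiplied by [c / 2], say [y], satisfies [y' <= y (1 - y)]. *)
have cr : c * kroot c e <= 1 by rewrite mul_kroot// gerBl sqrtr_ge0.
elim: k => [|k IH]; first by rewrite subr0; lra.
have /andP[h1 h2] := majorant_bounds k c0 e0 ce.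
set y := c / 2 * (kroot c e - majorant c e k) in IH.
have y0 : 0 <= y by rewrite mulr_ge0 ?divr_ge0 ?subr_ge0 ?(ltW c0).
have -> : c / 2 * (kroot c e - majorant c e k.+1) = (c * kroot c e - y) * y.
  by rewrite majorantS// /y; field.
apply: (@le_trans _ _ ((1 - y) * y)); first by rewrite ler_wpM2r// lerB.
have k2 : 0 < k.+2%:R :> R by rewrite ltr0n.
have -> : k.+3%:R = k.+2%:R + 1 :> R by rewrite -[in LHS]addn1 natrD.
move: IH k2; have : 2 <= k.+2%:R :> R by rewrite ler_nat.
move: (k.+2%:R) y0 => a y0 a2 + a0; rewrite -[a^-1]mul1r ler_pdivlMr// => ya.
have y1 : 0 <= 1 - y by nra.
have ay : 0 <= 1 - y * a by lra.
rewrite -[(a + 1)^-1]mul1r ler_pdivlMr; last by lra.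
have := mulr_ge0 y1 ay; have := mulr_ge0 y0 y0; lra.
Qed.

Lemma modified_newton_error Q x0 r K b e x y : 0 < K -> C11_on_ball Q x0 r K ->
  newton_state Q x0 r K x0 b e -> `|x - x0| <= r -> `|y - x0| <= r ->
  `|x - inv_op ('d Q x0) (Q x) - y| <=
    b * K / 2 * (`|x - x0| + `|y - x0|) * `|x - y| + b * `|Q y|.
Proof.
move=> K0 [_ _ tQ] st xr yr; have x0r := newton_state_lt K0 st.
case: st => [_ bij bnd b0 _ _ _].
rewrite (le_trans (bnd _))//.
have -> : 'd Q x0 (x - inv_op ('d Q x0) (Q x) - y) =
    - (Q x - Q y - 'd Q x0 (x - y)) - Q y.
  by rewrite addrAC linearB inv_opK// opprB -addrA -opprD subrK.
rewrite -3!mulrA -mulrDr ler_wpM2l ?(ltW b0)// (le_trans (ler_normB _ _))// normrN.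
by rewrite lerD2r !mulrA tQ.
Qed.

(** With the centre as second point, [modified_newton_error] is the recursion of the
    scalar iterates. *)
Lemma modified_newton_majorized Q x0 r K b e k : 0 < K -> C11_on_ball Q x0 r K ->
  newton_state Q x0 r K x0 b e ->
  `|modified_newton Q x0 k - x0| <= majorant (b * K) e k.
Proof.
move=> K0 hQ st; have [rho_r _ _ b0 e0 hh res] := st.
rewrite subrr normr0 add0r in rho_r.
have bK := mulr_gt0 b0 K0.
elim: k => [|k IH]; first by rewrite subrr normr0.
have /andP[h1 h2] := majorant_bounds k bK e0 hh.
have x0r : `|x0 - x0| <= r by rewrite subrr normr0; apply: le_trans rho_r; exact: le_trans h2.
have xr := le_trans IH (le_trans h2 rho_r).
rewrite /modified_newton iterS -/(modified_newton Q x0 k).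
rewrite (le_trans (modified_newton_error K0 hQ st xr x0r))//.
rewrite /majorant iterS -/(majorant _ _ k) addrC lerD//.
rewrite subrr normr0 addr0 -mulrA -expr2 ler_wpM2l ?divr_ge0 ?(ltW bK)//.
by rewrite ler_pXn2r// nnegrE.
Qed.

Lemma modified_newton_in Q x0 r K b e k : 0 < K -> C11_on_ball Q x0 r K ->
  newton_state Q x0 r K x0 b e -> `|modified_newton Q x0 k - x0| <= r.
Proof.
move=> K0 hQ st; rewrite (le_trans (modified_newton_majorized k K0 hQ st))//.
have [rho_r _ _ b0 e0 hh _] := st.
rewrite subrr normr0 add0r in rho_r; apply: le_trans rho_r.
by case/andP: (majorant_bounds k (mulr_gt0 b0 K0) e0 hh).
Qed.

(** The modified scheme is attracted, with a computable rate, by whatever zero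
    lies in the closed ball: this gives both its convergence and uniqueness. *)
Lemma modified_newton_rate Q x0 r K b e y k : 0 < K -> C11_on_ball Q x0 r K ->
  newton_state Q x0 r K x0 b e -> `|y - x0| <= kroot (b * K) e -> Q y = 0 ->
  `|modified_newton Q x0 k - y| <= kroot (b * K) e - majorant (b * K) e k.
Proof.
move=> K0 hQ st yr Qy0; have [rho_r _ _ b0 e0 hh res] := st.
rewrite subrr normr0 add0r in rho_r.
have bK := mulr_gt0 b0 K0.
elim: k => [|k IH]; first by rewrite subr0 distrC.
have hx := modified_newton_majorized k K0 hQ st.
have xr := modified_newton_in k K0 hQ st.
rewrite {1}/modified_newton iterS -/(modified_newton Q x0 k).
rewrite (le_trans (modified_newton_error K0 hQ st xr (le_trans yr rho_r)))//.
rewrite Qy0 normr0 mulr0 addr0 majorantS//.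
apply: ler_pM => //; first by rewrite !mulr_ge0 ?addr_ge0 ?(ltW b0) ?(ltW K0).
by rewrite ler_wpM2l ?divr_ge0 ?(ltW bK)// lerD.
Qed.

Lemma modified_newton_cvg Q x0 r K b e y : 0 < K -> C11_on_ball Q x0 r K ->
  newton_state Q x0 r K x0 b e -> `|y - x0| <= kroot (b * K) e -> Q y = 0 ->
  modified_newton Q x0 @ \oo --> y.
Proof.
move=> K0 hQ st yr Qy0; have [_ _ _ b0 e0 hh _] := st.
apply: (@squeeze_norm_cvg _ _ _ _ (fun k => 2 / (b * K) * harmonic k)).
  move=> k; rewrite (le_trans (modified_newton_rate k K0 hQ st yr Qy0))//.
  exact: majorant_harmonic (mulr_gt0 b0 K0) e0 hh.
by rewrite -(mulr0 (2 / (b * K))); apply: cvgMl_tmp; exact: cvg_harmonic.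
Qed.

(** Below the larger root the modified scheme is still contracted towards a
    zero, now with a ratio smaller than 1. *)
Lemma modified_newton_cvg_large Q x0 r K b e y : 0 < K -> C11_on_ball Q x0 r K ->
  newton_state Q x0 r K x0 b e -> `|y - x0| <= r ->
  `|y - x0| < (1 + Num.sqrt (1 - 2 * (b * K * e))) / (b * K) -> Q y = 0 ->
  modified_newton Q x0 @ \oo --> y.
Proof.
move=> K0 hQ st yr yr1 Qy0; have [_ _ _ b0 e0 hh _] := st.
have bK := mulr_gt0 b0 K0.
pose q := b * K / 2 * (kroot (b * K) e + `|y - x0|).
have q0 : 0 <= q.
  apply: mulr_ge0; first by apply: divr_ge0 => //; exact: ltW.
  by apply: addr_ge0 => //; exact: ltW (kroot_gt0 bK e0 hh).
have q1 : q < 1.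
  have -> : q = 2^-1 * (b * K * kroot (b * K) e + b * K * `|y - x0|).
    by rewrite /q; field.
  rewrite mul_kroot//.
  by move: yr1; rewrite ltr_pdivlMr// [`|y - x0| * _]mulrC; lra.
apply: (@squeeze_norm_cvg _ _ _ _ (geometric `|x0 - y| q)); last first.
  by apply: cvg_geometric; rewrite ger0_norm.
rewrite /geometric /=; elim=> [|k IH]; first by rewrite expr0 mulr1.
have /andP[_ h2] := majorant_bounds k bK e0 hh.
have hx := le_trans (modified_newton_majorized k K0 hQ st) h2.
have xr := modified_newton_in k K0 hQ st.
rewrite {1}/modified_newton iterS -/(modified_newton Q x0 k).
rewrite (le_trans (modified_newton_error K0 hQ st xr yr))//.
rewrite Qy0 normr0 mulr0 addr0 exprS mulrCA; apply: ler_pM => //.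
  by rewrite !mulr_ge0 ?addr_ge0 ?(ltW b0) ?(ltW K0).
by rewrite ler_wpM2l ?divr_ge0 ?(ltW bK)// lerD2r.
Qed.

End NewtonKantorovichTheorem.

(** * The Euclidean norm and its operator norm *)

Section Norm2.
Variables (R : realType) (n : nat).
Implicit Types (v w : 'cV[R]_n) (A B : 'M[R]_n).

Lemma norm2N v : norm2 (- v) = norm2 v.
Proof. by rewrite -scaleN1r norm2Z normrN1 mul1r. Qed.

Lemma norm2B v w : norm2 (v - w) <= norm2 v + norm2 w.
Proof. by rewrite (le_trans (norm2D _ _))// norm2N. Qed.

Lemma norm2_distC v w : norm2 (v - w) = norm2 (w - v).
Proof. by rewrite -norm2N opprB. Qed.

Lemma norm2_sum (I : Type) (s : seq I) (P : pred I) (F : I -> 'cV[R]_n) :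
  norm2 (\sum_(i <- s | P i) F i) <= \sum_(i <- s | P i) norm2 (F i).
Proof.
elim/big_rec2 : _ => [|i y v _ h]; first by rewrite norm20.
by rewrite (le_trans (norm2D _ _))// lerD2l.
Qed.

Lemma coord_le_norm2 v i : `|v i 0| <= norm2 v.
Proof.
rewrite -sqrtr_sqr ler_sqrt ?sumsq_ge0// (bigD1 i)//= lerDl.
by apply: sumr_ge0 => j _; exact: sqr_ge0.
Qed.

Lemma mxnorm_le_norm2 v : `|v| <= norm2 v.
Proof.
rewrite [leLHS]/Num.norm/= mx_normrE; apply/bigmax_leP; split.
  exact: norm2_ge0.
by move=> [i j] _ /=; rewrite ord1; exact: coord_le_norm2.
Qed.

Lemma norm2_le_coord v (m : R) : (forall i, `|v i 0| <= m) ->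
  norm2 v <= Num.sqrt n%:R * m.
Proof.
move=> vm.
have [m0|m0] := leP 0 m; last first.
  have -> : v = 0.
    apply/colP => i; have := le_trans (normr_ge0 _) (vm i); lra.
  rewrite norm20.
  have -> : n%:R = 0 :> R.
    case: (n) (v) vm => // k w vm; have := le_trans (normr_ge0 _) (vm ord0); lra.
  by rewrite sqrtr0 mul0r.
rewrite -[m in leRHS]ger0_norm// -sqrtr_sqr -sqrtrM// ler_sqrt ?mulr_ge0 ?sqr_ge0//.
have -> : n%:R * m ^+ 2 = \sum_(i < n) m ^+ 2.
  by rewrite sumr_const card_ord mulr_natl.
by apply: ler_sum => i _; rewrite -real_normK ?num_real// ler_pXn2r// nnegrE.
Qed.

Lemma dot_le v w : `|\sum_i v i 0 * w i 0| <= norm2 v * norm2 w.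
Proof.
rewrite -sqrtr_sqr -sqrtrM ?sumsq_ge0// ler_sqrt ?mulr_ge0 ?sumsq_ge0//.
exact: cauchy_schwarz.
Qed.

Lemma norm2_continuous : continuous (@norm2 R n).
Proof.
move=> v; apply/(@cvgrPdist_le _ _ _ (nbhs v)) => e e0; near=> w.
have n1 : 0 < n.+1%:R :> R by rewrite ltr0n.
have h (a b : 'cV[R]_n) : norm2 a - norm2 b <= n.+1%:R * `|a - b|.
  rewrite lerBlDr -{1}(subrK b a) (le_trans (norm2D _ _))// lerD2r.
  by rewrite (le_trans (norm2_le_mxnorm _))// ler_wpM2r// ler_nat.
have hw : n.+1%:R * `|v - w| <= e.
  rewrite mulrC -ler_pdivlMr//; near: w.
  by apply: (@cvgr_dist_le _ _ _ (nbhs v) _ id); rewrite ?divr_gt0.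
rewrite ler_norml (le_trans (h _ _) hw) andbT lerNl opprB.
by rewrite (le_trans (h _ _))// distrC.
Unshelve. all: by end_near. Qed.

End Norm2.

Section Opnorm2.
Variables (R : realType) (n : nat).
Implicit Types (v w : 'cV[R]_n) (A B : 'M[R]_n).

Lemma mulmx_bounded A : exists2 C, 0 <= C & forall v, norm2 (A *m v) <= C * norm2 v.
Proof.
exists (\sum_i norm2 (col i A)); first by apply: sumr_ge0 => i _; exact: norm2_ge0.
move=> v.
have -> : A *m v = \sum_i v i 0 *: col i A.
  apply/colP => k; rewrite mxE summxE; apply: eq_bigr => i _.
  by rewrite !mxE mulrC.
rewrite (le_trans (norm2_sum _ _ _))// mulr_suml; apply: ler_sum => i _.
by rewrite norm2Z mulrC ler_wpM2l ?norm2_ge0// coord_le_norm2.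
Qed.

Lemma opnorm2_ubound A :
  has_ubound [set norm2 (A *m v) | v in [set v : 'cV[R]_n | norm2 v <= 1]].
Proof.
have [C C0 hC] := mulmx_bounded A; exists C => _ [v /= v1 <-].
by rewrite (le_trans (hC v))// ler_piMr.
Qed.

Lemma opnorm2_ge0 A : 0 <= opnorm2 A.
Proof.
apply: (le_trans (norm2_ge0 (A *m 0))); apply: ub_le_sup; first exact: opnorm2_ubound.
by exists 0 => //=; rewrite norm20.
Qed.

Lemma norm2_mulmx A v : norm2 (A *m v) <= opnorm2 A * norm2 v.
Proof.
have [v0|v0] := eqVneq (norm2 v) 0.
  by rewrite v0 (norm2_eq0 v0) mulmx0 norm20 mulr0.
have vp : 0 < norm2 v by rewrite lt_def v0 norm2_ge0.
rewrite -ler_pdivrMr// mulrC -[(norm2 v)^-1]ger0_norm ?invr_ge0 ?norm2_ge0//.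
rewrite -norm2Z scalemxAr; apply: ub_le_sup; first exact: opnorm2_ubound.
exists ((norm2 v)^-1 *: v) => //=.
by rewrite norm2Z ger0_norm ?invr_ge0 ?norm2_ge0// mulVf.
Qed.

Lemma opnorm2_le A C : 0 <= C -> (forall v, norm2 (A *m v) <= C * norm2 v) ->
  opnorm2 A <= C.
Proof.
move=> C0 h; apply: ge_sup; first by exists (norm2 (A *m 0)), 0 => //=; rewrite norm20.
by move=> _ [v /= v1 <-]; rewrite (le_trans (h v))// ler_piMr.
Qed.

Lemma norm2_mulmx_le A v C : norm2 v <= C -> norm2 (A *m v) <= opnorm2 A * C.
Proof.
by move=> h; rewrite (le_trans (norm2_mulmx _ _))// ler_wpM2l// opnorm2_ge0.
Qed.

Lemma opnorm2D A B : opnorm2 (A + B) <= opnorm2 A + opnorm2 B.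
Proof.
apply: opnorm2_le; first by rewrite addr_ge0 ?opnorm2_ge0.
move=> v; rewrite mulmxDl (le_trans (norm2D _ _))// mulrDl.
by rewrite lerD ?norm2_mulmx.
Qed.

Lemma opnorm2Z (l : R) A : opnorm2 (l *: A) <= `|l| * opnorm2 A.
Proof.
apply: opnorm2_le; first by rewrite mulr_ge0 ?opnorm2_ge0.
by move=> v; rewrite -scalemxAl norm2Z -mulrA ler_wpM2l// norm2_mulmx.
Qed.

Lemma opnorm2M A B : opnorm2 (A *m B) <= opnorm2 A * opnorm2 B.
Proof.
apply: opnorm2_le; first by rewrite mulr_ge0 ?opnorm2_ge0.
by move=> v; rewrite -mulmxA -mulrA norm2_mulmx_le// norm2_mulmx.
Qed.

Lemma opnorm2_0 : opnorm2 (0 : 'M[R]_n) = 0.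
Proof.
apply/eqP; rewrite eq_le opnorm2_ge0 andbT; apply: opnorm2_le => // v.
by rewrite mul0mx norm20 mul0r.
Qed.

Lemma opnorm2_1 : opnorm2 (1%:M : 'M[R]_n) <= 1.
Proof. by apply: opnorm2_le => // v; rewrite mul1mx mul1r. Qed.

Lemma opnorm2X A k : opnorm2 (A ^+ k) <= opnorm2 A ^+ k.
Proof.
elim: k => [|k IH]; first by rewrite !expr0 opnorm2_1.
by rewrite !exprS (le_trans (opnorm2M _ _))// ler_wpM2l ?opnorm2_ge0.
Qed.

Lemma opnorm2_sum (I : Type) (s : seq I) (P : pred I) (F : I -> 'M[R]_n) :
  opnorm2 (\sum_(i <- s | P i) F i) <= \sum_(i <- s | P i) opnorm2 (F i).
Proof.
elim/big_rec2 : _ => [|i y v _ h]; first by rewrite opnorm2_0.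
by rewrite (le_trans (opnorm2D _ _))// lerD2l.
Qed.

Lemma entry_le_opnorm2 A i j : `|A i j| <= opnorm2 A.
Proof.
have d1 : norm2 (delta_mx j 0 : 'cV[R]_n) <= 1.
  rewrite /norm2 (bigD1 j)//= big1 ?addr0 => [|k kj]; last first.
    by rewrite mxE (negbTE kj)/= expr0n.
  by rewrite mxE !eqxx expr1n sqrtr1.
have -> : A i j = (A *m delta_mx j 0 : 'cV[R]_n) i 0 by rewrite -colE mxE.
rewrite (le_trans (coord_le_norm2 _ _))// (le_trans (norm2_mulmx _ _))//.
by rewrite ler_piMr// opnorm2_ge0.
Qed.

Lemma mxnorm_le_opnorm2 A : `|A| <= opnorm2 A.
Proof.
rewrite [leLHS]/Num.norm/= mx_normrE; apply/bigmax_leP; split.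
  exact: opnorm2_ge0.
by move=> [i j] _ /=; exact: entry_le_opnorm2.
Qed.

End Opnorm2.

(** * The matrix exponential *)

Lemma cvg_sumr (R : realType) (T : Type) (F : set_system T) (I : Type)
    (s : seq I) (f : I -> T -> R) (a : I -> R) : Filter F ->
  (forall i, f i @ F --> a i) ->
  (fun x => \sum_(i <- s) f i x) @ F --> \sum_(i <- s) a i.
Proof.
move=> FF h; elim: s => [|i s IH].
  by rewrite big_nil; under eq_fun do rewrite big_nil; exact: cvg_cst.
rewrite big_cons; under eq_fun do rewrite big_cons.
by apply: cvgD.
Qed.

(** Joins the complete and the normed structure of matrices, so that normally
    convergent series of matrices converge. *)
HB.instance Definition _ (R : realType) (m n : nat) := Complete.on 'M[R]_(m, n).

Section Expmx.
Variables (R : realType) (n : nat).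
Implicit Types (A B : 'M[R]_n) (s t : R).

Definition expmx_term A k : 'M[R]_n := (k`!%:R)^-1 *: A ^+ k.

Lemma opnorm2_expmx_term A k : opnorm2 (expmx_term A k) <= exp_coeff (opnorm2 A) k.
Proof.
rewrite (le_trans (opnorm2Z _ _))// ger0_norm// mulrC /exp_coeff.
by rewrite ler_wpM2r// opnorm2X.
Qed.

Lemma expmx_cvg A : series (expmx_term A) @ \oo --> expmx A.
Proof.
suff : cvgn (series (expmx_term A)) by [].
apply: normed_cvg; apply: series_le_cvg (is_cvg_series_exp_coeff (opnorm2 A)) => k.
- exact: normr_ge0.
- by rewrite exp_coeff_ge0// opnorm2_ge0.
- by rewrite (le_trans (mxnorm_le_opnorm2 _))// opnorm2_expmx_term.
Qed.

Lemma expmx_entry_cvg A i j :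
  (fun N => series (expmx_term A) N i j) @ \oo --> expmx A i j.
Proof.
apply: (cvg_comp (series (expmx_term A)) (fun M : 'M[R]_n => M i j)); last exact: coord_continuous.
exact: expmx_cvg.
Qed.

Lemma exp_coeff_partial_le (a : R) N : 0 <= a -> series (exp_coeff a) N <= expR a.
Proof.
move=> a0; apply: nondecreasing_cvgn_le; last exact: is_cvg_series_exp_coeff.
by apply: nondecreasing_series => k _ _; exact: exp_coeff_ge0.
Qed.

Lemma opnorm2_limit_le (S_ : nat -> 'M[R]_n) B (C : R) : 0 <= C ->
  (forall i j, (fun N => S_ N i j) @ \oo --> B i j) ->
  (forall N, opnorm2 (S_ N) <= C) -> opnorm2 B <= C.
Proof.
move=> C0 cS hS; apply: opnorm2_le => // v.
have c : (fun N => norm2 (S_ N *m v)) @ \oo --> norm2 (B *m v).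
  rewrite /norm2; apply: continuous_cvg; first exact: sqrt_continuous.
  apply: cvg_sumr => i.
  have h : (fun N => (S_ N *m v) i 0) @ \oo --> (B *m v) i 0.
    have -> : (fun N => (S_ N *m v) i 0) = (fun N => \sum_j S_ N i j * v j 0).
      by apply/funext => N; rewrite mxE.
    by rewrite mxE; apply: cvg_sumr => j; apply: cvgMr_tmp.
  exact: cvg_comp h (@exprn_continuous _ 2 _).
rewrite -(cvg_lim _ c)//; apply: limr_le; first exact: cvgP c.
apply: nearW => N; rewrite (le_trans (norm2_mulmx _ _))//.
by rewrite ler_wpM2r// norm2_ge0.
Qed.

Lemma opnorm2_expmx A : opnorm2 (expmx A) <= expR (opnorm2 A).
Proof.
apply: (opnorm2_limit_le (S_ := series (expmx_term A)) (expR_ge0 _)) => [i j|N].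
  exact: expmx_entry_cvg.
rewrite (le_trans (opnorm2_sum _ _ _))//.
rewrite (le_trans _ (exp_coeff_partial_le N (opnorm2_ge0 A)))//.
by apply: ler_sum => k _; exact: opnorm2_expmx_term.
Qed.

Lemma opnorm2_expmxB1 A : opnorm2 (expmx A - 1%:M) <= expR (opnorm2 A) - 1.
Proof.
have e1 : 0 <= expR (opnorm2 A) - 1 by rewrite subr_ge0 -[leLHS]expR0 ler_expR opnorm2_ge0.
apply: (opnorm2_limit_le (S_ := fun N => series (expmx_term A) N.+1 - 1%:M)) => // [i j|N].
  under eq_fun do rewrite 2!mxE.
  rewrite !mxE; apply: cvgB; last exact: cvg_cst.
  by rewrite (cvg_shiftS (fun N => series (expmx_term A) N i j)); exact: expmx_entry_cvg.
have -> : series (expmx_term A) N.+1 - 1%:M = \sum_(0 <= k < N) expmx_term A k.+1.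
  rewrite /series/= big_nat_recl// {1}/expmx_term fact0 invr1 scale1r expr0.
  by rewrite addrAC subrr add0r.
rewrite (le_trans (opnorm2_sum _ _ _))// lerBrDr addrC.
rewrite (le_trans _ (exp_coeff_partial_le N.+1 (opnorm2_ge0 A)))//.
rewrite /series/= [leRHS]big_nat_recl// lerD//.
  by rewrite /exp_coeff/= expr0 fact0 divr1.
by apply: ler_sum => k _; exact: opnorm2_expmx_term.
Qed.


Lemma big_triangle (U : nmodType) (F : nat -> nat -> U) N :
  \sum_(0 <= k < N) \sum_(0 <= i < k.+1) F i (k - i)%N =
  \sum_(0 <= i < N) \sum_(0 <= j < N - i) F i j.
Proof.
elim: N => [|N IH]; first by rewrite !big_nil.
rewrite big_nat_recr//= IH [RHS]big_nat_recr//= subSnn big_nat1.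
rewrite [X in _ + X]big_nat_recr//= subnn addrA; congr (_ + _).
rewrite -big_split/= !big_nat; apply: eq_bigr => i /andP[_ iN].
by rewrite subSn ?(ltnW iN)// big_nat_recr//=.
Qed.

Lemma exp_coeffD s t k : exp_coeff (s + t) k =
  \sum_(0 <= i < k.+1) exp_coeff s i * exp_coeff t (k - i)%N.
Proof.
rewrite /exp_coeff/= [s + t]addrC exprDn mulr_suml big_mkord.
apply: eq_bigr => i _; have ik : (i <= k)%N by rewrite -ltnS.
have fn m : m`!%:R != 0 :> R by rewrite pnatr_eq0 -lt0n fact_gt0.
rewrite -mulr_natr -(bin_fact ik) !natrM; field.
by rewrite !fn pnatr_eq0 -lt0n bin_gt0 ik.
Qed.

Lemma series_exp_coeffD s t N : series (exp_coeff (s + t)) N =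
  \sum_(0 <= i < N) \sum_(0 <= j < N - i) exp_coeff s i * exp_coeff t j.
Proof.
rewrite -(big_triangle (fun i j => exp_coeff s i * exp_coeff t j)).
by apply: eq_bigr => k _; exact: exp_coeffD.
Qed.

Lemma scalemx_expr A s k : (s *: A) ^+ k = s ^+ k *: A ^+ k.
Proof.
elim: k => [|k IH]; first by rewrite !expr0 scale1r.
by rewrite !exprS IH -!mulmxE -scalemxAl -scalemxAr scalerA.
Qed.

Lemma expmx_termZ A s k : expmx_term (s *: A) k = exp_coeff s k *: A ^+ k.
Proof. by rewrite /expmx_term scalemx_expr scalerA /exp_coeff/= mulrC. Qed.

Lemma expmx_termM A s t i j : expmx_term (s *: A) i *m expmx_term (t *: A) j =
  (exp_coeff s i * exp_coeff t j) *: A ^+ (i + j).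
Proof. by rewrite !expmx_termZ -scalemxAl -scalemxAr scalerA mulmxE exprD. Qed.

Lemma series_expmxD A s t N :
  series (expmx_term ((s + t) *: A)) N =
  \sum_(0 <= i < N) \sum_(0 <= j < N - i)
    expmx_term (s *: A) i *m expmx_term (t *: A) j.
Proof.
rewrite -(big_triangle (fun i j => expmx_term (s *: A) i *m expmx_term (t *: A) j)).
apply: eq_bigr => k _; rewrite expmx_termZ exp_coeffD scaler_suml !big_nat.
by apply: eq_bigr => i /andP[_ ik]; rewrite expmx_termM subnKC.
Qed.

(** The partial sums are not multiplicative, but the defect is dominated, term
    by term, by the corresponding defect of the scalar exponential of
    [`|s| a] and [`|t| a], which tends to 0. *)
Lemma series_expmxM_defect A s t N (a := opnorm2 A) :
  opnorm2 (series (expmx_term (s *: A)) N *m series (expmx_term (t *: A)) N -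
           series (expmx_term ((s + t) *: A)) N) <=
  series (exp_coeff (`|s| * a)) N * series (exp_coeff (`|t| * a)) N -
  series (exp_coeff (`|s| * a + `|t| * a)) N.
Proof.
have split_sum (U : zmodType) (F : nat -> nat -> U) :
  \sum_(0 <= i < N) \sum_(0 <= j < N) F i j -
  \sum_(0 <= i < N) \sum_(0 <= j < N - i) F i j =
  \sum_(0 <= i < N) \sum_(N - i <= j < N) F i j.
  rewrite -sumrB; apply: eq_bigr => i _.
  rewrite [in X in X - _](@big_cat_nat _ _ _ (N - i))//= ?leq_subr//.
  by rewrite addrAC subrr add0r.
rewrite series_expmxD series_exp_coeffD.
have -> : series (expmx_term (s *: A)) N *m series (expmx_term (t *: A)) N =
    \sum_(0 <= i < N) \sum_(0 <= j < N) expmx_term (s *: A) i *m expmx_term (t *: A) j.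
  by rewrite /series/= mulmx_suml; apply: eq_bigr => i _; rewrite mulmx_sumr.
have -> : series (exp_coeff (`|s| * a)) N * series (exp_coeff (`|t| * a)) N =
    \sum_(0 <= i < N) \sum_(0 <= j < N) exp_coeff (`|s| * a) i * exp_coeff (`|t| * a) j.
  by rewrite /series/= mulr_suml; apply: eq_bigr => i _; rewrite mulr_sumr.
rewrite !split_sum (le_trans (opnorm2_sum _ _ _))//; apply: ler_sum => i _.
rewrite (le_trans (opnorm2_sum _ _ _))//; apply: ler_sum => j _.
have h u k : opnorm2 (expmx_term (u *: A) k) <= exp_coeff (`|u| * a) k.
  rewrite (le_trans (opnorm2_expmx_term _ _))// /exp_coeff/=.
  by rewrite ler_wpM2r// lerXn2r ?nnegrE ?mulr_ge0 ?opnorm2_ge0// opnorm2Z.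
by rewrite (le_trans (opnorm2M _ _))// ler_pM ?opnorm2_ge0 ?h.
Qed.

(** The functional equation is all that is needed of the exponential: it turns
    the convolution in the variation of constants formula into a product, and it
    reduces continuity to the origin. *)
Lemma expmxD A s t :
  expmx ((s + t) *: A) = expmx (s *: A) *m expmx (t *: A).
Proof.
pose a := opnorm2 A.
pose D N := series (exp_coeff (`|s| * a)) N * series (exp_coeff (`|t| * a)) N -
  series (exp_coeff (`|s| * a + `|t| * a)) N.
have cD : D @ \oo --> (0 : R).
  rewrite -(subrr (expR (`|s| * a + `|t| * a))) {1}expRD.
  by apply: cvgB; [apply: cvgM|]; exact: is_cvg_series_exp_coeff.
apply/matrixP => i j; apply/eqP; rewrite eq_sym -subr_eq0; apply/eqP.
pose S_ u N := series (expmx_term (u *: A)) N.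
have c1 : (fun N => (S_ s N *m S_ t N - S_ (s + t) N) i j) @ \oo -->
    (expmx (s *: A) *m expmx (t *: A)) i j - expmx ((s + t) *: A) i j.
  have -> : (fun N => (S_ s N *m S_ t N - S_ (s + t) N) i j) =
      (fun N => \sum_k S_ s N i k * S_ t N k j - S_ (s + t) N i j).
    by apply/funext => N; rewrite !mxE.
  apply: cvgB; last exact: expmx_entry_cvg.
  by rewrite mxE; apply: cvg_sumr => k; apply: cvgM; exact: expmx_entry_cvg.
have c0 : (fun N => (S_ s N *m S_ t N - S_ (s + t) N) i j) @ \oo --> (0 : R).
  apply/norm_cvg0P; apply: (squeeze_cvgr (f := fun=> 0) (h := D)) cD; last exact: cvg_cst.
  apply: nearW => N; rewrite normr_ge0 (le_trans (entry_le_opnorm2 _ _ _))//.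
  exact: series_expmxM_defect.
exact: cvg_unique c1 c0.
Qed.

Lemma expmx_entry_continuous A i j : continuous (fun t => expmx (t *: A) i j).
Proof.
move=> s; pose a := opnorm2 A.
pose E (t : R) := expR (`|s| * a) * (expR (`|t - s| * a) - 1).
have cE : E t @[t --> s] --> (0 : R).
  have -> : 0 = expR (`|s| * a) * (expR (`|s - s| * a) - 1).
    by rewrite subrr normr0 mul0r expR0 subrr mulr0.
  apply: cvgMl_tmp; apply: cvgB; last exact: cvg_cst.
  apply: continuous_cvg; first exact: continuous_expR.
  apply: cvgMr_tmp; apply: cvg_norm; apply: cvgB; [exact: cvg_id|exact: cvg_cst].
apply/subr_cvg0; apply/norm_cvg0P.
apply: (squeeze_cvgr (f := fun=> 0) (h := E)) cE; last exact: cvg_cst.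
apply: nearW => t; rewrite normr_ge0/=.
have -> : expmx (t *: A) i j - expmx (s *: A) i j =
    (expmx (s *: A) *m (expmx ((t - s) *: A) - 1%:M)) i j.
  by rewrite mulmxBr mulmx1 -expmxD [s + _]addrC subrK !mxE.
rewrite (le_trans (entry_le_opnorm2 _ _ _))// (le_trans (opnorm2M _ _))//.
apply: ler_pM; rewrite ?opnorm2_ge0//.
  by rewrite (le_trans (opnorm2_expmx _))// ler_expR opnorm2Z.
by rewrite (le_trans (opnorm2_expmxB1 _))// lerB// ler_expR opnorm2Z.
Qed.

Lemma opnorm2_expmxZ A t : 0 <= t ->
  opnorm2 (expmx (t *: A)) <= expR (opnorm2 A * t).
Proof.
move=> t0; rewrite (le_trans (opnorm2_expmx _))// ler_expR mulrC.
by rewrite (le_trans (opnorm2Z _ _))// ger0_norm.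
Qed.

End Expmx.

(** * Integrals of bounded measurable vector functions *)

Section BoundedMeasurable.
Variables (R : realType) (n : nat) (tau : R).
Implicit Types (f h : R -> 'cV[R]_n) (t : R).

(** Boundedness is required at every point, so that integrability is automatic
    and the class is stable under products with bounded measurable matrices. *)
Definition bmeas f : Prop :=
  (forall i, measurable_fun `[0, tau] (fun s => f s i 0)) /\
  exists C, forall s, `[0, tau]%classic s -> norm2 (f s) <= C.

Lemma bmeas_integrable f t i : bmeas f -> t <= tau ->
  lebesgue_measure.-integrable `[0, t] (EFin \o (fun s => f s i 0)).
Proof.
move=> [mf [C hC]] tt.
have sub : `[0, t]%classic `<=` `[0, tau]%classic.
  by move=> s /=; rewrite !in_itv/= => /andP[-> /le_trans]; apply.
apply: measurable_bounded_integrable => //.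
- by apply: compact_finite_measure; exact: segment_compact.
- exact: measurable_funS (mf i).
- exists C; split; first by rewrite num_real.
  move=> D CD s /= st; rewrite (le_trans (coord_le_norm2 _ _))//.
  by rewrite (le_trans (hC _ _)) ?ltW//; exact: sub.
Qed.

Lemma bmeasD f h : bmeas f -> bmeas h -> bmeas (fun s => f s + h s).
Proof.
move=> [mf [C hC]] [mh [C' hC']]; split=> [i|].
  rewrite (_ : (fun s => _) = (fun s => f s i 0 + h s i 0)).
    exact: measurable_funD.
  by apply/funext => s; rewrite mxE.
exists (C + C') => s hs; rewrite (le_trans (norm2D _ _))//.
by rewrite lerD ?hC ?hC'.
Qed.

Lemma bmeasN f : bmeas f -> bmeas (fun s => - f s).
Proof.
move=> [mf [C hC]]; split=> [i|]; last by exists C => s hs; rewrite norm2N hC.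
rewrite (_ : (fun s => _) = (fun s => -1 * f s i 0)).
  by apply: measurable_funM => //; exact: measurable_cst.
by apply/funext => s; rewrite mxE mulN1r.
Qed.

Lemma bmeasB f h : bmeas f -> bmeas h -> bmeas (fun s => f s - h s).
Proof. by move=> bf /bmeasN; exact: bmeasD. Qed.

Lemma measurable_mulmx (B : R -> 'M[R]_n) f :
  (forall i j, measurable_fun `[0, tau] (fun s => B s i j)) ->
  (forall i, measurable_fun `[0, tau] (fun s => f s i 0)) ->
  forall i, measurable_fun `[0, tau] (fun s => (B s *m f s) i 0).
Proof.
move=> mB mf i; rewrite (_ : (fun s => _) = (fun s => \sum_j B s i j * f s j 0)).
  by apply: measurable_sum => j; exact: measurable_funM.
by apply/funext => s; rewrite mxE.
Qed.

Lemma bmeas_mulmx (B : R -> 'M[R]_n) f C :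
  (forall i j, measurable_fun `[0, tau] (fun s => B s i j)) ->
  (forall s, `[0, tau]%classic s -> opnorm2 (B s) <= C) ->
  bmeas f -> bmeas (fun s => B s *m f s).
Proof.
move=> mB hB [mf [D hD]]; split; first exact: measurable_mulmx.
exists (C * D) => s hs; rewrite (le_trans (norm2_mulmx _ _))//.
by rewrite ler_pM ?opnorm2_ge0 ?norm2_ge0 ?hB ?hD.
Qed.

Lemma within_continuous_measurable (F : R -> R) :
  {within `[0, tau], continuous F} -> measurable_fun `[0, tau] F.
Proof. by move=> cF; apply: subspace_continuous_measurable_fun. Qed.

Lemma bmeas_cont f :
  (forall i, {within `[0, tau], continuous (fun s => f s i 0)}) -> bmeas f.
Proof.
move=> cf; split=> [i|]; first exact: within_continuous_measurable.
have h i : exists C, forall s, `[0, tau]%classic s -> `|f s i 0| <= C.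
  have : compact ((fun s => f s i 0) @` `[0, tau]).
    by apply: continuous_compact; [exact: cf|exact: segment_compact].
  move=> /compact_bounded[m [_ hm]]; exists (m + 1) => s hs.
  by apply: (hm (m + 1)); [rewrite ltrDl|exists s].
have [C hC] := choice h.
exists (Num.sqrt n%:R * \sum_i `|C i|) => s hs; apply: norm2_le_coord => i.
rewrite (le_trans (hC i s hs))// (bigD1 i)//= (le_trans (ler_norm _))// lerDl.
exact: sumr_ge0.
Qed.

Lemma intvD f h t : t <= tau -> bmeas f -> bmeas h ->
  intv 0 t (fun s => f s + h s) = intv 0 t f + intv 0 t h.
Proof.
move=> tt bf bh; apply/colP => i; rewrite !mxE.
rewrite -RintegralD//; [|exact: bmeas_integrable|exact: bmeas_integrable].
by apply: eq_Rintegral => s _; rewrite mxE.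
Qed.

Lemma eq_intv f h a b : (forall s, `[a, b]%classic s -> f s = h s) ->
  intv a b f = intv a b h.
Proof.
move=> fh; apply/colP => i; rewrite !mxE; apply: eq_Rintegral => s.
by rewrite inE => /fh ->.
Qed.

Lemma Rintegral_sumr (T : Type) (s : seq T) (F : T -> R -> R) (D : set R) :
  measurable D ->
  (forall i, lebesgue_measure.-integrable D (EFin \o F i)) ->
  \int[lebesgue_measure]_(x in D) (\sum_(i <- s) F i x) =
  \sum_(i <- s) \int[lebesgue_measure]_(x in D) F i x.
Proof.
move=> mD iF; elim: s => [|i s IH].
  rewrite big_nil; under eq_Rintegral do rewrite big_nil.
  by rewrite Rintegral_cst// mul0r.
rewrite big_cons -IH -RintegralD//.
  by apply: eq_Rintegral => x _; rewrite big_cons.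
have -> : EFin \o (fun x => \sum_(j <- s) F j x) =
    (fun x => (\sum_(j <- s) (F j x)%:E))%E.
  by apply/funext => x /=; rewrite sumEFin.
by apply: integrable_sum => // j _; exact: iF.
Qed.

Lemma intv_mulmx (B : 'M[R]_n) f t : t <= tau -> bmeas f ->
  intv 0 t (fun s => B *m f s) = B *m intv 0 t f.
Proof.
move=> tt bf; apply/colP => i; rewrite !mxE.
under eq_Rintegral do rewrite mxE.
rewrite Rintegral_sumr// => [|j].
  apply: eq_bigr => j _; rewrite mxE RintegralZl//.
  exact: bmeas_integrable.
rewrite (_ : EFin \o _ = (fun x => (B i j)%:E * (f x j 0)%:E)%E)//.
by apply: integrableZl => //; exact: bmeas_integrable.
Qed.

Lemma intv_ae_eq f h t : t <= tau ->
  (forall i, measurable_fun `[0, tau] (fun s => f s i 0)) ->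
  (forall i, measurable_fun `[0, tau] (fun s => h s i 0)) ->
  (@lebesgue_measure R).-negligible [set s | `[0, tau]%classic s /\ f s <> h s] ->
  intv 0 t f = intv 0 t h.
Proof.
move=> tt mf mh fh; apply/colP => i; rewrite !mxE /Rintegral; congr fine.
have sub : `[0, t]%classic `<=` `[0, tau]%classic.
  by move=> s /=; rewrite !in_itv/= => /andP[-> /le_trans]; apply.
apply: ae_eq_integral => //.
- by apply/measurable_EFinP; apply: measurable_funS (mf i).
- by apply/measurable_EFinP; apply: measurable_funS (mh i).
apply: negligibleS fh => s /= hs; apply: contrapT => /not_andP[sN|/contrapT fhs].
  by apply: hs => /sub.
by apply: hs => _; rewrite fhs.
Qed.

(** Integrate the scalar product of [f] with the integral itself. The majorant of
    the norm is given as a derivative so that its integral is explicit. *)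
Lemma norm2_intv_le f (H dH : R -> R) t : 0 <= t <= tau -> bmeas f ->
  (forall s : R, is_derive s (1 : R) H (dH s)) -> continuous dH ->
  (forall s, 0 <= s <= t -> norm2 (f s) <= dH s) ->
  norm2 (intv 0 t f) <= H t - H 0.
Proof.
move=> /andP[]; rewrite le_eqVlt => /predU1P[<- _ _ _ _ _|t0 tt bf iH cH hf].
  rewrite subrr (_ : intv _ _ _ = 0) ?norm20//; apply/colP => i.
  by rewrite !mxE set_itv1 Rintegral_set1.
have cdH : {within `[0, t], continuous dH}.
  by apply: continuous_subspaceT.
have idH : lebesgue_measure.-integrable `[0, t] (EFin \o dH).
  by apply: continuous_compact_integrable => //; exact: segment_compact.
have ftc : \int[lebesgue_measure]_(s in `[0, t]) dH s = H t - H 0.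
  have cHH (s : R) : {for s, continuous H}.
    apply: differentiable_continuous; apply/derivable1_diffP.
    exact: (ex_derive (is_derive := iH s)).
  rewrite /Rintegral (@continuous_FTC2 _ dH H)//.
    split => [s _||].
    - exact: (ex_derive (is_derive := iH s)).
    - by apply: cvg_at_right_filter; exact: cHH.
    - by apply: cvg_at_left_filter; exact: cHH.
  by move=> s _; rewrite derive1E (derive_val (is_derive := iH s)).
set w := intv 0 t f.
have hw : norm2 w ^+ 2 <= norm2 w * (H t - H 0).
  rewrite sqr_sqrtr ?sumsq_ge0//.
  have -> : \sum_i w i 0 ^+ 2 =
      \int[lebesgue_measure]_(s in `[0, t]) (\sum_i w i 0 * f s i 0).
    rewrite Rintegral_sumr// => [|i].
      apply: eq_bigr => i _; rewrite RintegralZl//; last exact: bmeas_integrable.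
      by rewrite expr2 {2}/w mxE.
    rewrite (_ : EFin \o _ = (fun x => (w i 0)%:E * (f x i 0)%:E)%E)//.
    by apply: integrableZl => //; exact: bmeas_integrable.
  rewrite -ftc -RintegralZl//; apply: le_Rintegral => //.
  - rewrite (_ : EFin \o _ = (fun x => (\sum_i (w i 0 * f x i 0)%:E)%E)).
      apply: integrable_sum => // i _.
      rewrite (_ : (fun x => _) = (fun x => (w i 0)%:E * (f x i 0)%:E)%E)//.
      by apply: integrableZl => //; exact: bmeas_integrable.
    by apply/funext => x /=; rewrite sumEFin.
  - rewrite (_ : EFin \o _ = (fun x => (norm2 w)%:E * (dH x)%:E)%E)//.
    exact: integrableZl.
  - move=> s /=; rewrite in_itv/= => /hf fs.
    rewrite (le_trans (ler_norm _))// (le_trans (dot_le _ _))//.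
    by rewrite ler_wpM2l// norm2_ge0.
have [w0|w0] := eqVneq (norm2 w) 0.
  rewrite w0 -ftc; apply: Rintegral_ge0 => s /=; rewrite in_itv/= => /hf.
  exact: le_trans (norm2_ge0 _).
by move: hw; rewrite expr2 ler_pM2l// lt_def w0 norm2_ge0.
Qed.

Lemma intv_continuous f i : 0 <= tau -> bmeas f ->
  {within `[0, tau], continuous (fun t => intv 0 t f i 0)}.
Proof.
move=> tau0 bf.
rewrite (_ : (fun t => _) =
    (parameterized_integral lebesgue_measure 0)^~ (fun s => f s i 0)).
  by apply: parameterized_integral_continuous => //; exact: bmeas_integrable.
by apply/funext => t; rewrite mxE.
Qed.

End BoundedMeasurable.

(** * The periodic solution operator *)

(** All majorants integrated below are derivatives of combinations of two
    exponentials and a linear term. *)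
Lemma is_derive_exp_comb (R : realType) (al c be d ga s : R) :
  is_derive s (1 : R) (fun x => al * expR (c * x) + be * expR (d * x) + ga * x)
    (al * c * expR (c * s) + be * d * expR (d * s) + ga).
Proof.
have de (k : R) : is_derive s (1 : R) (fun x => expR (k * x)) (k * expR (k * s)).
  have h1 : is_derive s (1 : R) (fun x : R => k * x) k.
    by apply: is_derive_eq; rewrite /= ?scaler1 ?mulr1 ?scaler0 ?addr0.
  have h2 := is_derive_expR (k * s).
  by apply: is_derive_eq; rewrite mulrC.
have h1 := de c; have h2 := de d.
apply: is_derive_eq.
rewrite /GRing.scale/=; ring.
Qed.

Lemma continuous_exp_comb (R : realType) (al c be d ga : R) :
  continuous (fun x : R => al * expR (c * x) + be * expR (d * x) + ga).
Proof.
move=> x; apply: cvgD; last exact: cvg_cst.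
by apply: cvgD; apply: cvgMl_tmp; apply: continuous_cvg;
  [exact: continuous_expR|apply: cvgMl_tmp; exact: cvg_id|
   exact: continuous_expR|apply: cvgMl_tmp; exact: cvg_id].
Qed.

Lemma cvg_norm2_coord (R : realType) n (T : Type) (l : set_system T) (F : T -> 'cV[R]_n)
    (v : 'cV[R]_n) : Filter l ->
  (forall i, (fun x => F x i 0) @ l --> v i 0) ->
  (fun x => norm2 (F x - v)) @ l --> (0 : R).
Proof.
move=> Fl h.
suff : (fun x => Num.sqrt (\sum_(i < n) (F x - v) i 0 ^+ 2)) @ l -->
    Num.sqrt (\sum_(i < n) (0 : R)) by rewrite [X in Num.sqrt X]big1// sqrtr0.
apply: continuous_cvg; first exact: sqrt_continuous.
apply: (@cvg_sumr _ _ _ _ _ (fun i x => (F x - v) i 0 ^+ 2) (fun=> 0)) => i.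
rewrite (_ : (fun x => _) = (fun x => (F x i 0 - v i 0) ^+ 2)); last first.
  by apply/funext => x; rewrite !mxE.
rewrite (_ : 0 = (v i 0 - v i 0) ^+ 2); last by rewrite subrr expr0n.
apply: (@cvg_comp _ _ _ (fun x => F x i 0 - v i 0) (fun y => y ^+ 2) _ _ _ _
  (@exprn_continuous _ 2 _)).
by apply: cvgB; [exact: h|exact: cvg_cst].
Qed.

Lemma cvg_norm2P (R : realType) n (T : Type) (l : set_system T) (F : T -> 'cV[R]_n)
    (v : 'cV[R]_n) : Filter l ->
  (fun x => norm2 (F x - v)) @ l --> (0 : R) -> F @ l --> v.
Proof.
move=> Fl h; apply/cvgrPdist_le => e e0; near=> x.
rewrite (le_trans (mxnorm_le_norm2 _))// norm2_distC.
rewrite (le_trans (ler_norm _))//; near: x.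
exact: (cvgr0_norm_le _ h).
Unshelve. all: by end_near. Qed.

Lemma cvg_coordP (R : realType) n (T : Type) (l : set_system T) (F : T -> 'cV[R]_n)
    (v : 'cV[R]_n) : Filter l ->
  (forall i, (fun x => F x i 0) @ l --> v i 0) -> F @ l --> v.
Proof. by move=> Fl h; apply: cvg_norm2P; exact: cvg_norm2_coord. Qed.

Section KernelOperator.
Variables (R : realType) (n : nat) (tau : R) (A : 'M[R]_n).
Implicit Types (f h : R -> 'cV[R]_n) (t : R).

Let Rinv := invmx (expmx (- tau *: A) - 1%:M).

(** When [expmx (- tau *: A) - 1] is invertible, [Kop f] is the solution of
    [y' = A y + f] with [y 0 = y tau]. By definition [calF A g u x] is [Kop] applied
    to [g \o x + u]. *)
Definition Kop f t : 'cV[R]_n :=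
  expmx (t *: A) *m (Rinv *m intv 0 tau (fun s => expmx (- s *: A) *m f s)) +
  intv 0 t (fun s => expmx ((t - s) *: A) *m f s).

Definition KX f : CX tau n := insubd (0 : CX tau n) (patch (fun=> 0) `[0, tau] (Kop f)).

Lemma measurable_expmx t c i j :
  measurable_fun `[0, tau] (fun s => expmx ((t + c * s) *: A) i j).
Proof.
apply: measurable_funTS; apply: continuous_measurable_fun => s.
apply: (@continuous_comp _ _ _ (fun s => t + c * s) (fun u => expmx (u *: A) i j)).
  by apply: cvgD; [exact: cvg_cst|apply: cvgMl_tmp; exact: cvg_id].
exact: expmx_entry_continuous.
Qed.

Lemma bmeas_exp f t c : bmeas tau f ->
  bmeas tau (fun s => expmx ((t + c * s) *: A) *m f s).
Proof.
apply: (@bmeas_mulmx _ _ _ _ _ (expR ((`|t| + `|c| * tau) * opnorm2 A))) => [i j|s].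
  exact: measurable_expmx.
rewrite /= in_itv/= => /andP[s0 st].
rewrite (le_trans (opnorm2_expmx _))// ler_expR (le_trans (opnorm2Z _ _))//.
rewrite ler_wpM2r ?opnorm2_ge0// (le_trans (ler_normD _ _))// lerD2l normrM.
by rewrite ler_wpM2l// ger0_norm.
Qed.

Lemma bmeas_expN f : bmeas tau f -> bmeas tau (fun s => expmx (- s *: A) *m f s).
Proof.
move=> /(bmeas_exp 0 (-1)).
by under eq_fun do rewrite add0r mulN1r.
Qed.

Lemma bmeas_expB f t : bmeas tau f ->
  bmeas tau (fun s => expmx ((t - s) *: A) *m f s).
Proof.
move=> /(bmeas_exp t (-1)).
by under eq_fun do rewrite mulN1r.
Qed.

(** Pulling [expmx (t *: A)] out of the convolution leaves integrals that do not
    depend on [t] through the integrand: continuity in [t] becomes visible. *)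
Lemma Kop_factor f t : bmeas tau f -> t <= tau ->
  Kop f t = expmx (t *: A) *m
    (Rinv *m intv 0 tau (fun s => expmx (- s *: A) *m f s) +
     intv 0 t (fun s => expmx (- s *: A) *m f s)).
Proof.
move=> bf tt; rewrite mulmxDr -(@intv_mulmx _ _ tau)//; last exact: bmeas_expN.
congr (_ + _); apply: eq_intv => s _.
by rewrite mulmxA -expmxD.
Qed.

Lemma Kop_linear f h (l : R) t : bmeas tau f -> bmeas tau h -> t <= tau ->
  Kop (fun s => l *: f s + h s) t = l *: Kop f t + Kop h t.
Proof.
move=> bf bh tt.
have E (v : R -> 'cV[R]_n) : (fun s => l *: v s) = (fun s => l%:M *m v s).
  by apply/funext => s; rewrite mul_scalar_mx.
have bZ (v : R -> 'cV[R]_n) : bmeas tau v -> bmeas tau (fun s => l *: v s).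
  move=> bv; rewrite (E v); apply: (@bmeas_mulmx _ _ _ _ _ (opnorm2 (l%:M : 'M[R]_n))) => //.
have I u : u <= tau -> intv 0 u (fun s => expmx (- s *: A) *m (l *: f s + h s)) =
   l *: intv 0 u (fun s => expmx (- s *: A) *m f s) +
   intv 0 u (fun s => expmx (- s *: A) *m h s).
  move=> ut; rewrite -mul_scalar_mx -(@intv_mulmx _ _ tau)//; last exact: bmeas_expN.
  rewrite -(@intvD _ _ tau)//; last 2 first.
  - by rewrite -(E (fun s => expmx (- s *: A) *m f s)); apply: bZ; exact: bmeas_expN.
  - exact: bmeas_expN.
  by apply: eq_intv => s _; rewrite mulmxDr -scalemxAr mul_scalar_mx.
rewrite !Kop_factor ?I//; last by apply: bmeasD => //; exact: bZ.
rewrite scalemxAr -mulmxDr; congr (_ *m _).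
by rewrite mulmxDr -scalemxAr scalerDr addrACA.
Qed.

Lemma Kop_continuous f : 0 <= tau -> bmeas tau f ->
  {within `[0, tau], continuous (Kop f)}.
Proof.
move=> tau0 bf.
set c := Rinv *m intv 0 tau (fun s => expmx (- s *: A) *m f s).
pose I t := intv 0 t (fun s => expmx (- s *: A) *m f s).
have hE : {in `[0, tau]%classic, (fun t => expmx (t *: A) *m (c + I t)) =1 Kop f}.
  move=> t; rewrite inE/= in_itv/= => /andP[_ tt].
  by rewrite (Kop_factor bf tt).
clearbody c.
apply: (subspace_eq_continuous hE) => t; apply: cvg_coordP => i.
rewrite mxE.
rewrite (_ : (fun x => _) =
    (fun t => \sum_j expmx (t *: A) i j * (c j 0 + I t j 0))); last first.
  by apply/funext => s; rewrite mxE; apply: eq_bigr => j _; rewrite mxE.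
apply: cvg_sumr => j; rewrite mxE; apply: cvgM.
  by apply: continuous_subspaceT; exact: expmx_entry_continuous.
apply: cvgD; first exact: cvg_cst.
by apply: intv_continuous => //; exact: bmeas_expN.
Qed.

Lemma KXE f t : 0 <= tau -> bmeas tau f -> `[0, tau]%classic t ->
  KX f t = Kop f t.
Proof.
move=> tau0 bf ht.
have hF : patch (fun=> 0) `[0, tau] (Kop f) \in contI tau n.
  apply/asboolP; split.
    apply: (subspace_eq_continuous _ (Kop_continuous tau0 bf)) => s hs.
    by rewrite /= /from_subspace/= patchT.
  by move=> s hs; rewrite /patch memNset.
have vE : val (KX f) = patch (fun=> 0) `[0, tau] (Kop f) by rewrite /KX insubdK.
by rewrite -[LHS]/(val (KX f) t) vE /patch mem_set.
Qed.

Lemma Kop_ae_eq f h t : t <= tau ->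
  (forall i, measurable_fun `[0, tau] (fun s => f s i 0)) ->
  (forall i, measurable_fun `[0, tau] (fun s => h s i 0)) ->
  (@lebesgue_measure R).-negligible [set s | `[0, tau]%classic s /\ f s <> h s] ->
  Kop f t = Kop h t.
Proof.
move=> tt mf mh fh.
have I (a c u : R) : u <= tau ->
    intv 0 u (fun s => expmx ((a + c * s) *: A) *m f s) =
    intv 0 u (fun s => expmx ((a + c * s) *: A) *m h s).
  move=> ut; apply: (@intv_ae_eq _ _ tau) => // [i|i|].
  - by apply: measurable_mulmx => //; exact: measurable_expmx.
  - by apply: measurable_mulmx => //; exact: measurable_expmx.
  apply: negligibleS fh => s /= [hs fhs]; split => // E.
  by apply: fhs; rewrite E.
have EN (v : R -> 'cV[R]_n) : (fun s => expmx (- s *: A) *m v s) =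
    (fun s => expmx ((0 + -1 * s) *: A) *m v s).
  by apply/funext => s; rewrite add0r mulN1r.
have EB (v : R -> 'cV[R]_n) : (fun s => expmx ((t - s) *: A) *m v s) =
    (fun s => expmx ((t + -1 * s) *: A) *m v s).
  by apply/funext => s; rewrite mulN1r.
have I1 := I 0 (-1) tau (lexx _); rewrite -(EN f) -(EN h) in I1.
have I2 := I t (-1) t tt; rewrite -(EB f) -(EB h) in I2.
by rewrite /Kop I1 I2.
Qed.

Lemma eq_KX f h : (forall t, `[0, tau]%classic t -> Kop f t = Kop h t) -> KX f = KX h.
Proof.
move=> fh; rewrite /KX.
suff -> : patch (fun=> 0) `[0, tau] (Kop f) = patch (fun=> 0) `[0, tau] (Kop h) by [].
by apply/funext => t; rewrite /patch; case: ifPn => // /[!inE] /fh.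
Qed.

Lemma KX_linear f h (l : R) : 0 <= tau -> bmeas tau f -> bmeas tau h ->
  KX (fun s => l *: f s + h s) = l *: KX f + KX h.
Proof.
move=> tau0 bf bh; apply: Xfun_inj => t /[dup] ht.
rewrite /= in_itv/= => /andP[_ tt].
have bZ : bmeas tau (fun s => l *: f s + h s).
  apply: bmeasD => //; rewrite (_ : (fun s => _) = (fun s => l%:M *m f s)).
    by apply: (@bmeas_mulmx _ _ _ _ _ (opnorm2 (l%:M : 'M[R]_n))).
  by apply/funext => s; rewrite mul_scalar_mx.
rewrite (KXE tau0 bZ ht) (Kop_linear _ bf bh tt).
by rewrite -(KXE tau0 bf ht) -(KXE tau0 bh ht).
Qed.

End KernelOperator.

(** * Bounds of the periodic solution operator *)

Section KernelBounds.
Variables (R : realType) (n : nat) (tau : R) (A : 'M[R]_n) (M omega : R).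
Hypotheses (tau0 : 0 < tau) (M1 : 1 <= M) (omega0 : 0 < omega).
Hypothesis hexp : forall t : R, - tau <= t <= tau ->
  opnorm2 (expmx (t *: A)) <= M * expR (omega * `|t|).
Implicit Types (f h : R -> 'cV[R]_n) (t : R).

(** The two integrals of [Kop] are estimated separately. Over the whole period the
    exponential is bounded through [M] and [omega]; in the convolution both this
    bound and [expR (opnorm2 A * t)] are used, as in the constants of the theorem. *)
Lemma norm2_fundamental_le f (K p q : R) : bmeas tau f -> 0 <= K ->
  (forall s, 0 <= s <= tau -> norm2 (f s) <= p + q * expR (K * s)) ->
  norm2 (intv 0 tau (fun s => expmx (- s *: A) *m f s)) <=
  M * (p * (expR (omega * tau) - 1) / omega +
       q * (expR ((K + omega) * tau) - 1) / (K + omega)).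
Proof.
move=> bf K0 hf.
have w0 : omega != 0 by rewrite gt_eqF.
have Kw0 : K + omega != 0 by rewrite gt_eqF// ltr_wpDl.
pose al := M * p / omega; pose be := M * q / (K + omega).
have := @norm2_intv_le _ _ tau (fun s => expmx (- s *: A) *m f s)
   (fun x => al * expR (omega * x) + be * expR ((K + omega) * x) + 0 * x) _ tau _
   (bmeas_expN A bf) (is_derive_exp_comb al omega be (K + omega) 0)
   (@continuous_exp_comb R _ _ _ _ _).
rewrite (ltW tau0) lexx => /(_ isT) h; apply: (le_trans (h _)); last first.
  rewrite !mulr0 expR0 !mulr1 !mul0r !addr0 /al /be le_eqVlt; apply/orP; left; apply/eqP.
  by field; rewrite w0 Kw0.
move=> s /andP[s0 st]; rewrite addr0.
have hs := hf s; rewrite s0 st in hs.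
have hA : opnorm2 (expmx (- s *: A)) <= M * expR (omega * s).
  rewrite (le_trans (hexp _))// ?normrN ?ger0_norm//.
  by rewrite lerN2 st/= (le_trans _ (ltW tau0))// oppr_le0.
rewrite (le_trans (norm2_mulmx _ _))//.
rewrite (le_trans (ler_pM (opnorm2_ge0 _) (norm2_ge0 _) hA (hs isT)))//.
rewrite /al /be (divfK w0) (divfK Kw0) le_eqVlt; apply/orP; left; apply/eqP.
by rewrite mulrDl expRD; ring.
Qed.

Lemma norm2_convolution_le f (b : R) t : 0 <= t <= tau -> bmeas tau f ->
  (forall s, 0 <= s <= tau -> norm2 (f s) <= b) ->
  norm2 (intv 0 t (fun s => expmx ((t - s) *: A) *m f s)) <=
  M * b * (expR (omega * t) - 1) / omega.
Proof.
move=> tt bf hf; have /andP[t0 ttau] := tt.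
have w0 : omega != 0 by rewrite gt_eqF.
pose al := - (M * b / omega * expR (omega * t)).
have := @norm2_intv_le _ _ tau (fun s => expmx ((t - s) *: A) *m f s)
   (fun x => al * expR (- omega * x) + 0 * expR (0 * x) + 0 * x) _ t tt
   (bmeas_expB A t bf) (is_derive_exp_comb al (- omega) 0 0 0)
   (@continuous_exp_comb R _ _ _ _ _).
move=> h; apply: (le_trans (h _)); last first.
  rewrite !mulr0 expR0 !mulr1 !mul0r !addr0 /al le_eqVlt; apply/orP; left; apply/eqP.
  by rewrite [- omega * t]mulNr expRN; field; rewrite w0 gt_eqF ?expR_gt0.
move=> s /andP[s0 st]; rewrite addr0 !mul0r addr0.
have hs : norm2 (f s) <= b by apply: hf; rewrite s0 (le_trans st).
have hA : opnorm2 (expmx ((t - s) *: A)) <= M * expR (omega * (t - s)).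
  by rewrite (le_trans (hexp _))// ?ger0_norm ?subr_ge0//; lra.
rewrite (le_trans (norm2_mulmx _ _))//.
rewrite (le_trans (ler_pM (opnorm2_ge0 _) (norm2_ge0 _) hA hs))//.
rewrite /al le_eqVlt; apply/orP; left; apply/eqP.
by rewrite [omega * (t - s)]mulrBr expRD [- omega * s]mulNr; field.
Qed.

Lemma norm2_convolution_exp_le f (L p q : R) t : 0 <= t <= tau -> bmeas tau f ->
  0 <= L -> 0 <= p ->
  (forall s, 0 <= s <= t ->
     norm2 (f s) <= L * (p + q * expR ((opnorm2 A + L) * s))) ->
  norm2 (intv 0 t (fun s => expmx ((t - s) *: A) *m f s)) <=
  expR (opnorm2 A * t) * (p * L * t + q * (expR (L * t) - 1)).
Proof.
move=> tt bf L0 p0 hf; have /andP[t0 ttau] := tt.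
pose a := opnorm2 A; have a0 : 0 <= a := opnorm2_ge0 A.
pose al := expR (a * t) * q; pose ga := expR (a * t) * (p * L).
have := @norm2_intv_le _ _ tau (fun s => expmx ((t - s) *: A) *m f s)
   (fun x => al * expR (L * x) + 0 * expR (0 * x) + ga * x) _ t tt
   (bmeas_expB A t bf) (is_derive_exp_comb al L 0 0 ga)
   (@continuous_exp_comb R _ _ _ _ _).
move=> h; apply: (le_trans (h _)); last first.
  rewrite !mulr0 expR0 !mulr1 !mul0r !addr0 /al /ga le_eqVlt; apply/orP; left; apply/eqP.
  by ring.
move=> s /[dup] hs /andP[s0 st]; rewrite !mul0r addr0.
have hA : opnorm2 (expmx ((t - s) *: A)) <= expR (a * (t - s)).
  by rewrite opnorm2_expmxZ// subr_ge0.
rewrite (le_trans (norm2_mulmx _ _))//.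
rewrite (le_trans (ler_pM (opnorm2_ge0 _) (norm2_ge0 _) hA (hf s hs)))//.
have e1 : expR (a * (t - s)) <= expR (a * t).
  by rewrite ler_expR ler_wpM2l// gerBl.
have -> : expR (a * (t - s)) * (L * (p + q * expR ((a + L) * s))) =
    expR (a * (t - s)) * (p * L) + expR (a * t) * q * L * expR (L * s).
  rewrite [(a + L) * s]mulrDl expRD.
  have -> : expR (a * t) = expR (a * (t - s)) * expR (a * s).
    by rewrite -expRD -mulrDr subrK.
  by ring.
by rewrite addrC lerD2l /ga ler_wpM2r// mulr_ge0.
Qed.

(** The norm of [Kop] from bounded functions to continuous functions is at most
    [kappa]; it is the common factor of [rho0] and [rho2]. *)
Definition kappa : R := M * (expR (omega * tau) - 1) *
  (1 + M * Rtau tau A * expR (omega * tau)) / omega.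

Lemma norm2_Kop_split f (E I1 J1 : R) t :
  opnorm2 (expmx (t *: A)) <= E ->
  norm2 (intv 0 tau (fun s => expmx (- s *: A) *m f s)) <= I1 ->
  norm2 (intv 0 t (fun s => expmx ((t - s) *: A) *m f s)) <= J1 ->
  norm2 (Kop tau A f t) <= E * (Rtau tau A * I1) + J1.
Proof.
move=> hE hI hJ; rewrite (le_trans (norm2D _ _))// lerD//.
rewrite (le_trans (norm2_mulmx _ _))// ler_pM ?opnorm2_ge0 ?norm2_ge0//.
exact: norm2_mulmx_le.
Qed.

Lemma norm2_Kop_le f (b : R) t : 0 <= t <= tau -> bmeas tau f ->
  (forall s, 0 <= s <= tau -> norm2 (f s) <= b) ->
  norm2 (Kop tau A f t) <= kappa * b.
Proof.
move=> tt bf hf; have /andP[t0 ttau] := tt.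
have h1 : norm2 (intv 0 tau (fun s => expmx (- s *: A) *m f s)) <=
    M * (b * (expR (omega * tau) - 1) / omega).
  have := @norm2_fundamental_le f 0 b 0 bf (lexx 0).
  rewrite !mul0r addr0; apply => s hs; rewrite mul0r addr0; exact: hf.
have h2 := norm2_convolution_le tt bf hf.
have b0 : 0 <= b by apply: le_trans (norm2_ge0 _) (hf 0 _); rewrite lexx ltW.
have M0 : 0 <= M by apply: le_trans M1.
have et : expR (omega * t) <= expR (omega * tau) by rewrite ler_expR ler_wpM2l// ltW.
have hE : opnorm2 (expmx (t *: A)) <= M * expR (omega * tau).
  rewrite (le_trans (hexp _))// ?ger0_norm//; last by rewrite ler_wpM2l.
  by rewrite ttau andbT (le_trans _ t0)// oppr_le0 ltW.
rewrite (le_trans (norm2_Kop_split hE h1 h2))//.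
apply: (@le_trans _ _ (M * expR (omega * tau) *
   (Rtau tau A * (M * (b * (expR (omega * tau) - 1) / omega))) +
   M * b * (expR (omega * tau) - 1) / omega)).
  by rewrite lerD2l ler_wpM2r ?invr_ge0 ?(ltW omega0)// ler_wpM2l ?mulr_ge0// lerB.
rewrite le_eqVlt; apply/orP; left; apply/eqP; rewrite /kappa; field.
by rewrite gt_eqF.
Qed.

Section Weighted.
Variable L : R.
Hypothesis L0 : 0 <= L.
Let a := opnorm2 A.
Let a0 : 0 <= a. Proof. exact: opnorm2_ge0. Qed.

(** [Sconst] without its factor [sqrt n]. *)
Definition sconst1 : R :=
  M * L * Rtau tau A * (expR ((opnorm2 A + L + omega) * tau) - 1) /
  (opnorm2 A + L + omega).

Lemma sconst1_ge0 : 0 <= sconst1.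
Proof.
have R0 : 0 <= Rtau tau A by exact: opnorm2_ge0.
have M0 : 0 <= M by exact: le_trans M1.
have w0 := ltW omega0; have t0 := ltW tau0.
have e0 : 0 <= expR ((opnorm2 A + L + omega) * tau) - 1.
  by rewrite subr_ge0 -[leLHS]expR0 ler_expR mulr_ge0 ?addr_ge0.
by apply: divr_ge0; [rewrite !mulr_ge0|rewrite !addr_ge0].
Qed.

Lemma fundamental_gain_ge0 :
  0 <= M * L * Rtau tau A * (expR (omega * tau) - 1) / omega.
Proof.
have R0 : 0 <= Rtau tau A by exact: opnorm2_ge0.
have M0 : 0 <= M by exact: le_trans M1.
have w0 := ltW omega0; have t0 := ltW tau0.
have e0 : 0 <= expR (omega * tau) - 1.
  by rewrite subr_ge0 -[leLHS]expR0 ler_expR mulr_ge0.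
by apply: divr_ge0 => //; rewrite !mulr_ge0.
Qed.

(** The weight [e^((a + L) t)] is a strict supersolution of the positive operator
    that dominates [Kop \o (g' *m)]; a bound by a multiple of it is therefore
    improved by a fixed factor less than 1 as soon as [sconst1 < 1]. *)
Lemma norm2_Kop_weighted f (m : R) t : 0 <= t <= tau -> bmeas tau f -> 0 <= m ->
  sconst1 <= 1 ->
  (forall s, 0 <= s <= tau -> norm2 (f s) <= L * (m * expR ((a + L) * s))) ->
  norm2 (Kop tau A f t) <=
    (1 - (1 - sconst1) * expR (- (L * tau))) * m * expR ((a + L) * t).
Proof.
move=> tt bf m0 S1 hf; have /andP[t0 ttau] := tt.
have K0 : 0 <= a + L by rewrite addr_ge0.
have KL0 : a + L + omega != 0 by rewrite gt_eqF// ltr_wpDl.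
have h1 : norm2 (intv 0 tau (fun s => expmx (- s *: A) *m f s)) <=
    M * (L * m * (expR ((a + L + omega) * tau) - 1) / (a + L + omega)).
  have := @norm2_fundamental_le f (a + L) 0 (L * m) bf K0.
  by rewrite !mul0r add0r; apply => s hs; rewrite add0r -mulrA; exact: hf.
have h2 : norm2 (intv 0 t (fun s => expmx ((t - s) *: A) *m f s)) <=
    expR (a * t) * (m * (expR (L * t) - 1)).
  have := @norm2_convolution_exp_le f L 0 m t tt bf L0 (lexx 0).
  rewrite !mul0r add0r; apply => s /andP[s0 st]; rewrite add0r.
  by apply: hf; rewrite s0 (le_trans st).
rewrite (le_trans (norm2_Kop_split (opnorm2_expmxZ _ t0) h1 h2))//.
have -> : expR ((a + L) * t) = expR (a * t) * expR (L * t) by rewrite [(a + L) * t]mulrDl expRD.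
apply: (@le_trans _ _ (expR (a * t) * (m * (expR (L * t) - (1 - sconst1))))).
  by rewrite le_eqVlt; apply/orP; left; apply/eqP; rewrite /sconst1 -/a; field.
rewrite [leRHS]mulrCA ler_wpM2l ?expR_ge0// [leRHS]mulrAC mulrC ler_wpM2r//.
rewrite mulrBl mul1r lerD2l lerN2 -mulrA ler_piMr ?subr_ge0//.
by rewrite -expRD -expR0 ler_expR addrC subr_le0 ler_wpM2l.
Qed.

(** [1 + (c + L t) e^((a + L) t)] is a supersolution of the affine problem
    [v = Kop (g' v) - w] with [|w| <= 1]. Its growth [c + L t], instead of the
    multiple of the exponential that the preceding weight would give, is what makes
    the resulting bound of the inverse as small as [rho1]. *)
Lemma norm2_Kop_supersolution f (m c : R) t : 0 <= t <= tau -> bmeas tau f ->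
  0 <= m -> 0 <= c ->
  M * L * Rtau tau A * (expR (omega * tau) - 1) / omega +
    (c + L * tau) * sconst1 <= c ->
  (forall s, 0 <= s <= tau ->
     norm2 (f s) <= L * (m * (1 + (c + L * s) * expR ((a + L) * s)))) ->
  norm2 (Kop tau A f t) <= m * ((c + L * t) * expR ((a + L) * t)).
Proof.
move=> tt bf m0 c0 hc hf; have /andP[t0 ttau] := tt.
have K0 : 0 <= a + L by rewrite addr_ge0.
have KL0 : a + L + omega != 0 by rewrite gt_eqF// ltr_wpDl.
have w0 : omega != 0 by rewrite gt_eqF.
have h1 : norm2 (intv 0 tau (fun s => expmx (- s *: A) *m f s)) <=
    M * (L * m * (expR (omega * tau) - 1) / omega +
     L * m * (c + L * tau) * (expR ((a + L + omega) * tau) - 1) / (a + L + omega)).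
  apply: (norm2_fundamental_le bf K0) => s /[dup] hs /andP[s0 st].
  rewrite (le_trans (hf s hs))//.
  have -> : L * m + L * m * (c + L * tau) * expR ((a + L) * s) =
    L * (m * (1 + (c + L * tau) * expR ((a + L) * s))) by ring.
  rewrite ler_wpM2l// ler_wpM2l// lerD2l ler_wpM2r ?expR_ge0// lerD2l.
  by rewrite ler_wpM2l.
have h2 : norm2 (intv 0 t (fun s => expmx ((t - s) *: A) *m f s)) <=
    expR (a * t) * (m * L * t + m * (c + L * t) * (expR (L * t) - 1)).
  apply: (norm2_convolution_exp_le tt bf L0 m0) => s /andP[s0 st].
  rewrite (le_trans (hf s _))// ?s0 ?(le_trans st)// ler_wpM2l//.
  have -> : m + m * (c + L * t) * expR ((a + L) * s) =
    m * (1 + (c + L * t) * expR ((a + L) * s)) by ring.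
  rewrite ler_wpM2l// lerD2l.
  by rewrite ler_wpM2r ?expR_ge0// lerD2l ler_wpM2l.
rewrite (le_trans (norm2_Kop_split (opnorm2_expmxZ _ t0) h1 h2))//.
rewrite [(a + L) * t]mulrDl expRD.
apply: (@le_trans _ _ (expR (a * t) * m *
    (M * L * Rtau tau A * (expR (omega * tau) - 1) / omega +
     (c + L * tau) * sconst1 + (L * t + (c + L * t) * (expR (L * t) - 1))))).
  rewrite le_eqVlt; apply/orP; left; apply/eqP; rewrite /sconst1 -/a; field.
  by rewrite KL0 w0.
rewrite (_ : m * _ = expR (a * t) * m * ((c + L * t) * expR (L * t))); last by ring.
rewrite ler_wpM2l ?mulr_ge0 ?expR_ge0//.
rewrite (_ : (c + L * t) * expR (L * t) =
  c + (L * t + (c + L * t) * (expR (L * t) - 1))); last by ring.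
by rewrite lerD2r.
Qed.

End Weighted.

End KernelBounds.

(** * Directional derivatives and Taylor estimates *)

Section Directional.
Variables (R : realType) (n : nat).
Implicit Types (f : 'cV[R]_n -> R) (x d v w : 'cV[R]_n).

Lemma is_derive_line f x d (s : R) : derivable f (x + s *: d) d ->
  is_derive s (1 : R) (fun u => f (x + u *: d)) ('D_d f (x + s *: d)).
Proof.
move=> df.
have E : (fun h : R => h^-1 *:
    (((fun u => f (x + u *: d)) \o shift s) (h *: (1 : R)) - f (x + s *: d))) =
  (fun h => h^-1 *: ((f \o shift (x + s *: d)) (h *: d) - f (x + s *: d))).
  apply/funext => h /=; congr (_ *: (f _ - _)).
  by rewrite -[h *: (1 : R)]/(h * 1) mulr1 scalerDl addrCA addrA.
by split; [rewrite /derivable E|rewrite /derive E].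
Qed.

Lemma is_derive_line0 f x d l : is_derive (0 : R) (1 : R) (fun u => f (x + u *: d)) l ->
  is_derive x d f l.
Proof.
have E : (fun h : R => h^-1 *:
    (((fun u => f (x + u *: d)) \o shift (0 : R)) (h *: (1 : R)) -
     f (x + (0 : R) *: d))) =
  (fun h => h^-1 *: ((f \o shift x) (h *: d) - f x)).
  apply/funext => h /=; rewrite scale0r !addr0; congr (_ *: (f _ - _)).
  by rewrite -[h *: (1 : R)]/(h * 1) mulr1 addrC.
by move=> [h1 h2]; split; [rewrite /derivable -E|rewrite /derive -E].
Qed.

Lemma is_derive_dirZ f x d (k : R) : derivable f x d ->
  is_derive x (k *: d) f (k * 'D_d f x).
Proof.
move=> df; apply: is_derive_line0.
have h1 : is_derive (0 : R) (1 : R) (fun u : R => u * k) k.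
  by apply: is_derive_eq; rewrite /GRing.scale/= ?mulr1 ?mulr0 ?add0r ?addr0.
have h2 : is_derive ((0 : R) * k) (1 : R) (fun u => f (x + u *: d)) ('D_d f x).
  have := @is_derive_line f x d 0; rewrite scale0r addr0 mul0r; exact.
rewrite (_ : (fun u => _) = (fun u => f (x + u *: d)) \o (fun u : R => u * k)); last first.
  by apply/funext => u /=; rewrite scalerA.
by apply: is_derive_eq; rewrite mulrC.
Qed.

Lemma mean_value_segment f x d :
  (forall s : R, 0 <= s <= 1 -> derivable f (x + s *: d) d) ->
  exists2 c : R, 0 <= c <= 1 & f (x + d) - f x = 'D_d f (x + c *: d).
Proof.
move=> df.
have iD (s : R) : 0 <= s <= 1 ->
    is_derive s (1 : R) (fun u => f (x + u *: d)) ('D_d f (x + s *: d)).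
  by move=> hs; apply: is_derive_line; exact: df.
have [||c] := @MVT_segment R (fun u => f (x + u *: d)) (fun s => 'D_d f (x + s *: d)) 0 1 ler01.
- move=> s; rewrite in_itv/= => /andP[s0 s1]; apply: iD.
  by rewrite !ltW.
- apply: derivable_within_continuous => s; rewrite in_itv/= => hs.
  exact: (ex_derive (is_derive := iD s hs)).
rewrite in_itv/= => hc; rewrite scale1r scale0r addr0 subr0 mulr1 => ->.
by exists c.
Qed.

(** Only [v] needs a continuous derivative: the increment along [h w + h v] is split
    at [h w], and the mean value theorem is applied on the second leg. *)
Lemma is_derive_dirD (D : set 'cV[R]_n) f x v w : open D -> D x ->
  (forall y, D y -> derivable f y v) -> derivable f x w ->
  {for x, continuous ('D_v f)} ->
  is_derive x (v + w) f ('D_v f x + 'D_w f x).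
Proof.
move=> oD Dx dv dw cv.
suff h : (fun h : R => h^-1 *: ((f \o shift x) (h *: (v + w)) - f x)) @ 0^' -->
    'D_v f x + 'D_w f x.
  by split; [exact: cvgP h|exact: cvg_lim h].
have hw : (fun h : R => h^-1 *: ((f \o shift x) (h *: w) - f x)) @ 0^' --> 'D_w f x by [].
have hv : (fun h : R => h^-1 *: (f (x + h *: w + h *: v) - f (x + h *: w))) @ 0^' -->
    'D_v f x.
  apply/cvgrPdist_le => e e0.
  have : \forall y \near x, D y /\ `|'D_v f x - 'D_v f y| <= e.
    near=> y; split; near: y; first exact: open_nbhs_nbhs.
    exact: (@cvgr_dist_le _ _ _ (nbhs x) _ _ _ cv).
  move=> /nbhs_ballP[r /= r0 hr].
  have vw0 : 0 < `|v| + `|w| + 1 by rewrite ltr_wpDl// addr_ge0.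
  near=> h.
  have h0 : h != 0 by near: h; exact: nbhs_dnbhs_neq.
  have hsmall : `|h| < r / (`|v| + `|w| + 1).
    near: h; apply: dnbhs0_lt; exact: divr_gt0.
  have hD (s : R) : 0 <= s <= 1 -> ball x r (x + h *: w + s *: (h *: v)).
    move=> /andP[s0 s1]; rewrite -ball_normE /ball_/= -addrA opprD addNKr normrN.
    move: hsmall; rewrite ltr_pdivlMr// => /(le_lt_trans _); apply.
    rewrite (le_trans (ler_normD _ _))// !normrZ mulrDr mulrDr mulr1.
    rewrite -addrA addrCA lerD// [`|s|]ger0_norm//.
    rewrite (le_trans _ (_ : `|h| * `|v| <= _))// ?lerDl// ler_piMl// mulr_ge0.
  have dl (s : R) : 0 <= s <= 1 -> derivable f (x + h *: w + s *: (h *: v)) (h *: v).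
    move=> hs; have [Dy _] := hr _ (hD s hs).
    exact: (ex_derive (is_derive := is_derive_dirZ h (dv _ Dy))).
  have [c hc ->] := mean_value_segment dl.
  have [Dy hy] := hr _ (hD c hc).
  rewrite (derive_val (is_derive := is_derive_dirZ h (dv _ Dy))).
  by rewrite /GRing.scale/= mulKf.
apply: cvg_trans (cvgD hv hw); apply: near_eq_cvg; near=> h.
rewrite !fctE /=.
have -> : h *: (v + w) + x = x + h *: w + h *: v.
  by rewrite scalerDr addrC addrA addrAC.
by rewrite [h *: w + x]addrC -[LHS]scalerDr addrA subrK.
Unshelve. all: by end_near. Qed.

End Directional.

Section Gradient.
Variables (R : realType) (n : nat) (D : set 'cV[R]_n).
Hypothesis oD : open D.
Implicit Types (f : 'cV[R]_n -> R) (x y z d v w : 'cV[R]_n).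

Definition grad f x : 'cV[R]_n := \col_j partial j f x.

Lemma CkW k f : Ck D k.+1 f -> Ck D k f.
Proof.
elim: k f => [f []//|k IH f [cf h]]; split=> // j; have [dj cj] := h j.
by split=> //; exact: IH.
Qed.

(** By induction on the coordinates of [d], with [is_derive_dirD]. *)
Lemma is_derive_grad f x d : Ck D 1 f -> D x ->
  is_derive x d f (\sum_j grad f x j 0 * d j 0).
Proof.
move=> [_ cf] Dx.
have -> : d = \sum_(j < n) d j 0 *: delta_mx j 0.
  apply/colP => i; rewrite summxE (bigD1 i)//= big1 => [|j ji].
    by rewrite !mxE !eqxx mulr1 addr0.
  by rewrite !mxE eq_sym (negbTE ji) mulr0.
rewrite (eq_bigr (fun j => d j 0 * partial j f x)); last first.
  move=> i _; rewrite summxE (bigD1 i)//= big1 => [|j ji].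
    by rewrite !mxE !eqxx mulr1 addr0 mulrC.
  by rewrite !mxE eq_sym (negbTE ji) mulr0.
elim: (index_enum _) => [|j s IH]; first by rewrite !big_nil; exact: is_derive0.
rewrite !big_cons.
have dZ y : D y -> is_derive y (d j 0 *: delta_mx j 0) f (d j 0 * partial j f y).
  by move=> Dy; apply: is_derive_dirZ; exact: (cf j).1.
rewrite -(derive_val (is_derive := IH)) -(derive_val (is_derive := dZ _ Dx)).
apply: (is_derive_dirD oD Dx).
- by move=> y Dy; exact: (ex_derive (is_derive := dZ _ Dy)).
- exact: (ex_derive (is_derive := IH)).
- have c : (fun y => d j 0 * partial j f y) @ x --> d j 0 * partial j f x.
    by apply: (@cvgMl_tmp _ _ (nbhs x)); exact: ((cf j).2 x Dx).
  apply/(@cvgrPdist_le _ _ _ (nbhs x)) => e e0.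
  near=> y.
  have Dy : D y by near: y; exact: open_nbhs_nbhs.
  rewrite (derive_val (is_derive := dZ _ Dx)) (derive_val (is_derive := dZ _ Dy)).
  by near: y; exact: (@cvgr_dist_le _ _ _ (nbhs x) _ _ _ c).
Unshelve. all: by end_near. Qed.

Section Hessian.
Variables (f : 'cV[R]_n -> R) (H : R).
Hypotheses (f2 : Ck D 2 f) (hH : forall x, D x -> opnorm2 (hessian_mx f x) <= H).

Lemma is_derive_grad_line x d v (s : R) : D (x + s *: d) ->
  is_derive s (1 : R) (fun u => \sum_j grad f (x + u *: d) j 0 * v j 0)
    (\sum_i d i 0 * (hessian_mx f (x + s *: d) *m v) i 0).
Proof.
move=> Ds.
have hj j : is_derive s (1 : R) (fun u => partial j f (x + u *: d) * v j 0)
    ((\sum_i partial i (partial j f) (x + s *: d) * d i 0) * v j 0).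
  have hp : is_derive s (1 : R) (fun u => partial j f (x + u *: d))
      (\sum_i partial i (partial j f) (x + s *: d) * d i 0).
    have h := is_derive_grad d (f2.2 j).2 Ds.
    rewrite (_ : \sum_i _ = 'D_d (partial j f) (x + s *: d)).
      by apply: is_derive_line; exact: (ex_derive (is_derive := h)).
    rewrite (derive_val (is_derive := h)).
    by apply: eq_bigr => i _; rewrite mxE.
  by apply: is_derive_eq; rewrite /GRing.scale/= mulr0 add0r mulrC.
have hs := is_derive_sum hj.
rewrite (_ : (fun u => _) =
    \sum_(j < n) (fun u => partial j f (x + u *: d) * v j 0)); last first.
  by apply/funext => u; rewrite fct_sumE; apply: eq_bigr => j _; rewrite mxE.
apply: is_derive_eq.
under eq_bigr do rewrite mulr_suml.
rewrite exchange_big/=; apply: eq_bigr => i _.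
rewrite mxE mulr_sumr; apply: eq_bigr => j _.
by rewrite mxE [_ * d i 0]mulrC mulrA.
Qed.

Lemma hessian_bilinear_le x d v : D x ->
  `|\sum_i d i 0 * (hessian_mx f x *m v) i 0| <= H * norm2 d * norm2 v.
Proof.
move=> Dx; rewrite (le_trans (dot_le _ _))// [H * _]mulrC -mulrA.
rewrite ler_wpM2l ?norm2_ge0// (le_trans (norm2_mulmx _ _))//.
by rewrite ler_wpM2r ?norm2_ge0// hH.
Qed.

Lemma grad_lipschitz x z v :
  (forall s : R, 0 <= s <= 1 -> D (z + s *: (x - z))) ->
  `|\sum_j (grad f x j 0 - grad f z j 0) * v j 0| <= H * norm2 (x - z) * norm2 v.
Proof.
move=> hD.
pose psi (u : R) := \sum_j grad f (z + u *: (x - z)) j 0 * v j 0.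
pose dpsi (s : R) :=
  \sum_i (x - z) i 0 * (hessian_mx f (z + s *: (x - z)) *m v) i 0.
have iD (s : R) : 0 <= s <= 1 -> is_derive s (1 : R) psi (dpsi s).
  by move=> hs; apply: is_derive_grad_line; exact: hD.
have [||c] := @MVT_segment R psi dpsi 0 1 ler01.
- by move=> s; rewrite in_itv/= => /andP[s0 s1]; apply: iD; rewrite !ltW.
- apply: derivable_within_continuous => s; rewrite in_itv/= => hs.
  exact: (ex_derive (is_derive := iD s hs)).
rewrite in_itv/= subr0 mulr1 => hc E.
have -> : \sum_j (grad f x j 0 - grad f z j 0) * v j 0 = psi 1 - psi 0.
  rewrite /psi -sumrB scale1r scale0r addr0 addrC subrK.
  by apply: eq_bigr => j _; rewrite mulrBl.
by rewrite E hessian_bilinear_le//; exact: hD.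
Qed.

(** The linear part is frozen at a third point [z]. The sharp factor 1/2 comes from
    integrating the Lipschitz bound of the gradient along the segment from [y] to
    [x]; here this is a comparison of derivatives. *)
Lemma taylor_estimate (C : set 'cV[R]_n) x y z : C `<=` D ->
  (forall a b (s : R), C a -> C b -> 0 <= s <= 1 -> C (a + s *: (b - a))) ->
  C x -> C y -> C z ->
  `|f x - f y - \sum_j grad f z j 0 * (x - y) j 0| <=
  H / 2 * (norm2 (x - z) + norm2 (y - z)) * norm2 (x - y).
Proof.
move=> CD Cc Cx Cy Cz; pose d := x - y.
pose G := \sum_j grad f z j 0 * d j 0.
pose a := norm2 (y - z); pose b := norm2 (x - z).
have H0 : 0 <= H by apply: le_trans (opnorm2_ge0 _) (hH (CD _ Cz)).
have main (e : R) : `|e| <= 1 -> e * (f x - f y - G) <= H / 2 * (b + a) * norm2 d.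
  move=> e1.
  pose k := H * norm2 d.
  pose F (s : R) := e * (f (y + s *: d) - s * G) - k * (a * s + (b - a) / 2 * s ^+ 2).
  pose dF (s : R) := e * ('D_d f (y + s *: d) - G) - k * (a + (b - a) * s).
  have Ds (s : R) : 0 <= s <= 1 -> C (y + s *: d) by exact: Cc.
  have f1 : Ck D 1 f by exact: CkW.
  have iD (s : R) : 0 <= s <= 1 -> is_derive s (1 : R) F (dF s).
    move=> hs; have h := is_derive_grad d f1 (CD _ (Ds s hs)).
    have h2 := is_derive_line (ex_derive (is_derive := h)).
    rewrite /F /dF; apply: is_derive_eq.
    by rewrite /GRing.scale/=; field.
  have [||c] := @MVT_segment R F dF 0 1 ler01.
  - by move=> t; rewrite in_itv/= => /andP[s0 s1]; apply: iD; rewrite !ltW.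
  - apply: derivable_within_continuous => t; rewrite in_itv/= => hs.
    exact: (ex_derive (is_derive := iD t hs)).
  rewrite in_itv/= subr0 mulr1 => hc E.
  have dF0 : dF c <= 0.
    rewrite /dF; have Cyc := Ds c hc.
    have -> : 'D_d f (y + c *: d) - G =
        \sum_j (grad f (y + c *: d) j 0 - grad f z j 0) * d j 0.
      rewrite (derive_val (is_derive := is_derive_grad d f1 (CD _ Cyc))) -sumrB.
      by apply: eq_bigr => j _; rewrite mulrBl.
    have seg (s : R) : 0 <= s <= 1 -> D (z + s *: (y + c *: d - z)).
      by move=> hs; apply: CD; exact: Cc.
    have gl := @grad_lipschitz (y + c *: d) z d seg.
    rewrite subr_le0 (le_trans (ler_norm _))// normrM.
    rewrite (le_trans (ler_wpM2r (normr_ge0 _) e1))// mul1r (le_trans gl)//.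
    rewrite mulrAC ler_wpM2l ?mulr_ge0 ?norm2_ge0//.
    have /andP[c0 c1] := hc.
    have -> : y + c *: d - z = (1 - c) *: (y - z) + c *: (x - z).
      rewrite /d; apply/colP => i; rewrite !mxE; ring.
    rewrite (le_trans (norm2D _ _))// !norm2Z !ger0_norm ?subr_ge0//.
    rewrite le_eqVlt; apply/orP; left; apply/eqP; rewrite -/a -/b; ring.
  have F1 : F 1 - F 0 = e * (f x - f y - G) - H / 2 * (b + a) * norm2 d.
    have y1 : y + 1 *: d = x by rewrite scale1r /d addrC subrK.
    by rewrite /F y1 scale0r addr0 /k; field.
  by rewrite -subr_le0 -F1 E.
rewrite ler_norml; apply/andP; split.
  have := main (-1); rewrite normrN1 lexx mulN1r => /(_ isT).
  by rewrite lerNl.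
by have := main 1; rewrite normr1 lexx mul1r; exact.
Qed.

End Hessian.
End Gradient.

Section Jacobian.
Variables (R : realType) (n : nat) (D C : set 'cV[R]_n).
Variables (g : 'cV[R]_n -> 'cV[R]_n) (H : R).
Hypotheses (oD : open D) (g2 : Ckv D 2 g).
Hypothesis hH : forall k x, D x -> opnorm2 (hessian_mx (coordf g k) x) <= H.
Hypothesis CD : C `<=` D.
Hypothesis Cc : forall a b (s : R), C a -> C b -> 0 <= s <= 1 -> C (a + s *: (b - a)).
Implicit Types (x y z v : 'cV[R]_n).

Lemma jacobian_mulE x v k :
  (jacobian_mx g x *m v) k 0 = \sum_j grad (coordf g k) x j 0 * v j 0.
Proof. by rewrite mxE; apply: eq_bigr => j _; rewrite !mxE. Qed.

Lemma jacobian_taylor x y z : C x -> C y -> C z ->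
  norm2 (g x - g y - jacobian_mx g z *m (x - y)) <=
  Num.sqrt n%:R * H / 2 * (norm2 (x - z) + norm2 (y - z)) * norm2 (x - y).
Proof.
move=> Cx Cy Cz; rewrite -!mulrA; apply: norm2_le_coord => k; rewrite !mulrA.
have := @taylor_estimate _ _ _ oD _ H (g2 k) (hH k) C x y z CD Cc Cx Cy Cz.
by rewrite -jacobian_mulE /coordf !mxE.
Qed.

Lemma jacobian_lipschitz x z v : C x -> C z ->
  norm2 (jacobian_mx g x *m v - jacobian_mx g z *m v) <=
  Num.sqrt n%:R * H * norm2 (x - z) * norm2 v.
Proof.
move=> Cx Cz; rewrite -!mulrA; apply: norm2_le_coord => k; rewrite !mulrA.
have seg (s : R) : 0 <= s <= 1 -> D (z + s *: (x - z)).
  by move=> hs; apply: CD; exact: Cc.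
have := @grad_lipschitz _ _ _ oD _ H (g2 k) (hH k) x z v seg.
rewrite (eq_bigr (fun j => grad (coordf g k) x j 0 * v j 0 -
  grad (coordf g k) z j 0 * v j 0)); last by move=> j _; rewrite mulrBl.
rewrite sumrB -!jacobian_mulE.
by rewrite !mxE.
Qed.

End Jacobian.

(** * Completeness of the space of continuous functions *)

Section CXComplete.
Variables (R : realType) (tau : R) (n : nat).

Lemma mxnorm_coord_le_Xnorm (x y : CX tau n) t : `|x t - y t| <= `|x - y|.
Proof.
by rewrite (le_trans (mxnorm_le_norm2 _))// (norm2_le_Xnorm (x - y) t).
Qed.

Lemma CX_complete (F : set_system (CX tau n)) : ProperFilter F -> cauchy F -> cvg F.
Proof.
move=> FF /cauchyP Fc.
have Ft t : cvg ((fun x : CX tau n => x t) @ F).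
  apply/cauchy_cvgP/cauchyP => e e0.
  have [x hx] := Fc e e0; exists (x t).
  suff : F [set y : CX tau n | ball (x t) e (y t)] by [].
  apply: filterS hx => y; rewrite -!ball_normE /ball_/= => h.
  by apply: le_lt_trans h; exact: mxnorm_coord_le_Xnorm.
pose f t := lim ((fun x : CX tau n => x t) @ F).
have fc t : (fun x : CX tau n => x t) @ F --> f t by exact: Ft.
have fclose (x : CX tau n) (e : R) : F (ball x e) -> forall t, norm2 (f t - x t) <= e.
  move=> hx t.
  have h : (fun y : CX tau n => norm2 (y t - x t)) @ F --> norm2 (f t - x t).
    apply: (@continuous_cvg _ _ _ _ _ (fun y : CX tau n => y t - x t) (@norm2 R n)).
      exact: norm2_continuous.
    by apply: cvgB; [exact: fc|exact: cvg_cst].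
  rewrite -(cvg_lim _ h)//; apply: limr_le; first exact: cvgP h.
  apply: filterS hx => y; rewrite -ball_normE /ball_/= distrC => /ltW.
  exact: le_trans (norm2_le_Xnorm (y - x) t).
have fI : f \in contI tau n.
  apply/asboolP; split; last first.
    move=> t ht; rewrite /f (_ : (fun x : CX tau n => x t) = cst 0) ?lim_cst//.
    by apply/funext => x; rewrite X_out.
  move=> t; apply/cvgrPdist_le => e e0.
  have e3 : 0 < e / 3 by rewrite divr_gt0.
  have [x hx] := Fc _ e3.
  have hxt s := le_trans (mxnorm_le_norm2 _) (fclose x _ hx s).
  have /cvgrPdist_le cx := @X_cont _ _ _ x t.
  near=> s.
  have h : `|x t - x s| <= e / 3.
    by near: s; exact: cx.
  rewrite -[f t - f s](subrKA (x t)) (le_trans (ler_normD _ _))//.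
  rewrite -[x t - f s](subrKA (x s)).
  have := hxt t; have := hxt s; have := ler_normD (x t - x s) (x s - f s).
  rewrite [`|x s - f s|]distrC; lra.
apply/cvg_ex; exists (MkX fI); apply/cvgrPdist_le => e e0.
have e2 : 0 < e / 2 by rewrite divr_gt0.
have [x hx] := Fc _ e2.
have hfx : `|MkX fI - x| <= e / 2.
  by apply: Xnorm_le => [|t _]; [exact: ltW|exact: fclose hx t].
apply: filterS hx => y; rewrite -ball_normE /ball_/= => hxy.
rewrite -[_ - y](subrKA x) (le_trans (ler_normD _ _))//.
by move: hfx hxy; lra.
Unshelve. all: by end_near. Qed.

End CXComplete.

HB.instance Definition _ (R : realType) (tau : R) (n : nat) :=
  Uniform_isComplete.Build (CX tau n) (@CX_complete R tau n).

(** * Representatives of essentially bounded functions *)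

Lemma measurable_norm2 (R : realType) n (D : set R) (f : R -> 'cV[R]_n) :
  (forall i, measurable_fun D (fun s => f s i 0)) ->
  measurable_fun D (fun s => norm2 (f s)).
Proof.
move=> mf.
have h1 : measurable_fun D (fun s => \sum_i f s i 0 ^+ 2).
  by apply: measurable_sum => i; exact: measurable_funX.
exact: (measurableT_comp (continuous_measurable_fun (@sqrt_continuous R)) h1).
Qed.

Lemma Linfty_norm_ae (R : realType) (tau : R) n (u : R -> 'cV[R]_n) :
  0 < tau -> Linfty tau u ->
  (@lebesgue_measure R).-negligible
    [set s | `[0, tau]%classic s /\ ~ norm2 (u s) <= fine (Linfty_norm tau u)].
Proof.
move=> tau0 [mu uoo].
pose m := mrestr (@lebesgue_measure R) (measurable_itv `[0, tau]).
have mT : (0 < m setT)%E.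
  by rewrite /m/= /mrestr setTI lebesgue_measure_itv/= lte_fin tau0 -EFinB lte_fin subr0.
have E : Linfty_norm tau u = ess_sup_inf.ess_sup m (abse \o (fun t => (norm2 (u t))%:E)).
  by rewrite /Linfty_norm unlock /= mT.
have fin : Linfty_norm tau u \is a fin_num.
  by rewrite ge0_fin_numE// Lnorm_ge0.
have := ess_sup_inf.ess_sup_ge m (abse \o (fun t => (norm2 (u t))%:E)).
rewrite -E => -[N [mN N0 hN]].
exists (N `&` `[0, tau]%classic); split => //; first exact: measurableI.
move=> s /= [hs us]; split => //; apply: hN => /= h; apply: us.
by rewrite -lee_fin fineK// (le_trans _ h)// ger0_norm// norm2_ge0.
Qed.

(** With such a representative, every later estimate holds pointwise on [[0, tau]]
    instead of almost everywhere. *)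
Lemma Linfty_bounded_rep (R : realType) (tau : R) n (u : R -> 'cV[R]_n) :
  0 < tau -> Linfty tau u ->
  exists u' : R -> 'cV[R]_n, [/\ bmeas tau u',
    forall s, norm2 (u' s) <= fine (Linfty_norm tau u) &
    (@lebesgue_measure R).-negligible [set s | `[0, tau]%classic s /\ u s <> u' s]].
Proof.
move=> tau0 Lu; have hN := Linfty_norm_ae tau0 Lu; have [mu _] := Lu.
set U := fine _ in hN *.
have U0 : 0 <= U by rewrite fine_ge0// Lnorm_ge0.
pose E := `[0, tau]%classic `&` [set s | norm2 (u s) <= U].
have mE : measurable E.
  have h := measurable_fun_ler (measurable_norm2 mu) (measurable_cst U).
  have := h (measurable_itv _) [set true] (I : measurable [set true]).
  by rewrite (_ : _ @^-1` _ = [set s | norm2 (u s) <= U]).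
have hu' s : norm2 (\1_E s *: u s) <= U.
  rewrite norm2Z indicE; have [|_] := boolP (s \in E).
    by rewrite inE => -[_ /=]; rewrite normr1 mul1r.
  by rewrite normr0 mul0r.
exists (fun s => \1_E s *: u s); split => //.
- split; last by exists U.
  move=> i; rewrite (_ : (fun s => _) = (fun s => \1_E s * u s i 0)); last first.
    by apply/funext => s; rewrite mxE.
  by apply: measurable_funM => //; exact: measurable_indic.
- apply: negligibleS hN => s /= [hs us]; split => // un; apply: us.
  by rewrite indicE mem_set ?scale1r.
Qed.

(** * The operator P and its derivative *)

Lemma subr_cancel (V : zmodType) (a b c x y : V) :
  a - x - (b - y) - (c - (x - y)) = a - b - c.
Proof.
have -> : a - x - (b - y) = a - b - (x - y).
  by rewrite !opprB [y - b]addrC addrACA [- x + y]addrC.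
by move: (x - y) => q; rewrite opprB addrA subrK.
Qed.

Lemma subrBB (V : zmodType) (a b c : V) : a - c - (b - c) = a - b.
Proof. by rewrite opprB addrA subrK. Qed.

Section PeriodicOperator.
Variables (R : realType) (n : nat) (tau : R) (D : set 'cV[R]_n) (A : 'M[R]_n).
Variables (g : 'cV[R]_n -> 'cV[R]_n) (L M omega Hbar : R).
Hypotheses (tau0 : 0 < tau) (oD : open D) (D0 : D 0) (g2 : Ckv D 2 g).
Hypotheses (M1 : 1 <= M) (omega0 : 0 < omega).
Hypothesis hexp : forall t : R, - tau <= t <= tau ->
  opnorm2 (expmx (t *: A)) <= M * expR (omega * `|t|).
Hypothesis hL : forall xi, D xi -> opnorm2 (jacobian_mx g xi) <= L.
Hypotheses (Hbar0 : 0 <= Hbar).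
Hypothesis hH : forall (k : 'I_n) xi, D xi ->
  opnorm2 (hessian_mx (coordf g k) xi) <= Hbar.
Implicit Types (x y z v w : CX tau n).

(** Elements of [CX tau n] vanish outside [[0, tau]] and [0] lies in [D]: for [x] in
    [X_D], the composition [g \o x] can be studied on the whole line. *)
Lemma X_in_all x t : X_in D x -> D (x t).
Proof.
move=> Dx; have [ht|ht] := pselect (`[0, tau]%classic t); first exact: Dx.
by rewrite X_out.
Qed.

Lemma comp_continuous (f : 'cV[R]_n -> R) x : X_in D x ->
  (forall xi, D xi -> {for xi, continuous f}) ->
  {within `[0, tau], continuous (fun s => f (x s))}.
Proof.
move=> Dx cf t; apply: (@continuous_comp _ _ _ (x : subspace `[0, tau] -> _) f).
  exact: X_cont.
exact: cf (X_in_all t Dx).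
Qed.

Lemma coord_X_continuous x i : {within `[0, tau], continuous (fun s => x s i 0)}.
Proof.
move=> t; apply: (@continuous_comp _ _ _ (x : subspace `[0, tau] -> _)
  (fun v : 'cV[R]_n => v i 0)); first exact: X_cont.
exact: coord_continuous.
Qed.

Lemma bmeas_X x : bmeas tau x.
Proof. by apply: bmeas_cont => i; exact: coord_X_continuous. Qed.

Lemma bmeas_g x : X_in D x -> bmeas tau (fun s => g (x s)).
Proof.
move=> Dx; apply: bmeas_cont => i.
by apply: (@comp_continuous (coordf g i)) => // xi Dxi; exact: (g2 i).1.
Qed.

Lemma bmeas_jac x (f : R -> 'cV[R]_n) : X_in D x -> bmeas tau f ->
  bmeas tau (fun s => jacobian_mx g (x s) *m f s).
Proof.
move=> Dx; apply: (@bmeas_mulmx _ _ _ _ _ L) => [i j|s hs]; last exact/hL/Dx.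
apply: within_continuous_measurable.
rewrite (_ : (fun s => _) = (fun s => partial j (coordf g i) (x s))); last first.
  by apply/funext => s; rewrite mxE.
by apply: comp_continuous => // xi Dxi; exact: ((g2 i).2 j).2.1.
Qed.

Lemma kappa_ge0 : 0 <= kappa tau A M omega.
Proof.
have M0 : 0 <= M by exact: le_trans M1.
have e0 : 0 <= expR (omega * tau) - 1.
  by rewrite subr_ge0 -expR0 ler_expR mulr_ge0// ltW.
have R0 : 0 <= Rtau tau A by exact: opnorm2_ge0.
apply: divr_ge0; last exact: ltW.
by rewrite mulr_ge0 ?addr_ge0 ?mulr_ge0 ?expR_ge0.
Qed.

Lemma norm_KX_le (f : R -> 'cV[R]_n) (b : R) : bmeas tau f ->
  (forall s, `[0, tau]%classic s -> norm2 (f s) <= b) ->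
  `|KX tau A f| <= kappa tau A M omega * b.
Proof.
move=> bf hf.
have b0 : 0 <= b.
  by apply: le_trans (norm2_ge0 _) (hf 0 _); rewrite /= in_itv/= lexx ltW.
apply: Xnorm_le => [|t /[dup] ht]; first by rewrite mulr_ge0// kappa_ge0.
rewrite /= in_itv/= => tt; rewrite KXE ?(ltW tau0)//.
by apply: norm2_Kop_le => // s hs; apply: hf; rewrite /= in_itv.
Qed.

Section Jac.
Variable x : CX tau n.
Hypothesis Dx : X_in D x.

Definition dKX v : CX tau n := KX tau A (fun s => jacobian_mx g (x s) *m v s).

Lemma dKX_linear : linear dKX.
Proof.
move=> l v w.
have E := KX_linear A l (ltW tau0) (bmeas_jac Dx (bmeas_X v))
  (bmeas_jac Dx (bmeas_X w)).
rewrite /dKX -E.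
have -> : (fun s => jacobian_mx g (x s) *m (l *: v + w) s) =
    (fun s => l *: (jacobian_mx g (x s) *m v s) + jacobian_mx g (x s) *m w s).
  apply/funext => s.
  have -> : (l *: v + w) s = l *: v s + w s by [].
  by rewrite mulmxDr scalemxAr.
by [].
Qed.

Lemma dPop_linear : linear (fun v => dKX v - v).
Proof.
move=> l v w; rewrite dKX_linear scalerBr opprD !addrA; congr (_ - _).
by rewrite addrAC.
Qed.

Lemma dKX_bounded v : `|dKX v| <= kappa tau A M omega * L * `|v|.
Proof.
rewrite -mulrA; apply: norm_KX_le; first exact: bmeas_jac (bmeas_X v).
move=> s hs; rewrite (le_trans (norm2_mulmx _ _))// ler_pM ?opnorm2_ge0 ?norm2_ge0//.
  exact/hL/Dx.
exact: norm2_le_Xnorm.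
Qed.

End Jac.

Lemma KXB (f h : R -> 'cV[R]_n) : bmeas tau f -> bmeas tau h ->
  KX tau A (fun s => f s - h s) = KX tau A f - KX tau A h.
Proof.
move=> bf bh; have E := KX_linear A (-1) (ltW tau0) bh bf.
have -> : (fun s => f s - h s) = (fun s => -1 *: h s + f s).
  by apply/funext => s; rewrite scaleN1r addrC.
by rewrite E scaleN1r addrC.
Qed.

Section OnBall.
Variables (x0 : CX tau n) (r : R) (u : R -> 'cV[R]_n) (P : CX tau n -> CX tau n).
Hypotheses (r0 : 0 < r) (bu : bmeas tau u).
Hypothesis Br : forall x, `|x - x0| <= r -> X_in D x.
Hypothesis hP : forall x, X_in D x -> P x = KX tau A (fun s => g (x s) + u s) - x.

Let C t := [set xi : 'cV[R]_n | norm2 (xi - x0 t) <= r].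

(** The pointwise estimates need the Euclidean balls of radius [r] around [x0 t] to
    lie in [D]; a point of such a ball is reached by adding a constant to [x0]. *)
Lemma const_X (d : 'cV[R]_n) :
  exists c : CX tau n, forall s, `[0, tau]%classic s -> c s = d.
Proof.
have h : patch (fun=> 0) `[0, tau] (cst d) \in contI tau n.
  apply/asboolP; split.
    apply: (@subspace_eq_continuous _ _ _ (cst d)) => [s hs|].
      by rewrite /= /from_subspace/= patchT.
    by move=> s; exact: cst_continuous.
  by move=> s hs; rewrite /patch memNset.
by exists (MkX h) => s hs /=; rewrite /patch mem_set.
Qed.

Lemma tube_sub t : `[0, tau]%classic t -> C t `<=` D.
Proof.
move=> ht xi hxi; have [c hc] := const_X (xi - x0 t).
have -> : xi = (x0 + c) t by rewrite XaddE hc// addrC subrK.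
apply: Br => //; rewrite addrAC subrr add0r.
by apply: Xnorm_le => [|s hs]; [exact: ltW|rewrite hc].
Qed.

Lemma tube_convex t (a b : 'cV[R]_n) (s : R) : C t a -> C t b -> 0 <= s <= 1 ->
  C t (a + s *: (b - a)).
Proof.
rewrite /C /= => ha hb /andP[s0 s1].
have -> : a + s *: (b - a) - x0 t = (1 - s) *: (a - x0 t) + s *: (b - x0 t).
  by apply/colP => i; rewrite !mxE; ring.
have -> : r = (1 - s) * r + s * r by ring.
rewrite (le_trans (norm2D _ _))// !norm2Z !ger0_norm ?subr_ge0//.
by rewrite lerD// ler_wpM2l// subr_ge0.
Qed.

Lemma in_tube x t : `|x - x0| <= r -> C t (x t).
Proof. exact: le_trans (norm2_le_Xnorm (x - x0) t). Qed.

Lemma rho2E : rho2 tau A M omega Hbar = kappa tau A M omega * (Num.sqrt n%:R * Hbar).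
Proof. by rewrite /rho2 /kappa; ring. Qed.

(** Subtracting [P y] and the derivative removes [u] and the identity: what is left
    is [KX] applied to a Taylor remainder of [g]. *)
Lemma Pop_taylor x y z : `|x - x0| <= r -> `|y - x0| <= r -> `|z - x0| <= r ->
  `|P x - P y - (dKX z (x - y) - (x - y))| <=
  rho2 tau A M omega Hbar / 2 * (`|x - z| + `|y - z|) * `|x - y|.
Proof.
move=> xr yr zr; have [Dx Dy Dz] := And3 (Br xr) (Br yr) (Br zr).
have bx := bmeasD (bmeas_g Dx) bu; have by_ := bmeasD (bmeas_g Dy) bu.
have bz := bmeas_jac Dz (bmeas_X (x - y)).
have bxy := bmeasB bx by_.
have E : P x - P y - (dKX z (x - y) - (x - y)) =
    KX tau A (fun s => g (x s) + u s - (g (y s) + u s) -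
                       jacobian_mx g (z s) *m (x - y) s).
  rewrite KXB// KXB// !hP// /dKX.
  exact: subr_cancel.
rewrite E rho2E.
rewrite -[X in _ <= X * _ * _]mulrA -[X in _ <= X * _]mulrA -[X in _ <= X]mulrA.
apply: norm_KX_le => [|s hs]; first exact: bmeasB.
have -> : g (x s) + u s - (g (y s) + u s) - jacobian_mx g (z s) *m (x - y) s =
    g (x s) - g (y s) - jacobian_mx g (z s) *m (x s - y s).
  by rewrite opprD addrACA subrr addr0.
have := @jacobian_taylor _ _ D (C s) g Hbar oD g2 hH (tube_sub hs) (@tube_convex s)
  (x s) (y s) (z s) (in_tube s xr) (in_tube s yr) (in_tube s zr).
move=> /le_trans; apply; rewrite -!mulrA ler_wpM2l// ler_wpM2l// ler_wpM2l//.
rewrite ler_pM ?addr_ge0 ?norm2_ge0//; last exact: (norm2_le_Xnorm (x - y) s).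
by rewrite lerD//; [exact: (norm2_le_Xnorm (x - z) s)|exact: (norm2_le_Xnorm (y - z) s)].
Qed.

Lemma dKX_lipschitz x y v : `|x - x0| <= r -> `|y - x0| <= r ->
  `|dKX x v - dKX y v| <= rho2 tau A M omega Hbar * `|x - y| * `|v|.
Proof.
move=> xr yr; have [Dx Dy] := conj (Br xr) (Br yr).
have bx := bmeas_jac Dx (bmeas_X v); have by_ := bmeas_jac Dy (bmeas_X v).
rewrite /dKX -KXB// rho2E.
rewrite -[X in _ <= X * _]mulrA -[X in _ <= X]mulrA.
apply: norm_KX_le => [|s hs]; first exact: bmeasB.
have := @jacobian_lipschitz _ _ D (C s) g Hbar oD g2 hH (tube_sub hs) (@tube_convex s)
  (x s) (y s) (v s) (in_tube s xr) (in_tube s yr).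
move=> /le_trans; apply; rewrite -!mulrA ler_wpM2l// ler_wpM2l//.
by rewrite ler_pM ?norm2_ge0//; [exact: (norm2_le_Xnorm (x - y) s)|exact: norm2_le_Xnorm].
Qed.

Lemma Pop_diff x : `|x - x0| < r ->
  differentiable P x /\ 'd P x = (fun v => dKX x v - v) :> (CX tau n -> CX tau n).
Proof.
move=> xr; have Dx := Br (ltW xr).
pose T : {linear CX tau n -> CX tau n} := HB.pack (fun v => dKX x v - v)
  (GRing.isLinear.Build _ _ _ _ (fun v => dKX x v - v) (dPop_linear Dx)).
apply: (@diff_of_quadratic _ _ _ P T x (kappa tau A M omega * L + 1)
  (rho2 tau A M omega Hbar / 2) (r - `|x - x0|)) => [v||v hv].
- by rewrite (le_trans (ler_normB _ _))// mulrDl mul1r lerD2r dKX_bounded.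
- by rewrite subr_gt0.
- have xvr : `|x + v - x0| <= r.
    rewrite addrAC (le_trans (ler_normD _ _))//.
    by rewrite -lerBrDl.
  have := Pop_taylor xvr (ltW xr) (ltW xr).
  by rewrite subrr normr0 addr0 [x + v - x]addrAC subrr add0r -mulrA -expr2.
Qed.

Lemma Pop_C11 : C11_on_ball P x0 r (rho2 tau A M omega Hbar).
Proof.
split=> [x xr|x y v xr yr|x y z xr yr zr].
- exact: (Pop_diff xr).1.
- have [_ ex] := Pop_diff xr; have [_ ey] := Pop_diff yr.
  have -> : 'd P x v - 'd P y v = dKX x v - dKX y v.
    have -> : 'd P x v = dKX x v - v by rewrite ex.
    have -> : 'd P y v = dKX y v - v by rewrite ey.
    exact: subrBB.
  exact: dKX_lipschitz (ltW xr) (ltW yr).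
- by have [_ ->] := Pop_diff zr; exact: Pop_taylor xr yr (ltW zr).
Qed.

End OnBall.

End PeriodicOperator.

(** * Invertibility of the derivative *)

Lemma subr_swap (V : zmodType) (a b c : V) : a - b = c -> a - c = b.
Proof. by move=> <-; rewrite opprB addrC subrK. Qed.

Section Invertibility.
Variables (R : realType) (n : nat) (tau : R) (D : set 'cV[R]_n) (A : 'M[R]_n).
Variables (g : 'cV[R]_n -> 'cV[R]_n) (L M omega : R).
Hypotheses (tau0 : 0 < tau) (D0 : D 0) (g2 : Ckv D 2 g).
Hypotheses (L0 : 0 <= L) (M1 : 1 <= M) (omega0 : 0 < omega).
Hypothesis hexp : forall t : R, - tau <= t <= tau ->
  opnorm2 (expmx (t *: A)) <= M * expR (omega * `|t|).
Hypothesis hL : forall xi, D xi -> opnorm2 (jacobian_mx g xi) <= L.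
Variable x : CX tau n.
Hypothesis Dx : X_in D x.
Implicit Types (v w a b : CX tau n).

Let S1 := sconst1 tau A M omega L.
Hypothesis S1lt : S1 < 1.
Let K := opnorm2 A + L.
Let T := dKX A g x.
Let theta := 1 - (1 - S1) * expR (- (L * tau)).

Let itvP t : `[0, tau]%classic t <-> 0 <= t <= tau.
Proof. by rewrite /= in_itv. Qed.

Lemma dKX_sub a b : T (a - b) = T a - T b.
Proof.
have h := dKX_linear A tau0 D0 g2 hL Dx (-1) b a.
by rewrite scaleN1r [- b + a]addrC scaleN1r [- _ + dKX _ _ _ _]addrC in h.
Qed.

Lemma jac_le v s (m : R) : `[0, tau]%classic s -> norm2 (v s) <= m ->
  norm2 (jacobian_mx g (x s) *m v s) <= L * m.
Proof.
move=> hs hv; rewrite (le_trans (norm2_mulmx _ _))//.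
by rewrite ler_pM ?opnorm2_ge0 ?norm2_ge0//; exact/hL/Dx.
Qed.

Lemma dKX_weighted v (m : R) : 0 <= m ->
  (forall s, `[0, tau]%classic s -> norm2 (v s) <= m * expR (K * s)) ->
  forall t, `[0, tau]%classic t -> norm2 (T v t) <= theta * m * expR (K * t).
Proof.
move=> m0 hv t ht; have bv := bmeas_jac D0 g2 hL Dx (bmeas_X v).
rewrite /T /dKX (KXE _ (ltW tau0) bv ht).
move/itvP in ht.
apply: (norm2_Kop_weighted tau0 omega0 hexp L0 ht bv m0 (ltW S1lt)).
by move=> s /itvP hs; apply: jac_le => //; exact: hv.
Qed.

Let S1_ge0 : 0 <= S1 := sconst1_ge0 A tau0 M1 omega0 L0.

Let theta_ge0 : 0 <= theta.
Proof.
rewrite subr_ge0 mulr_ile1 ?expR_ge0 ?subr_ge0 ?(ltW S1lt)//.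
  by rewrite gerBl.
by rewrite -expR0 ler_expR oppr_le0 mulr_ge0 ?(ltW tau0).
Qed.

Let theta_lt1 : theta < 1.
Proof. by rewrite gtrBl mulr_gt0 ?subr_gt0 ?expR_gt0. Qed.

Let Phi w v := T v - w.

Lemma iter_Phi_weighted w k a b t : `[0, tau]%classic t ->
  norm2 (iter k (Phi w) a t - iter k (Phi w) b t) <=
    theta ^+ k * `|a - b| * expR (K * t).
Proof.
elim: k t => [|k IH] t ht.
  rewrite expr0 mul1r; apply: (le_trans (norm2_le_Xnorm (a - b) t)).
  rewrite ler_peMr ?Xnorm_ge0// -[leLHS]expR0 ler_expR.
  by move/itvP : ht => /andP[t0 _]; rewrite mulr_ge0 ?addr_ge0 ?opnorm2_ge0.
have -> : iter k.+1 (Phi w) a t - iter k.+1 (Phi w) b t =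
    T (iter k (Phi w) a - iter k (Phi w) b) t.
  by rewrite dKX_sub; exact: subrBB.
rewrite exprS -[theta * _ * _]mulrA; apply: dKX_weighted => //.
by rewrite mulr_ge0 ?exprn_ge0.
Qed.

Lemma iter_Phi_le w k a b :
  `|iter k (Phi w) a - iter k (Phi w) b| <= expR (K * tau) * theta ^+ k * `|a - b|.
Proof.
apply: Xnorm_le => [|t ht].
  by rewrite !mulr_ge0 ?exprn_ge0 ?expR_ge0.
apply: (le_trans (iter_Phi_weighted w k a b ht)).
rewrite mulrC -mulrA ler_wpM2r ?mulr_ge0 ?exprn_ge0// ler_expR.
by move/itvP : ht => /andP[_ tt]; rewrite ler_wpM2l ?addr_ge0 ?opnorm2_ge0.
Qed.

Let s0 := M * L * Rtau tau A * (expR (omega * tau) - 1) / omega.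
Let c := (s0 + L * tau * S1) / (1 - S1).

Let s0_ge0 : 0 <= s0 := fundamental_gain_ge0 A tau0 M1 omega0 L0.

Let c_ge0 : 0 <= c.
Proof.
apply: divr_ge0; last by rewrite subr_ge0 ltW.
apply: addr_ge0 => //; apply: mulr_ge0 => //; apply: mulr_ge0 => //.
exact: ltW.
Qed.

Let c_super : s0 + (c + L * tau) * S1 <= c.
Proof.
have d0 : 1 - S1 != 0 by rewrite subr_eq0 gt_eqF.
have e : c * (1 - S1) = s0 + L * tau * S1 by rewrite /c divfK.
by rewrite mulrDl addrCA -e mulrBr mulr1 addrC subrK.
Qed.

Lemma iter_Phi_bound w k t : `[0, tau]%classic t ->
  norm2 (iter k (Phi w) 0 t) <= `|w| * (1 + (c + L * t) * expR (K * t)).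
Proof.
elim: k t => [|k IH] t ht; have := ht; move=> /itvP/andP[t0 tt].
  rewrite /= norm20 mulr_ge0// addr_ge0// mulr_ge0 ?expR_ge0// addr_ge0//.
  exact: mulr_ge0.
rewrite iterS; set v := iter k _ _ in IH *.
have bv := bmeas_jac D0 g2 hL Dx (bmeas_X v).
have -> : Phi w v t = T v t - w t by [].
rewrite (le_trans (norm2B _ _))// mulrDr mulr1 addrC lerD ?norm2_le_Xnorm//.
rewrite /T /dKX (KXE _ (ltW tau0) bv ht).
apply: (norm2_Kop_supersolution tau0 omega0 hexp L0 _ bv _ c_ge0 c_super).
- exact/itvP.
- exact: normr_ge0.
by move=> s /itvP hs; apply: jac_le => //; exact: IH.
Qed.

Let Cst := 1 + (c + L * tau) * expR (K * tau).

(** [T v - v = w] is solved by iterating [v |-> T v - w] from 0. The weighted estimate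
    gives convergence, and with it uniqueness; the supersolution bounds all the
    iterates, hence the solution. *)
Theorem dKX_sub_id_invertible :
  bijective (fun v => T v - v) /\ forall v, `|v| <= Cst * `|T v - v|.
Proof.
have sol w : exists2 v, Phi w v = v & `|v| <= Cst * `|w|.
  have [v hv cv] := iterates_cvg_fixpoint theta_ge0 theta_lt1 (iter_Phi_le w) 0.
  exists v => //; rewrite -[v]subr0; apply: (norm_cvg_le cv) => k.
  rewrite subr0; apply: Xnorm_le => [|t ht].
    rewrite mulr_ge0// addr_ge0// mulr_ge0 ?expR_ge0// addr_ge0// mulr_ge0//.
    exact: ltW.
  rewrite (le_trans (iter_Phi_bound w k ht))// mulrC ler_wpM2r// lerD2l.
  have /andP[t0 tt] := (itvP t).1 ht.
  apply: ler_pM.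
  - by apply: addr_ge0 => //; exact: mulr_ge0.
  - exact: expR_ge0.
  - by rewrite lerD2l ler_wpM2l.
  - by rewrite ler_expR ler_wpM2l ?addr_ge0 ?opnorm2_ge0.
have uni w := fixpoint_unique theta_ge0 theta_lt1 (iter_Phi_le w).
have fixP w v : T v - v = w -> Phi w v = v by exact: subr_swap.
split=> [|v].
  apply: inj_surj_bijective => [a b ab|w].
    by apply: (uni (T a - a)); apply: fixP.
  have [v hv _] := sol w; exists v.
  exact: subr_swap hv.
have [v' hv' bv'] := sol (T v - v).
have E : v = v' := uni _ _ _ (fixP _ _ erefl) hv'.
by rewrite {1}E.
Qed.

End Invertibility.

(** * The constant rho1 *)

(** Computed integrals in [\int_0^t e^((K+w)s) ds <= e^(Kt) \int_0^t e^(ws) ds]. *)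
Lemma expR_quotient_le (R : realType) (K w t : R) : 0 <= K -> 0 < w -> 0 <= t ->
  (expR ((K + w) * t) - 1) / (K + w) <= expR (K * t) * ((expR (w * t) - 1) / w).
Proof.
move=> K0 w0 t0; have Kw : 0 < K + w by lra.
rewrite mulrA ler_pdivrMr// mulrAC ler_pdivlMr// [(K + w) * t]mulrDl expRD.
have h1 := expR_ge1Dx (- (K * t)); rewrite expRN in h1.
have h2 := expR_ge1Dx (w * t).
have E0 := expR_gt0 (K * t).
move: (expR (K * t)) (expR (w * t)) E0 h1 h2 => E W E0 h1 h2.
have h3 : E - 1 <= E * (K * t).
  have : E * (1 - K * t) <= E * E^-1 by rewrite ler_wpM2l// ltW.
  by rewrite divff ?gt_eqF//; lra.
have h4 : E * (K * (w * t)) <= E * (K * (W - 1)).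
  by rewrite ler_wpM2l ?(ltW E0)// ler_wpM2l//; lra.
have h5 : w * (E - 1) <= w * (E * (K * t)) by rewrite ler_wpM2l// ltW.
lra.
Qed.

(** The left side is the value at [t] of the supersolution; [L t e^(K t)] is below
    the second coefficient of [rho1] because [K t <= e^(K t) - 1]. *)
Lemma rho1_majorant (R : realType) (K L t q s0 S1 S : R) :
  0 <= L -> L <= K -> 0 <= t -> 1 <= q -> 0 <= s0 -> 0 <= S1 -> S1 <= S -> S < 1 ->
  S1 <= s0 * (q * expR (K * t)) ->
  forall phi al, phi = q * expR (K * t) -> al = s0 * phi / (1 - S) ->
  1 + ((s0 + L * t * S1) / (1 - S1) + L * t) * expR (K * t) <=
  1 + al + L * phi * (phi - q) / K * (1 + al).
Proof.
move=> L0 LK t0 q1 s00 S10 S1S Slt S1s phi al phiE alE.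
have E0 := expR_gt0 (K * t).
have K0 : 0 <= K := le_trans L0 LK.
have E1 : 1 <= expR (K * t) by rewrite -[leLHS]expR0 ler_expR mulr_ge0.
have h1 := expR_ge1Dx (K * t).
have hE : expR (K * t) <= phi by rewrite phiE ler_peMl// ltW.
have be : L * t * expR (K * t) <= L * phi * (phi - q) / K.
  have [K_eq0|Kn0] := eqVneq K 0.
    have -> : L = 0 by lra.
    by rewrite !mul0r.
  have Kp : 0 < K by rewrite lt_def Kn0.
  have hq : K * t <= phi - q.
    have -> : phi - q = q * (expR (K * t) - 1) by rewrite phiE; ring.
    have E1' : 0 <= expR (K * t) - 1 by lra.
    by have := ler_peMl E1' q1; lra.
  have := ler_wpM2l L0 (ler_pM (ltW E0) (mulr_ge0 K0 t0) hE hq).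
  by rewrite ler_pdivlMr//; lra.
have dS : 0 < 1 - S by lra.
have dS1 : 0 < 1 - S1 by lra.
have inv : (1 - S1)^-1 <= (1 - S)^-1 by rewrite lef_pV2 ?posrE//; lra.
have al1 : s0 * expR (K * t) / (1 - S1) <= al.
  by rewrite alE ler_pM ?invr_ge0 ?mulr_ge0 ?(ltW E0) ?(ltW dS1)// ler_wpM2l.
rewrite -phiE in S1s.
have al2 : S1 / (1 - S1) <= al by rewrite alE ler_pM ?invr_ge0 ?(ltW dS1).
have be0 : 0 <= L * t * expR (K * t) by rewrite !mulr_ge0 ?(ltW E0).
have := ler_pM be0 (divr_ge0 S10 (ltW dS1)) be al2.
have -> : ((s0 + L * t * S1) / (1 - S1) + L * t) * expR (K * t) =
  s0 * expR (K * t) / (1 - S1) + L * t * expR (K * t) * (S1 / (1 - S1)) +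
  L * t * expR (K * t) by ring.
move: be al1; lra.
Qed.

Section Assembly.
Variables (R : realType) (n : nat) (tau : R) (D : set 'cV[R]_n) (A : 'M[R]_n).
Variables (g : 'cV[R]_n -> 'cV[R]_n) (L M omega Hbar : R).
Hypotheses (tau0 : 0 < tau) (oD : open D) (D0 : D 0) (g2 : Ckv D 2 g).
Hypotheses (L0 : 0 <= L) (M1 : 1 <= M) (omega0 : 0 < omega) (n0 : (0 < n)%N).
Hypothesis hexp : forall t : R, - tau <= t <= tau ->
  opnorm2 (expmx (t *: A)) <= M * expR (omega * `|t|).
Hypothesis hL : forall xi, D xi -> opnorm2 (jacobian_mx g xi) <= L.
Hypothesis S_lt1 : Sconst tau A L M omega < 1.

Lemma sqrtn_ge1 : 1 <= Num.sqrt n%:R :> R.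
Proof. by rewrite -[leLHS]sqrtr1 ler_sqrt// ler1n. Qed.

Lemma sconst1_le : sconst1 tau A M omega L <= Sconst tau A L M omega.
Proof.
rewrite /sconst1 /Sconst.
have R0 : 0 <= Rtau tau A by exact: opnorm2_ge0.
have a0 : 0 <= opnorm2 A by exact: opnorm2_ge0.
have M0 : 0 <= M by exact: le_trans M1.
have e0 : 0 <= expR ((opnorm2 A + L + omega) * tau) - 1.
  by rewrite subr_ge0 -[leLHS]expR0 ler_expR mulr_ge0 ?addr_ge0 ?(ltW tau0) ?(ltW omega0).
rewrite ler_wpM2r ?invr_ge0 ?addr_ge0 ?(ltW omega0)// ler_wpM2r//.
by rewrite ler_wpM2r// ler_wpM2r// ler_peMl// sqrtn_ge1.
Qed.

Lemma sconst1_lt1 : sconst1 tau A M omega L < 1.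
Proof. exact: le_lt_trans sconst1_le S_lt1. Qed.

Let c : R :=
  (M * L * Rtau tau A * (expR (omega * tau) - 1) / omega +
   L * tau * sconst1 tau A M omega L) / (1 - sconst1 tau A M omega L).

Lemma rho1_ge :
  1 + (c + L * tau) * expR ((opnorm2 A + L) * tau) <= rho1 tau A L M omega.
Proof.
have R0 : 0 <= Rtau tau A by exact: opnorm2_ge0.
have a0 : 0 <= opnorm2 A by exact: opnorm2_ge0.
have M0 : 0 <= M by exact: le_trans M1.
have S10 := sconst1_ge0 A tau0 M1 omega0 L0.
pose s0 := M * L * Rtau tau A * (expR (omega * tau) - 1) / omega.
have s00 : 0 <= s0 := fundamental_gain_ge0 A tau0 M1 omega0 L0.
have S1s : sconst1 tau A M omega L <=
    s0 * (Num.sqrt n%:R * expR ((opnorm2 A + L) * tau)).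
  apply: (@le_trans _ _ (s0 * expR ((opnorm2 A + L) * tau))).
    have h := expR_quotient_le (addr_ge0 a0 L0) omega0 (ltW tau0).
    have ML0 : 0 <= M * L * Rtau tau A by rewrite !mulr_ge0.
    have h1 := ler_wpM2l ML0 h.
    rewrite /sconst1 -[leLHS]mulrA (le_trans h1)// le_eqVlt; apply/orP; left; apply/eqP.
    by rewrite /s0; ring.
  by rewrite ler_wpM2l// ler_peMl ?expR_ge0 ?sqrtn_ge1.
have LK : L <= opnorm2 A + L by rewrite lerDr.
pose al := s0 * phi A L tau / (1 - Sconst tau A L M omega).
have alE : al = L * M * Rtau tau A * (expR (omega * tau) - 1) * phi A L tau /
    ((1 - Sconst tau A L M omega) * omega).
  have dS : 1 - Sconst tau A L M omega != 0 by rewrite subr_eq0 gt_eqF.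
  have w0 : omega != 0 by rewrite gt_eqF.
  by rewrite /al /s0; field; rewrite dS w0.
rewrite /rho1 -alE.
exact: (rho1_majorant L0 LK (ltW tau0) sqrtn_ge1 s00 S10 sconst1_le S_lt1 S1s erefl erefl).
Qed.

Lemma rho1_gt0 : 0 < rho1 tau A L M omega.
Proof.
apply: lt_le_trans rho1_ge.
have S10 := sconst1_ge0 A tau0 M1 omega0 L0.
have t0 := ltW tau0.
have c0 : 0 <= c.
  apply: divr_ge0; last by rewrite subr_ge0 ltW// sconst1_lt1.
  apply: addr_ge0; last by apply: mulr_ge0 => //; exact: mulr_ge0.
  exact: fundamental_gain_ge0.
apply: ltr_pwDl => //; apply: mulr_ge0; last exact: expR_ge0.
by apply: addr_ge0 => //; exact: mulr_ge0.
Qed.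

Lemma dPop_bound (x : CX tau n) : X_in D x ->
  bijective (fun v => dKX A g x v - v) /\
  forall v, `|v| <= rho1 tau A L M omega * `|dKX A g x v - v|.
Proof.
move=> Dx; have [bij bnd] := dKX_sub_id_invertible tau0 D0 g2 L0 M1 omega0 hexp hL Dx sconst1_lt1.
split=> // v; apply: (le_trans (bnd v)); rewrite ler_wpM2r//.
exact: rho1_ge.
Qed.

End Assembly.

(** * Conclusion *)

(** Membership of [x] in [X_D] makes the integrands measurable, so that changing them
    on a null set does not change the integrals. *)
Lemma Pop_rep (R : realType) (n : nat) (tau : R) (D : set 'cV[R]_n)
    (A : 'M[R]_n) (g : 'cV[R]_n -> 'cV[R]_n) (u u' : R -> 'cV[R]_n) :
  D 0 -> Ckv D 2 g -> Linfty tau u -> bmeas tau u' ->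
  (@lebesgue_measure R).-negligible [set s | `[0, tau]%classic s /\ u s <> u' s] ->
  forall x : CX tau n, X_in D x ->
  Pop A g u x = KX tau A (fun s => g (x s) + u' s) - x.
Proof.
move=> D0 g2 [mu _] [mu' _] uu' x Dx; have [mg _] := bmeas_g D0 g2 Dx.
have -> : Pop A g u x = KX tau A (fun s => g (x s) + u s) - x by [].
suff -> : KX tau A (fun s => g (x s) + u s) = KX tau A (fun s => g (x s) + u' s) by [].
have mD (w : R -> 'cV[R]_n) : (forall i, measurable_fun `[0, tau] (fun s => w s i 0)) ->
    forall i, measurable_fun `[0, tau] (fun s => (g (x s) + w s) i 0).
  move=> mw i; rewrite (_ : (fun s => _) = (fun s => g (x s) i 0 + w s i 0)).
    exact: measurable_funD.
  by apply/funext => s; rewrite mxE.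
apply: eq_KX => t; rewrite /= in_itv/= => /andP[_ tt].
apply: Kop_ae_eq => //; [exact: mD|exact: mD|].
apply: negligibleS uu' => s /= [hs h]; split => // E.
by apply: h; rewrite E.
Qed.

Lemma Pop_residual_le (R : realType) (n : nat) (tau : R) (D : set 'cV[R]_n)
    (A : 'M[R]_n) (g : 'cV[R]_n -> 'cV[R]_n) (M omega : R) (u u' : R -> 'cV[R]_n)
    (x : CX tau n) :
  0 < tau -> D 0 -> Ckv D 2 g -> 1 <= M -> 0 < omega ->
  (forall t : R, - tau <= t <= tau ->
     opnorm2 (expmx (t *: A)) <= M * expR (omega * `|t|)) ->
  bmeas tau u' -> (forall s, norm2 (u' s) <= fine (Linfty_norm tau u)) ->
  X_in D x ->
  `|KX tau A (fun s => g (x s) + u' s) - x| <= rho0 A g M omega x u.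
Proof.
move=> tau0 D0 g2 M1 w0 hexp bu' hu' Dx.
have bg := bmeas_g D0 g2 Dx.
rewrite (le_trans (ler_normB _ _))// addrC /rho0 lerD2l.
rewrite -/(kappa tau A M omega).
apply: (norm_KX_le tau0 M1 w0 hexp (bmeasD bg bu')) => s hs.
rewrite addrC (le_trans (norm2D _ _))// lerD//.
apply: ub_le_sup; last by exists s.
by have [_ [C hC]] := bg; exists C => _ [t ht <-]; exact: hC.
Qed.

Lemma exprz_1B (R : realType) (k : nat) : 2 ^ (1 - k%:Z) = 2 * 2^-1 ^+ k :> R.
Proof. by rewrite expfzDr ?pnatr_eq0// expr1z -exprnN exprVn. Qed.


(** The statements on both schemes for an abstract operator: [a0] bounds the
    residual at the centre, [a1] the inverse of the derivative there, and [a2] is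
    the Lipschitz constant of the derivative. *)
Theorem newton_kantorovich_summary (R : realType) (V : completeNormedModType R)
    (Q : V -> V) (x0 : V) (r a0 a1 a2 : R) :
  0 < a0 -> 0 < a1 -> 0 < a2 -> C11_on_ball Q x0 r a2 ->
  bijective ('d Q x0) -> (forall v, `|v| <= a1 * `|'d Q x0 v|) -> `|Q x0| <= a0 ->
  forall h eta, h = a0 * a1 ^+ 2 * a2 -> eta = a0 * a1 -> h <= 1 / 2 ->
  forall r0 r1, r0 = (1 - Num.sqrt (1 - 2 * h)) / h * a0 * a1 ->
  r1 = (1 + Num.sqrt (1 - 2 * h)) / h * eta -> r0 <= r ->
  (forall k, `|modified_newton Q x0 k - x0| <= r) /\
  (forall k, `|newton Q x0 k - x0| < r /\ invertible_op ('d Q (newton Q x0 k))) /\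
  exists xs : V,
    closed_ball x0 r0 xs /\ Q xs = 0 /\
    (modified_newton Q x0 k @[k --> \oo] --> xs) /\
    (newton Q x0 k @[k --> \oo] --> xs) /\
    (forall k, `|newton Q x0 k - xs| <=
       2 ^ (1 - k%:Z) * (2 * h) ^+ (2 ^ k - 1) * eta) /\
    (forall k, `|modified_newton Q x0 k - xs| <=
       eta / h * (1 - Num.sqrt (1 - 2 * h)) ^+ k.+1) /\
    (h < 1 / 2 ->
       forall y, (ball x0 r `&` ball x0 r1) y -> Q y = 0 -> y = xs) /\
    (h = 1 / 2 ->
       forall y, closed_ball x0 r0 y -> Q y = 0 -> y = xs).
Proof.
move=> a0p a1p a2p C11 bij bnd res h eta hE etaE h_le r0 r1 r0E r1E r0r.
have bK := mulr_gt0 a1p a2p.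
have eta0 : 0 < eta by rewrite etaE mulr_gt0.
have hE' : h = a1 * a2 * eta by rewrite hE etaE; ring.
have h0 : 0 < h by rewrite hE' mulr_gt0.
have hh : a1 * a2 * eta <= 1 / 2 by rewrite -hE'.
have cn : a1 * a2 != 0 by rewrite gt_eqF.
have [a0n a1n a2n] : [/\ a0 != 0, a1 != 0 & a2 != 0] by rewrite !gt_eqF.
have r0k : r0 = kroot (a1 * a2) eta.
  rewrite r0E /kroot -hE' hE; move: (Num.sqrt _) => s; field.
  by rewrite a0n a1n a2n.
have r1k : r1 = (1 + Num.sqrt (1 - 2 * (a1 * a2 * eta))) / (a1 * a2).
  rewrite r1E -hE' etaE hE; move: (Num.sqrt _) => s; field.
  by rewrite a0n a1n a2n.
have st : newton_state Q x0 r a2 x0 a1 eta.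
  split => //; first by rewrite subrr normr0 add0r -r0k.
  by rewrite etaE mulrC ler_wpM2r// ltW.
have r0p : 0 < r0 by rewrite r0k kroot_gt0.
have cb y : closed_ball x0 r0 y -> `|y - x0| <= kroot (a1 * a2) eta.
  by rewrite closed_ballE// /closed_ball_/= distrC -r0k.
split; first by move=> k; exact: modified_newton_in k a2p C11 st.
split.
  move=> k; have [b [e [stk _ _]]] := newton_states k a2p C11 st.
  split; first exact: newton_state_lt stk.
  by case: stk => _ bijk bndk _ _ _ _; exact: inv_op_continuous bndk.
have [xs [xs_ball xs0 xs_cvg xs_rate]] := newton_kantorovich a2p C11 st.
have m_cvg := modified_newton_cvg a2p C11 st xs_ball xs0.
exists xs; split; first by rewrite closed_ballE// /closed_ball_/= distrC r0k.
split; first exact: xs0.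
split; first exact: m_cvg.
split; first exact: xs_cvg.
split.
  move=> k; apply: (le_trans (xs_rate k)).
  by rewrite exprz_1B -hE' !mulrA.
split.
  move=> k; apply: (le_trans (modified_newton_rate k a2p C11 st xs_ball xs0)).
  apply: (le_trans (majorant_geometric k bK eta0 hh)).
  have -> : eta / h = (a1 * a2)^-1.
    by rewrite hE'; field; rewrite a1n a2n gt_eqF.
  by rewrite mul_kroot// -hE' exprS /kroot -hE' mulrA [_^-1 * _]mulrC.
split=> [hlt y [yr yr1] y0|heq y /cb yr y0].
  have cy : modified_newton Q x0 @ \oo --> y.
    apply: (modified_newton_cvg_large a2p C11 st) => //.
      by move: yr; rewrite -ball_normE /ball_/= distrC => /ltW.
    by move: yr1; rewrite -ball_normE /ball_/= distrC r1k.
  exact: cvg_unique cy m_cvg.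
have cy := modified_newton_cvg a2p C11 st yr y0.
exact: cvg_unique cy m_cvg.
Qed.

Theorem theorem3p4 (R : realType) (n : nat) (tau : R) (htau : 0 < tau)
  (D : set 'cV[R]_n) (Dopen : open D) (Dconn : connected D) (D0 : D 0)
  (A : 'M[R]_n) (g : 'cV[R]_n -> 'cV[R]_n) (gC1 : Ckv D 1 g)
  (A1 : \det (expmx (- tau *: A) - 1%:M) != 0)
  (L M omega : R) (L_ge0 : 0 <= L) (M_ge1 : 1 <= M) (omega_gt0 : 0 < omega)
  (A2g : forall xi, D xi -> opnorm2 (jacobian_mx g xi) <= L)
  (A2e : forall t : R, - tau <= t <= tau ->
     opnorm2 (expmx (t *: A)) <= M * expR (omega * `|t|))
  (A5 : Sconst tau A L M omega < 1)
  (gC2 : Ckv D 2 g)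
  (Hbar : R) (Hbar_ge0 : 0 <= Hbar)
  (A6 : forall (k : 'I_n) xi, D xi ->
     opnorm2 (hessian_mx (coordf g k) xi) <= Hbar)
  (x0 : CX tau n) (x0D : X_in D x0)
  (u : R -> 'cV[R]_n) (uLoo : Linfty tau u)
  (r : R) (r_gt0 : 0 < r) (Br : closed_ball x0 r `<=` X_in D) :
  let P := Pop A g u : CX tau n -> CX tau n in
  let eta := rho0 A g M omega x0 u * rho1 tau A L M omega in
  let h := rho0 A g M omega x0 u * rho1 tau A L M omega ^+ 2 *
           rho2 tau A M omega Hbar in
  let r0 := (1 - Num.sqrt (1 - 2 * h)) / h *
            rho0 A g M omega x0 u * rho1 tau A L M omega in
  let r1 := (1 + Num.sqrt (1 - 2 * h)) / h * eta in
  let x_ := modified_newton P x0 in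
  let xt_ := newton P x0 in
  0 < h -> h <= 1 / 2 -> r0 <= r ->
  (* the two schemes are well defined *)
  differentiable P x0 /\ invertible_op ('d P x0) /\
  (forall k, X_in D (x_ k)) /\
  (forall k, X_in D (xt_ k) /\ differentiable P (xt_ k) /\
     invertible_op ('d P (xt_ k))) /\
  exists xs : CX tau n,
    closed_ball x0 r0 xs /\ P xs = 0 /\
    (x_ k @[k --> \oo] --> xs) /\ (xt_ k @[k --> \oo] --> xs) /\
    (forall k, `|xt_ k - xs| <= 2 ^ (1 - k%:Z) * (2 * h) ^+ (2 ^ k - 1) * eta) /\
    (forall k, `|x_ k - xs| <= eta / h * (1 - Num.sqrt (1 - 2 * h)) ^+ k.+1) /\
    (h < 1 / 2 ->
       forall y, (ball x0 r `&` ball x0 r1) y -> P y = 0 -> y = xs) /\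
    (h = 1 / 2 ->
       forall y, closed_ball x0 r0 y -> P y = 0 -> y = xs).
Proof.
move=> P eta h r0 r1 x_ xt_ h_gt0 h_le r0r.
have [u' [bu' hu' uu']] := Linfty_bounded_rep htau uLoo.
have hP := Pop_rep A D0 gC2 uLoo bu' uu'.
have Br' y : `|y - x0| <= r -> X_in D y.
  by move=> yr; apply: Br; rewrite closed_ballE// /closed_ball_/= distrC.
(* For [n = 0] the factor [sqrt n] of [rho2] makes [h] vanish. *)
have n0 : (0 < n)%N.
  rewrite lt0n; apply/eqP => n_eq0; move: h_gt0.
  by rewrite /h /rho2 [in Num.sqrt _]n_eq0 sqrtr0 !mul0r mulr0 ltxx.
have Pdiff := Pop_diff htau Dopen D0 gC2 M_ge1 omega_gt0 A2e A2g Hbar_ge0 A6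
  r_gt0 bu' Br' hP.
have C11 : C11_on_ball P x0 r (rho2 tau A M omega Hbar) :=
  Pop_C11 htau Dopen D0 gC2 M_ge1 omega_gt0 A2e A2g Hbar_ge0 A6
    r_gt0 bu' Br' hP.
have x0r : `|x0 - x0| < r by rewrite subrr normr0.
have [dP0 dP0E] := Pdiff x0 x0r.
have [bij bnd] := dPop_bound htau D0 gC2 L_ge0 M_ge1 omega_gt0 n0 A2e A2g A5 x0D.
rewrite -dP0E in bij.
have {}bnd v : `|v| <= rho1 tau A L M omega * `|'d P x0 v|.
  by rewrite dP0E; exact: bnd.
have res : `|P x0| <= rho0 A g M omega x0 u.
  rewrite /P hP//.
  exact: (Pop_residual_le htau D0 gC2 M_ge1 omega_gt0 A2e bu' hu' x0D).
have a1p : 0 < rho1 tau A L M omega :=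
  rho1_gt0 htau L_ge0 M_ge1 omega_gt0 n0 A5.
have a0p : 0 < rho0 A g M omega x0 u.
  rewrite lt_def (le_trans (normr_ge0 _) res) andbT; apply/eqP => a0_0.
  by move: h_gt0; rewrite /h a0_0 !mul0r ltxx.
have a2p : 0 < rho2 tau A M omega Hbar.
  by move: h_gt0; rewrite /h pmulr_rgt0// mulr_gt0// exprn_gt0.
have [m_in [n_in concl]] := newton_kantorovich_summary a0p a1p a2p C11 bij bnd res
  (erefl h) (erefl eta) h_le (erefl r0) (erefl r1) r0r.
split; first exact: dP0.
split; first exact: inv_op_continuous bij bnd.
split; first by move=> k; exact: Br' (m_in k).
split; last exact: concl.
move=> k; have [xk_r xk_inv] := n_in k.
split; first exact: Br' (ltW xk_r).
by split; [exact: (Pdiff _ xk_r).1|].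
Qed.
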